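(* Consider an $n\times n$ input-queued switch with mean arrival rate matrix $\boldsymbol\lambda=(1-\epsilon)\boldsymbol\nu$. Any scheduling algorithm that lies in the class $\Pi_2$ achieves state-space collapse (SSC), and so its heavy traffic behaviour is MaxWeight-like, i.e. $$\lim_{\epsilon\downarrow0}\epsilon\,\mathbb E\Big[\sum_{i,j}\bar q_{ij}\Big]=\Big(1-\frac1{2n}\Big)\|\tilde{\boldsymbol\sigma}\|^2 .$$
   Context: Switch model. Fix $n$; time slots are $t=0,1,2,\dots$. $\mathbf q(t)\in\mathbb Z_{\ge0}^{n\times n}$ is the queue length matrix, $\mathbf a(t)\in\mathbb Z_{\ge0}^{n\times n}$ the arrival matrix, and the schedule $\mathbf s(t)$ is an element of the set $\mathcal X$ of $n\times n$ permutation matrices, picked in each slot by a (possibly randomized) scheduling algorithm. The evolution is $q_{ij}(t+1)=\max\{0,\,q_{ij}(t)+a_{ij}(t)-s_{ij}(t)\}$. $\langle\cdot,\cdot\rangle$ and $\|\cdot\|$ are the Frobenius inner product and norm on $\mathbb R^{n\times n}$. Let $\tilde{\mathcal H}_t=\{\mathbf q(0),\mathbf s(0),\mathbf q(1),\dots,\mathbf s(t-1),\mathbf q(t),\mathbf s(t)\}$. Arrivals. (i) For each $(i,j)$, $a_{ij}(t)$ is i.i.d. in $t$; (ii) the arrival processes are independent across pairs $(i,j)$; (iii) $a_{ij}(t)\le a_{\max}<\infty$ for all $i,j,t$, with $a_{\max}$ not depending on $\epsilon$; (iv) $\mathbb P(\mathbf a(t)=\mathbf 0)>0$. $\mathbf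 a(t)$ is independent of $\tilde{\mathcal H}_t$. $\mathbb E[\mathbf a(t)]=\boldsymbol\lambda=(1-\epsilon)\boldsymbol\nu$, where $\epsilon\in(0,1)$ and $\boldsymbol\nu$ is a fixed doubly stochastic matrix with $\nu_{\min}=\min_{ij}\nu_{ij}>0$. $\sigma_{ij}^2=\mathrm{Var}(a_{ij}(t))$. One considers a family of systems indexed by $\epsilon$ ($n$, $\boldsymbol\nu$ fixed); the entrywise variances $\boldsymbol\sigma^2$ converge to $\tilde{\boldsymbol\sigma}^2$ as $\epsilon\downarrow0$. Markov chain. It is assumed that there is a process $X(t)$ associated with the switch that forms a Markov chain on a countable state space. Conditions: A.1: $X(t)$ is $\sigma(\tilde{\mathcal H}_t)$-measurable, irreducible and aperiodic. A.2: there is a function $g$ with $\mathbf q(t)=g(X(t))$ and such that $g^{-1}(\mathcal A)$ is finite for every finite $\mathcal A\subset\mathbb Z^{n\times n}$. The switch is stable if $X(t)$ is positive recurrent; then $\bar{\mathbf q}$ denotes the steady-state limit (in distribution) of $\mathbf q(t)$. Cone. $\mathcal S=\{\mathbf x\in\mathbb R^{n\times n}: x_{ij}=w_i+\tilde w_j \text{ for some } w,\tilde w\in\mathbb R^n\}$, $\mathcal K=\mathcal S\cap\mathbb R_{\ge0}^{n\times n}$; $\mathbf x_{\|\mathcal K}$ is the Euclidean (Frobenius) projection of $\mathbf x$ onto $\mathcal K$ and $\mathbf x_{\perp\mathcal K}=\mathbf x-\mathbf x_{\|\mathcal K}$. SSC. A scheduling algorithm achieves SSC if the switch is stable, $X(t)$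 satisfies A.1 and A.2, and there is $\epsilon_0>0$ such that for all $0<\epsilon\le\epsilon_0$, $\mathbb E[\|\bar{\mathbf q}_{\perp\mathcal K}\|^r]\le C_r$ for all $r\in\{1,2,\dots\}$, with constants $C_r$ independent of $\epsilon$. Class $\Pi_2$. A scheduling algorithm lies in $\Pi_2$ if $X(t)$ satisfies A.1 and A.2 and there is a constant $W_2\ge0$, independent of $\epsilon$, such that for every $t\ge0$ and every state $X$, with $\mathbf q=g(X)$, $$\mathbb E[\langle\mathbf q(t),\mathbf s(t)\rangle\mid X(t)=X]\ \ge\ \max_{\mathbf s\in\mathcal X}\langle\mathbf q,\mathbf s\rangle-W_2 .$$ *)

(* Defs.v *)
From HB Require Import structures.
From mathcomp Require Import all_boot all_order all_fingroup all_algebra.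
From mathcomp Require Import all_classical all_reals all_analysis.
Import Order.TTheory GRing.Theory Num.Theory.
Import numFieldNormedType.Exports.

Set Implicit Arguments.
Unset Strict Implicit.
Unset Printing Implicit Defensive.

Local Open Scope classical_set_scope.
Local Open Scope ring_scope.

Definition frob_inner (T : pzSemiRingType) n (x y : 'M[T]_n) : T :=
  \sum_(i < n) \sum_(j < n) x i j * y i j.

(* The canonical norm of ['M[R]_n] in the library is the sup norm. *)
Definition frob_norm (R : realType) n (x : 'M[R]_n) : R :=
  Num.sqrt (frob_inner x x).

Definition doubly_stochastic (R : realType) n (x : 'M[R]_n) : Prop :=
  [/\ forall i j, 0 <= x i j,
      forall i, \sum_(j < n) x i j = 1
    & forall j, \sum_(i < n) x i j = 1].

Definition subspaceS (R : realType) n : set 'M[R]_n :=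
  [set x | exists w w' : 'I_n -> R, forall i j, x i j = w i + w' j].

Definition coneK (R : realType) n : set 'M[R]_n :=
  @subspaceS R n `&` [set x | forall i j, 0 <= x i j].

(* [coneK] is a nonempty closed convex set, so there is exactly one nearest
   point; the default value 0 of [xget] is never used. *)
Definition projK (R : realType) n (x : 'M[R]_n) : 'M[R]_n :=
  xget 0 [set y | coneK y /\
    forall z, coneK z -> frob_norm (x - y) <= frob_norm (x - z)].

Definition perpK (R : realType) n (x : 'M[R]_n) : 'M[R]_n := x - projK x.

(* Queue lengths, arrivals and schedules: natural number matrices, with the
   discrete sigma-algebra. *)
Definition natmx n := 'M[nat]_n.
HB.instance Definition _ n := Countable.on (natmx n).
HB.instance Definition _ n := isPointed.Build (natmx n) (const_mx 0%N).
HB.instance Definition _ n := @isMeasurable.Build default_measure_display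
  (natmx n) discrete_measurable discrete_measurable0
  discrete_measurableC discrete_measurableU.

Definition real_mx (R : realType) n (q : natmx n) : 'M[R]_n :=
  map_mx (fun k : nat => k%:R) q.

Definition max_weight n (q : natmx n) : nat :=
  \max_(s : 'S_n) frob_inner q (perm_mx s : 'M[nat]_n).

(* Both notions are for random variables with values in a countable type. *)
Definition independent (R : realType) d (T : measurableType d)
    (P : probability T R) (A B : Type) (Y : T -> A) (Z : T -> B) : Prop :=
  forall (U : set A) (V : set B),
    P (Y @^-1` U `&` Z @^-1` V) = (P (Y @^-1` U) * P (Z @^-1` V))%E.

Definition mutually_independent (R : realType) d (T : measurableType d)
    (P : probability T R) (I : eqType) (A : Type) (Y : I -> T -> A) : Prop :=
  forall (J : seq I) (B : I -> set A), uniq J ->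
    fine (P [set w | forall i, i \in J -> B i (Y i w)]) =
    \prod_(i <- J) fine (P (Y i @^-1` B i)).

(* Expectation of f given E, meaningful for an event E of positive probability. *)
Definition cond_expectation (R : realType) d (T : measurableType d)
    (P : probability T R) (E : set T) (f : T -> R) : R :=
  fine (\int[P]_(w in E) (f w)%:E) / fine (P E).

Section MarkovChains.
Variables (R : realType) (S : countType).
Implicit Type p : S -> S -> R.

Definition stochastic p : Prop :=
  (forall x y, 0 <= p x y) /\
  (forall x, \esum_(y in [set: S]) (p x y)%:E = 1%E).

Definition markov_chain d (T : measurableType d) (P : probability T R)
    p (X : nat -> T -> S) : Prop :=
  stochastic p /\
  forall (t : nat) (x : nat -> S),
    P [set w | forall k, (k <= t.+1)%N -> X k w = x k] =
    (P [set w | forall k, (k <= t)%N -> X k w = x k] *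
     (p (x t) (x t.+1))%:E)%E.

Fixpoint nstep p (k : nat) (x y : S) : \bar R :=
  if k is k'.+1 then
    \esum_(z in [set: S]) ((p x z)%:E * nstep p k' z y)%E
  else (x == y)%:R%:E.

Definition irreducible p : Prop :=
  forall x y, exists k, (0 < nstep p k x y)%E.

(* The return times to x have greatest common divisor 1. *)
Definition aperiodic p : Prop :=
  forall x (d : nat),
    (forall k, (0 < k)%N -> (0 < nstep p k x x)%E -> (d %| k)%N) -> d = 1%N.

(* Probability that the chain started at x visits y at time k for the first
   time after time 0. *)
Fixpoint first_passage p (k : nat) (x y : S) : \bar R :=
  match k with
  | 0 => 0%E
  | 1 => (p x y)%:E
  | k'.+1 => \esum_(z in ~` [set y]) ((p x z)%:E * first_passage p k' z y)%E
  end.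

(* From every state, return is almost sure and has finite mean time. *)
Definition positive_recurrent p : Prop :=
  forall x,
    (\sum_(0 <= k <oo) first_passage p k x x = 1)%E /\
    (\sum_(0 <= k <oo) k%:R%:E * first_passage p k x x < +oo)%E.

End MarkovChains.

(* The data of one switch run under one scheduling algorithm. The randomness
   of the algorithm is carried by the law of [schedule]; [trans] is the
   transition matrix of the (time homogeneous) chain X = [chain], and
   [queue_of] is the map g giving the queue lengths from the state. *)
Record switch_system (R : realType) (n : nat) := SwitchSystem {
  disp : measure_display;
  sample : measurableType disp;
  prob : probability sample R;
  queue : nat -> sample -> natmx n;
  arrival : nat -> sample -> natmx n;
  schedule : nat -> sample -> natmx n;
  state : countType;
  chain : nat -> sample -> state;
  trans : state -> state -> R;
  queue_of : state -> natmx n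
}.

Section Switch.
Variables (R : realType) (n : nat).
Implicit Type sw : switch_system R n.

(* q(0), s(0), ..., q(t), s(t) *)
Definition history sw (t : nat) (w : sample sw) : seq (natmx n * natmx n) :=
  mkseq (fun k => (queue k w, schedule k w)) t.+1.

Record is_switch (nu : 'M[R]_n) (amax : nat) (eps : R) sw : Prop := {
  measurable_queue : forall t, measurable_fun setT (@queue _ _ sw t);
  measurable_arrival : forall t, measurable_fun setT (@arrival _ _ sw t);
  measurable_schedule : forall t, measurable_fun setT (@schedule _ _ sw t);
  schedule_perm : forall t (w : sample sw),
    is_perm_mx (schedule t w : 'M[nat]_n);
  (* the truncated subtraction of [nat] is the max with 0 *)
  queue_dynamics : forall t (w : sample sw) i j,
    queue t.+1 w i j = (queue t w i j + arrival t w i j - schedule t w i j)%N;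
  (* i.i.d. in time and independent processes across the pairs (i, j): the
     whole family indexed by (t, (i, j)) is mutually independent *)
  arrival_indep : mutually_independent (prob sw)
    (fun (k : nat * ('I_n * 'I_n)) w => arrival k.1 w k.2.1 k.2.2);
  arrival_same_law : forall t i j (B : set nat),
    prob sw [set w | B (arrival t w i j)] =
    prob sw [set w | B (arrival 0 w i j)];
  arrival_bounded : forall t (w : sample sw) i j, (arrival t w i j <= amax)%N;
  arrival_zero : forall t,
    (0 < prob sw [set w | forall i j, arrival t w i j = 0%N])%E;
  arrival_indep_history : forall t,
    independent (prob sw) (@arrival _ _ sw t) (@history sw t);
  arrival_mean : forall t i j,
    ('E_(prob sw)[fun w => ((arrival t w i j)%:R)%R] =
     ((1 - eps) * nu i j)%:E)%E;
  chain_markov : markov_chain (prob sw) (@trans _ _ sw) (@chain _ _ sw)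
}.

(* By identical distribution in time, slot 0 stands for all slots. *)
Definition arrival_variance sw (i j : 'I_n) : R :=
  fine ('V_(prob sw)[fun w => ((arrival 0 w i j)%:R)%R])%E.

(* The history takes countably many values, so the sigma-algebra generated by
   it consists of the preimages of arbitrary sets of histories. *)
Definition condA1 sw : Prop :=
  [/\ forall t (A : set (state sw)), exists B,
        @chain _ _ sw t @^-1` A = @history sw t @^-1` B,
      irreducible (@trans _ _ sw)
    & aperiodic (@trans _ _ sw)].

Definition condA2 sw : Prop :=
  (forall t (w : sample sw), queue t w = queue_of (chain t w)) /\
  (forall A : set (natmx n), finite_set A ->
     finite_set (@queue_of _ _ sw @^-1` A)).

Definition stable sw : Prop := positive_recurrent (@trans _ _ sw).

(* q(t) converges in distribution to [mu]: on a discrete space every bounded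
   function is a test function. *)
Definition steady_state_law sw (mu : probability (natmx n) R) : Prop :=
  forall f : natmx n -> R, (exists M : R, forall q, `|f q| <= M) ->
    ('E_(prob sw)[fun w => f (queue t w)])%E @[t --> \oo] --> ('E_mu[f])%E.

(* In the next two definitions [sys eps] is the switch with load 1 - eps run
   under the scheduling algorithm considered. *)

Definition in_Pi2 (sys : R -> switch_system R n) : Prop :=
  (forall eps : R, 0 < eps < 1 -> condA1 (sys eps) /\ condA2 (sys eps)) /\
  exists W2 : R, 0 <= W2 /\
    forall eps : R, 0 < eps < 1 ->
    forall (t : nat) (x : state (sys eps)),
      let E := @chain _ _ (sys eps) t @^-1` [set x] in
      (0 < prob (sys eps) E)%E ->
      (max_weight (queue_of x))%:R - W2 <=
      cond_expectation (prob (sys eps)) E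
        (fun w => (frob_inner (queue t w : 'M[nat]_n) (schedule t w))%:R).

Definition achieves_SSC (sys : R -> switch_system R n) : Prop :=
  (forall eps : R, 0 < eps < 1 ->
     [/\ stable (sys eps), condA1 (sys eps) & condA2 (sys eps)]) /\
  exists qbar : R -> probability (natmx n) R,
    (forall eps : R, 0 < eps < 1 -> steady_state_law (sys eps) (qbar eps)) /\
    exists (eps0 : R) (C : nat -> R), 0 < eps0 < 1 /\
      forall eps : R, 0 < eps <= eps0 -> forall r : nat, (0 < r)%N ->
        ('E_(qbar eps)[fun q => (frob_norm (perpK (real_mx R q)) ^+ r)%R]
           <= (C r)%:E)%E.

End Switch.

(* Main.v *)
From HB Require Import structures.
Require Import Defs.
From mathcomp Require Import all_boot all_order all_fingroup all_algebra.
From mathcomp Require Import all_classical all_reals all_analysis.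
From mathcomp Require Import measurable_realfun ring lra zify.
Import Order.TTheory GRing.Theory Num.Theory.
Import numFieldNormedType.Exports.

Set Implicit Arguments.
Unset Strict Implicit.
Unset Printing Implicit Defensive.

Local Open Scope classical_set_scope.
Local Open Scope ring_scope.

(** Write S for the space of the matrices with entries w i + w' j, and z for
    the residual of a queue matrix q after projection onto the cone K.

    The switch first becomes a positive operator.  Irreducibility makes every
    state likely in some slot, bounded arrivals and the finiteness of the
    fibres of g make the rows of the transition matrix finite, and the
    independence of the arrivals from the past shows that the chain moves by
    drawing a schedule from a law depending on the state and, independently,
    an arrival matrix (switch_is_kernel).

    The maximal weight of a schedule dominates the inner product of q with any
    doubly substochastic matrix (max_weight_ge).  Applied to nu it shows that
    the arrival rate minus the mean service has inner product with q at most
    W2 - eps * c * |q|, where c bounds the entries of nu from below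
    (queue_drift).  The row and column sums of z are nonpositive, because z
    lies in the polar of K, so nu + (c / |z|) z is again substochastic; this
    gives a drift of at most W2 - (c / 2) |z| in the direction z, with
    constants that do not depend on eps (max_weight_perp, perp_drift).  As both
    |q| and |z| move by bounded amounts in one slot, the exponentials
    exp (th * |q|) and exp (th * |z|) contract geometrically up to an additive
    constant (geometric_drift), with th and the constants independent of eps
    for z.

    The drift of exp (th * |q|), whose sublevel sets are finite, bounds the mean
    hitting times of a state (taboo_sum_bounded).  This yields positive
    recurrence (kernel_positive_recurrent) and, applied to the diagonal of two
    independent copies of the chain, convergence of all bounded observables to
    constants (coupling_rate, kernel_ergodic).  Tightness turns the limits into
    a probability law on the queue matrices (limit_law_exists), which is the
    steady state.  The drift of exp (th * |z|) then bounds all moments of z in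
    the steady state uniformly in eps (perp_moment): this is the state space
    collapse.

    For the heavy traffic limit, consider the squared norm of the projection of
    q onto S.  The inner product of this projection with every doubly
    stochastic matrix is the total queue divided by n, so the drift of the
    squared norm involves only the total queue, the variances and the unused
    service u (form_next).  Unused service occurs only at queues that stay
    empty, so it is orthogonal to the next queue matrix and pairs with its
    projection onto S only through the residual; the resulting error is at most
    d |z|^2 + (1 / d + 1) * (sum of u) for every d > 0 (unused_form_bound).  In the
    steady state the drifts of the total queue and of the squared norm vanish:
    the mean of the sum of u is eps * n, and
      2 * eps * E[sum of q] / n = (2 / n - 1 / n^2) * (sum of variances) + eps^2
    up to d * E[|z|^2] + (1 / d + 1) * eps * n (steady_balance).  The collapse
    bounds E[|z|^2], and letting eps and then d tend to 0 gives the limit. *)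

(** * Maximal weight and doubly stochastic matrices *)

Section Matching.
Variables (R : realType) (n : nat).

Section Walks.
Variable c : 'I_n -> 'I_n -> R.

Fixpoint walk_reward (i : 'I_n) (p : seq 'I_n) : R :=
  if p is j :: p' then c i j + walk_reward j p' else 0.

Lemma walk_reward_cat i p1 p2 :
  walk_reward i (p1 ++ p2) = walk_reward i p1 + walk_reward (last i p1) p2.
Proof. by elim: p1 i => [|j p1 IH] i /=; rewrite ?add0r// IH addrA. Qed.

Lemma walk_reward_split i p1 y p2 : walk_reward i (p1 ++ y :: p2) =
  walk_reward i (rcons p1 y) + walk_reward y p2.
Proof. by rewrite -cat_rcons walk_reward_cat last_rcons. Qed.

(** For y0 = y the walk is a cycle, and the right-hand side is the part over its
    vertices of the sum attached to the permutation that follows the cycle. *)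
Lemma walk_reward_next y0 y s : uniq (y :: s) ->
  walk_reward y (rcons s y0) = \sum_(z <- y :: s) c z (path.next_at z y0 y s).
Proof.
elim: s y => [|y' s IH] y /=; first by rewrite big_seq1 /= eqxx addr0.
move=> /andP[ynin /IH ->]; rewrite [in RHS]big_cons /= eqxx; congr (_ + _).
apply: eq_big_seq => z zin; case: eqVneq => // zy.
by move: ynin; rewrite -zy zin.
Qed.

Hypothesis perm_le0 : forall s : 'S_n, \sum_i c i (s i) <= 0.
Hypothesis diag0 : forall i, c i i = 0.

(** A simple cycle extends by fixed points to a permutation, and fixed points
    contribute c i i = 0. *)
Lemma cycle_reward_le0 y s : uniq (y :: s) -> walk_reward y (rcons s y) <= 0.
Proof.
move=> us; rewrite walk_reward_next//.
have -> : \sum_(z <- y :: s) c z (path.next_at z y y s) =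
          \sum_(z <- y :: s) c z (next (y :: s) z) by [].
have inj : injective (next (y :: s)) by exact: (can_inj (prev_next us)).
have := perm_le0 (perm inj).
rewrite (bigID (mem (y :: s))) /= [X in _ + X]big1 ?addr0; last first.
  by move=> i ni; rewrite permE next_nth (negbTE ni).
rewrite big_uniq//; under eq_bigr do rewrite permE; by [].
Qed.

(** The cycle returned is simple: it closes at the first repetition met when
    the sequence is read backwards. *)
Lemma not_uniq_split (T : eqType) (s : seq T) : ~~ uniq s ->
  exists s1 y s2 s3, s = s1 ++ y :: s2 ++ y :: s3 /\ uniq (y :: s2).
Proof.
elim: s => // z s IH /=; rewrite negb_and negbK.
have [us|nus] := boolP (uniq s); last first.
  move=> _; have [s1 [y [s2 [s3 [-> u]]]]] := IH nus.
  by exists (z :: s1), y, s2, s3.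
rewrite orbF => zs; case/splitPr: zs us => p1 p2.
rewrite cat_uniq => /and3P[u1 h _]; exists [::], z, p1, p2; split => //=.
by rewrite u1 andbT; apply: contra h => /= ->.
Qed.

(** Cutting a simple cycle out of a walk can only increase its reward, and what
    remains in the end visits each vertex at most once. *)
Lemma walk_reward_bounded : exists B, forall i p, walk_reward i p <= B.
Proof.
pose C := \sum_i \sum_j `|c i j|.
have C0 : 0 <= C by apply: sumr_ge0 => i _; apply: sumr_ge0.
have cC i j : c i j <= C.
  rewrite (le_trans (ler_norm _))// /C (bigD1 i)//= (bigD1 j)//= -addrA lerDl.
  by rewrite addr_ge0 ?sumr_ge0// => k _; apply: sumr_ge0.
have len i p : walk_reward i p <= (size p)%:R * C.
  elim: p i => [|j p IH] i /=; first by rewrite mul0r.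
  by rewrite -natr1 mulrDl mul1r addrC lerD.
exists (n%:R * C) => i p; have [N] := ubnP (size p).
elim: N i p => // N IH i p; rewrite ltnS => sp.
have [u|nu] := boolP (uniq (i :: p)).
  rewrite (le_trans (len _ _))// ler_wpM2r// ler_nat.
  have /(leq_trans (leqnSn _)) := uniq_leq_size u (fun x _ => mem_enum 'I_n x).
  by rewrite size_enum_ord.
have [[|i' s1] [y [s2 [s3 [e us]]]]] := not_uniq_split nu.
  case: e => -> ep; rewrite ep walk_reward_split.
  rewrite -[leRHS]add0r lerD// ?cycle_reward_le0//; apply: IH.
  by move: sp; rewrite ep size_cat /=; lia.
case: e => ei ep.
have -> : walk_reward i p = walk_reward i (s1 ++ y :: s3) +
    walk_reward y (rcons s2 y).
  by rewrite ep !walk_reward_split; ring.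
rewrite -[leRHS]addr0 lerD// ?cycle_reward_le0//; apply: IH.
by move: sp; rewrite ep !size_cat /= size_cat /=; lia.
Qed.

(** If the mean reward of the Markov chain with transition matrix M were
    positive, the best reward of a walk of N steps, averaged over its starting
    point, would grow linearly in N, as the uniform law is stationary for a
    doubly stochastic M; but rewards of walks are bounded. *)
Lemma mean_reward_le0 (M : 'M[R]_n) : doubly_stochastic M ->
  \sum_i \sum_j M i j * c i j <= 0.
Proof.
move=> [M0 Mr Mc].
(* best reward over the walks from i with at most N steps *)
pose u := fix u N i : R :=
  if N is N'.+1 then \big[Num.max/0]_j (c i j + u N' j) else 0.
have [B hB] := walk_reward_bounded.
have uw N i : exists p, u N i <= walk_reward i p.
  elim: N i => [|N IH] i; first by exists [::].
  rewrite /=; apply: (big_ind (fun x => exists p, x <= walk_reward i p)).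
  - by exists [::].
  - by move=> x y [p hp] [q hq]; rewrite /Num.max; case: ifP => _; [exists q|exists p].
  - by move=> j _; have [p hp] := IH j; exists (j :: p); rewrite /= lerD2l.
have uS N i j : c i j + u N j <= u N.+1 i by rewrite /= le_bigmax.
have grow N : N%:R * (\sum_i \sum_j M i j * c i j) <= \sum_i u N i.
  elim: N => [|N IH]; first by rewrite mul0r big1.
  rewrite -natr1 mulrDl mul1r; apply: (@le_trans _ _
     (\sum_i \sum_j M i j * (c i j + u N j))).
    rewrite addrC; under [leRHS]eq_bigr do
      (under eq_bigr do rewrite mulrDr; rewrite big_split).
    rewrite big_split lerD2l /= [leRHS]exchange_big/=.
    rewrite (le_trans IH)// le_eqVlt; apply/orP; left; apply/eqP/eq_bigr => j _.
    by rewrite -mulr_suml Mc mul1r.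
  apply: ler_sum => i _; rewrite -[leRHS]mul1r -(Mr i) mulr_suml.
  by apply: ler_sum => j _; rewrite ler_wpM2l.
have bnd N : \sum_i u N i <= \sum_(i < n) B.
  by apply: ler_sum => i _; have [p /le_trans] := uw N i; apply.
rewrite leNgt; apply/negP; set m := (X in 0 < X) in grow * => m0.
have B0 : 0 <= \sum_(i < n) B by rewrite (le_trans _ (bnd 0%N))//= big1.
have := archi_boundP (divr_ge0 B0 (ltW m0)).
by rewrite ltr_pdivrMr// ltNge (le_trans (grow _)).
Qed.

End Walks.

Lemma frob_inner_perm (q : natmx n) (s : 'S_n) :
  frob_inner q (perm_mx s : 'M[nat]_n) = (\sum_i q i (s i))%N.
Proof.
rewrite /frob_inner; apply: eq_bigr => i _.
rewrite (bigD1 (s i))//= big1 ?addr0; last first.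
  by move=> j /negbTE jn; rewrite !mxE eq_sym jn mulr0.
by rewrite !mxE eqxx mulr1.
Qed.

(** Fix an optimal permutation s0 and let c i j be the gain of serving at i the
    output that s0 gives to j instead of its own.  Optimality says that the
    total gain over a permutation is nonpositive, and mean_reward_le0 passes
    from permutations to doubly stochastic matrices. *)
Lemma max_weight_ds (q : natmx n) (M : 'M[R]_n) : doubly_stochastic M ->
  frob_inner (real_mx R q) M <= (max_weight q)%:R.
Proof.
move=> dsM; have [M0 Mr Mc] := dsM.
have [s0 hs0] : {s0 : 'S_n | max_weight q = frob_inner q (perm_mx s0 : 'M[nat]_n)}.
  have /(@bigop.eq_bigmax _ (fun s : 'S_n => frob_inner q (perm_mx s : 'M[nat]_n) : nat)) :
      (0 < #|{: 'S_n}|)%N by apply/card_gt0P; exists 1%g.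
  by case=> s0 h; exists s0.
pose c i j : R := (q i (s0 j))%:R - (q i (s0 i))%:R.
have cp (s : 'S_n) : \sum_i c i (s i) <= 0.
  rewrite big_split /= sumrN subr_le0 -!natr_sum ler_nat -frob_inner_perm -hs0.
  have := @bigop.leq_bigmax _ (fun s : 'S_n => frob_inner q (perm_mx s : 'M[nat]_n) : nat) (s * s0)%g.
  apply: leq_trans; rewrite frob_inner_perm.
  by rewrite leq_eqVlt; apply/orP; left; apply/eqP/eq_bigr => i _; rewrite permM.
have c0 i : c i i = 0 by rewrite /c subrr.
pose M' : 'M[R]_n := \matrix_(i, j) M i (s0 j).
have dsM' : doubly_stochastic M'.
  split=> [i j|i|j]; first by rewrite mxE.
    rewrite -(Mr i) [RHS](reindex_inj (@perm_inj _ s0)) /=.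
    by apply: eq_bigr => j _; rewrite mxE.
  by rewrite -(Mc (s0 j)); apply: eq_bigr => i _; rewrite mxE.
have := mean_reward_le0 cp c0 dsM'; rewrite -subr_ge0 sub0r -subr_ge0.
move=> h; rewrite -subr_ge0; apply: le_trans h _; rewrite subr0.
rewrite le_eqVlt; apply/orP; left; apply/eqP.
have -> : frob_inner (real_mx R q) M = \sum_i \sum_j M' i j * (q i (s0 j))%:R.
  apply: eq_bigr => i _; rewrite (reindex_inj (@perm_inj _ s0)) /=.
  by apply: eq_bigr => j _; rewrite !mxE mulrC.
rewrite hs0 frob_inner_perm natr_sum -sumrN -sumrB; apply: eq_bigr => i _.
have -> : (q i (s0 i))%:R = \sum_j M' i j * (q i (s0 i))%:R :> R.
  by case: dsM' => _ h _; rewrite -mulr_suml h mul1r.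
by rewrite -sumrN -sumrB; apply: eq_bigr => j _; rewrite /c; ring.
Qed.

(** A substochastic matrix lies below a doubly stochastic one: the row deficits
    r and the column deficits k have the same sum D, and adding the matrix
    r i * k j / D fills all of them at once. *)
Lemma max_weight_ge (q : natmx n) (M : 'M[R]_n) :
  (forall i j, 0 <= M i j) -> (forall i, \sum_j M i j <= 1) ->
  (forall j, \sum_i M i j <= 1) ->
  frob_inner (real_mx R q) M <= (max_weight q)%:R.
Proof.
move=> M0 Mr Mc.
pose r i := 1 - \sum_j M i j; pose k j := 1 - \sum_i M i j.
have r0 i : 0 <= r i by rewrite subr_ge0.
have k0 j : 0 <= k j by rewrite subr_ge0.
pose D := \sum_i r i.
have DE : D = \sum_j k j.
  by rewrite /D /r /k !sumrB; congr (_ - _); rewrite exchange_big.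
have D0 : 0 <= D by apply: sumr_ge0.
pose M' : 'M[R]_n := \matrix_(i, j) (M i j + r i * k j / D).
have rD i : D = 0 -> r i = 0.
  by move/eqP; rewrite psumr_eq0// => /allP/(_ i) h; apply/eqP/h; rewrite mem_index_enum.
have kD j : D = 0 -> k j = 0.
  by rewrite DE => /eqP; rewrite psumr_eq0// => /allP/(_ j) h; apply/eqP/h; rewrite mem_index_enum.
have ds : doubly_stochastic M'.
  split=> [i j|i|j]; first by rewrite mxE addr_ge0// divr_ge0// mulr_ge0.
  - under eq_bigr do rewrite mxE; rewrite big_split /= -mulr_suml -mulr_sumr -DE.
    have [Dz|Dn] := eqVneq D 0; last by rewrite mulfK// addrC subrK.
    by rewrite rD// !mul0r addr0; move/rD: Dz => /(_ i)/eqP; rewrite subr_eq0 => /eqP.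
  - under eq_bigr do rewrite mxE; rewrite big_split /= -!mulr_suml.
    have [Dz|Dn] := eqVneq D 0; last by rewrite mulrAC divff// mul1r addrC subrK.
    rewrite (kD j)// !mulr0 mul0r addr0; move/kD: Dz => /(_ j)/eqP.
    by rewrite subr_eq0 => /eqP.
apply: le_trans (max_weight_ds q ds).
apply: ler_sum => i _; apply: ler_sum => j _; rewrite !mxE ler_wpM2l//.
by rewrite lerDl divr_ge0// mulr_ge0.
Qed.

End Matching.

(** * The Frobenius inner product *)
Section Frobenius.
Variables (R : realType) (n : nat).
Implicit Types x y z : 'M[R]_n.

Lemma frob_innerC x y : frob_inner x y = frob_inner y x.
Proof. by apply: eq_bigr => i _; apply: eq_bigr => j _; rewrite mulrC. Qed.

Lemma frob_innerDl x y z : frob_inner (x + y) z = frob_inner x z + frob_inner y z.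
Proof.
rewrite /frob_inner -big_split; apply: eq_bigr => i _ /=.
by rewrite -big_split; apply: eq_bigr => j _ /=; rewrite mxE mulrDl.
Qed.

Lemma frob_innerZl a x y : frob_inner (a *: x) y = a * frob_inner x y.
Proof.
rewrite /frob_inner mulr_sumr; apply: eq_bigr => i _.
by rewrite mulr_sumr; apply: eq_bigr => j _; rewrite mxE mulrA.
Qed.

Lemma frob_innerNl x y : frob_inner (- x) y = - frob_inner x y.
Proof. by rewrite -scaleN1r frob_innerZl mulN1r. Qed.

Lemma frob_innerDr x y z : frob_inner x (y + z) = frob_inner x y + frob_inner x z.
Proof. by rewrite frob_innerC frob_innerDl !(frob_innerC x). Qed.

Lemma frob_innerZr a x y : frob_inner x (a *: y) = a * frob_inner x y.
Proof. by rewrite frob_innerC frob_innerZl frob_innerC. Qed.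

Lemma frob_innerNr x y : frob_inner x (- y) = - frob_inner x y.
Proof. by rewrite frob_innerC frob_innerNl frob_innerC. Qed.

Lemma frob_inner_ge0 x : 0 <= frob_inner x x.
Proof.
by apply: sumr_ge0 => i _; apply: sumr_ge0 => j _; rewrite -expr2 sqr_ge0.
Qed.

Lemma frob_norm_ge0 x : 0 <= frob_norm x.
Proof. exact: sqrtr_ge0. Qed.

Lemma frob_norm_sqr x : frob_norm x ^+ 2 = frob_inner x x.
Proof. by rewrite sqr_sqrtr// frob_inner_ge0. Qed.

Lemma frob_norm_le x y :
  (frob_norm x <= frob_norm y) = (frob_inner x x <= frob_inner y y).
Proof. by rewrite ler_sqrt// frob_inner_ge0. Qed.

Lemma frob_inner_sqrD x y : frob_inner (x + y) (x + y) =
  frob_inner x x + 2 * frob_inner x y + frob_inner y y.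
Proof. rewrite frob_innerDl !frob_innerDr (frob_innerC y x); ring. Qed.

Lemma frob_cauchy x y : frob_inner x y <= frob_norm x * frob_norm y.
Proof.
set a := frob_norm x; set b := frob_norm y.
have a0 : 0 <= a by exact: frob_norm_ge0.
have b0 : 0 <= b by exact: frob_norm_ge0.
have eqn0 u v : frob_norm u = 0 -> frob_inner u v = 0.
  move=> /eqP; rewrite sqrtr_eq0 => u0; rewrite /frob_inner big1// => i _.
  rewrite big1// => j _; apply/eqP; rewrite mulf_eq0 -sqrf_eq0 eq_le sqr_ge0 andbT.
  rewrite (le_trans _ u0)// /frob_inner (bigD1 i)//= (bigD1 j)//= expr2 -addrA lerDl.
  by rewrite addr_ge0// sumr_ge0// => k _; rewrite ?sumr_ge0// => *;
    rewrite -expr2 sqr_ge0.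
have [az|an] := eqVneq a 0; first by rewrite az mul0r eqn0.
have [bz|bn] := eqVneq b 0; first by rewrite bz mulr0 frob_innerC eqn0.
have := frob_inner_ge0 (b *: x + - a *: y).
rewrite frob_inner_sqrD !frob_innerZl !frob_innerZr -!frob_norm_sqr -/a -/b.
have ab0 : 0 < a * b by rewrite mulr_gt0// lt_def ?an ?bn.
by move=> h; rewrite -(ler_pM2l ab0); lra.
Qed.

Lemma frob_normN x : frob_norm (- x) = frob_norm x.
Proof. by rewrite /frob_norm frob_innerNl frob_innerNr opprK. Qed.

Lemma frob_normD x y : frob_norm (x + y) <= frob_norm x + frob_norm y.
Proof.
rewrite -ler_sqr ?nnegrE ?addr_ge0 ?frob_norm_ge0//.
rewrite frob_norm_sqr frob_inner_sqrD sqrrD !frob_norm_sqr.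
by have h := frob_cauchy x y; lra.
Qed.

Lemma ler_entry_frob x i j : `|x i j| <= frob_norm x.
Proof.
rewrite -ler_sqr ?nnegrE ?frob_norm_ge0// frob_norm_sqr real_normK ?num_real//.
rewrite /frob_inner (bigD1 i)//= (bigD1 j)//= expr2 -addrA lerDl.
by rewrite addr_ge0// sumr_ge0// => k _; rewrite ?sumr_ge0// => *;
    rewrite -expr2 sqr_ge0.
Qed.

Lemma frob_norm_le_entries x D : (forall i j, `|x i j| <= D) ->
  frob_norm x <= n%:R * D.
Proof.
move=> xD; have [/eqP n0|n0] := boolP (n == 0%N).
  rewrite /frob_norm /frob_inner big1 => [|i _]; last first.
    by have := ltn_ord i; rewrite {2}n0.
  by rewrite sqrtr0 n0 mul0r.
have D0 : 0 <= D.
  have i0 : 'I_n by case: n n0 => // m _; exact: ord0.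
  by apply: le_trans (xD i0 i0).
rewrite -ler_sqr ?nnegrE ?frob_norm_ge0 ?mulr_ge0// frob_norm_sqr.
apply: (@le_trans _ _ (\sum_(i < n) \sum_(j < n) D ^+ 2)).
  apply: ler_sum => i _; apply: ler_sum => j _; rewrite -expr2.
  by rewrite -real_normK ?num_real// ler_sqr// nnegrE.
rewrite !sumr_const !card_ord -mulrnA -[leLHS]mulr_natr natrM.
by rewrite le_eqVlt; apply/orP; left; apply/eqP; ring.
Qed.

(** * The projection onto the cone *)

Lemma coneK0 : coneK (0 : 'M[R]_n).
Proof.
split=> [|i j]; last by rewrite mxE.
by exists (fun=> 0), (fun=> 0) => i j; rewrite mxE addr0.
Qed.

Lemma coneKD x y : coneK x -> coneK y -> coneK (x + y).
Proof.
move=> [[w [w' h]] x0] [[v [v' k]] y0]; split=> [|i j].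
  exists (fun i => w i + v i), (fun i => w' i + v' i) => i j.
  by rewrite mxE h k addrACA.
by rewrite mxE addr_ge0.
Qed.

Lemma coneKZ a x : 0 <= a -> coneK x -> coneK (a *: x).
Proof.
move=> a0 [[w [w' h]] x0]; split=> [|i j].
  by exists (fun i => a * w i), (fun i => a * w' i) => i j; rewrite mxE h mulrDr.
by rewrite mxE mulr_ge0.
Qed.

Lemma continuous_sumr (T : topologicalType) (I : Type) (s : seq I)
    (f : I -> T -> R) :
  (forall i, continuous (f i)) -> continuous (fun t => \sum_(i <- s) f i t).
Proof.
move=> cf; elim: s => [|i s IH] t.
  by under eq_fun do rewrite big_nil; exact: cvg_cst.
by under eq_fun do rewrite big_cons; apply: cvgD; [exact: cf|exact: IH].
Qed.

(** The cone is the image of a closed set of parameters (w, w').  Choosing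
    the representation with w' i0 = 0 bounds the parameters by the entries, so only
    a compact set of parameters competes with the point 0. *)
Lemma projK_exists (i0 : 'I_n) x : exists y, coneK y /\
  forall z, coneK z -> frob_norm (x - y) <= frob_norm (x - z).
Proof.
pose phi (v : 'rV[R]_(n + n)) : 'M[R]_n :=
  \matrix_(i, j) (v ord0 (lshift n i) + v ord0 (rshift n j)).
have cphi i j : continuous (fun v => phi v i j).
  rewrite (_ : (fun v => _) = (fun v : 'rV[R]_(n + n) =>
      v ord0 (lshift n i) + v ord0 (rshift n j))); last first.
    by apply/funext => v; rewrite mxE.
  by move=> v; apply: continuousD; exact: coord_continuous.
pose B := 4 * frob_norm x.
have B0 : 0 <= B by rewrite mulr_ge0// frob_norm_ge0.
pose A := [set v : 'rV[R]_(n + n) | forall k, `[- B, B]%classic (v ord0 k)] `&`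
  \bigcap_(ij in [set: 'I_n * 'I_n]) [set v | 0 <= phi v ij.1 ij.2].
have cA : compact A.
  apply: compact_closedI.
    by apply: (@rV_compact _ _ (fun=> `[- B, B]%classic)) => _; exact: segment_compact.
  apply: closed_bigI => ij _.
  have := closed_comp (fun v _ => cphi ij.1 ij.2 v) (@closed_ge R 0).
  exact.
have A0 : A !=set0.
  exists 0; split => [k|ij _] /=; rewrite !mxE ?addr0//.
  by rewrite in_itv /= oppr_le0 B0.
pose f v := frob_inner (x - phi v) (x - phi v).
have cf : continuous f.
  apply: continuous_sumr => i; apply: continuous_sumr => j v.
  have h : continuous (fun v => (x - phi v) i j).
    rewrite (_ : (fun v => _) = (fun v => x i j - phi v i j)); last first.
      by apply/funext => u; rewrite !mxE.
    by move=> u; apply: continuousB; [exact: cst_continuous|exact: cphi].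
  by apply: continuousM; exact: h.
have [c cin cmin] := EVT_min_rV A0 cA (continuous_subspaceT cf).
have phiK v : A v -> coneK (phi v).
  case=> _ h; split=> [|i j]; last by exact: (h (i, j)).
  by exists (fun i => v ord0 (lshift n i)), (fun j => v ord0 (rshift n j)) => i j; rewrite mxE.
rewrite inE in cin; exists (phi c); split; first exact: phiK.
move=> z Kz; have [zx|/ltW xz] := leP (frob_norm (x - z)) (frob_norm x).
  have zB i j : `|z i j| <= 2 * frob_norm x.
    apply: le_trans (ler_entry_frob _ _ _) _.
    have -> : z = x + - (x - z) by rewrite opprB addrC subrK.
    by apply: le_trans (frob_normD _ _) _; rewrite frob_normN mulrDl !mul1r lerD2l.
  have [[w [w' h]] z0] := Kz.
  pose v : 'rV[R]_(n + n) := \row_(k < n + n) match fintype.split k with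
    | inl i => z i i0 | inr j => z i0 j - z i0 i0 end.
  have vz : phi v = z.
    apply/matrixP => i j; rewrite !mxE.
    rewrite (unsplitK (inl i : 'I_n + 'I_n)%type) (unsplitK (inr j : 'I_n + 'I_n)%type) !h.
    ring.
  rewrite frob_norm_le -[in leRHS]vz; apply: cmin; rewrite inE; split.
    move=> k /=; rewrite in_itv /= -ler_norml mxE.
    have fx := frob_norm_ge0 x.
    case: (fintype.split k) => i; first by apply: le_trans (zB _ _) _; rewrite /B; lra.
    by apply: le_trans (ler_normB _ _) _; have := zB i0 i; have := zB i0 i0; rewrite /B; lra.
  by move=> [i j] _ /=; rewrite vz.
apply: le_trans xz; rewrite frob_norm_le.
have -> : frob_inner x x = f 0.
  rewrite /f; suff -> : phi 0 = 0 by rewrite subr0.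
  by apply/matrixP => i j; rewrite !mxE addr0.
apply: cmin; rewrite inE; split => [k|ij _] /=; rewrite !mxE ?addr0//.
by rewrite in_itv /= oppr_le0 B0.
Qed.

Hypothesis hn : (0 < n)%N.

Lemma projKP x : coneK (Defs.projK x) /\
  forall z, coneK z -> frob_norm (perpK x) <= frob_norm (x - z).
Proof.
pose nearest := [set y | coneK y /\
  forall z, coneK z -> frob_norm (x - y) <= frob_norm (x - z)].
have ex : exists y, nearest y := projK_exists (Ordinal hn) x.
exact: (@xgetPex _ 0 nearest ex).
Qed.

(** First order condition at t = 0 for the minimum of a quadratic function. *)
Lemma sqr_bound_le0 (a b : R) :
  (forall t, 0 < t -> t < 1 -> 2 * t * a <= t ^+ 2 * b) -> a <= 0.
Proof.
move=> h; rewrite leNgt; apply/negP => a0.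
have b0 : 0 < b.
  have := h 2^-1; rewrite invr_gt0 ltr0n invf_lt1 ?ltr1n// => /(_ isT isT) hh.
  by nra.
pose t := a / (a + b).
have ab : 0 < a + b by rewrite addr_gt0.
have t0 : 0 < t by rewrite divr_gt0.
have t1 : t < 1 by rewrite ltr_pdivrMr// mul1r ltrDl.
have h1 := h _ t0 t1.
have tb : t * b < a by rewrite /t mulrAC ltr_pdivrMr// ltr_pM2l// ltrDr.
have h2 : 0 < t * (2 * a - t * b) by rewrite mulr_gt0//; lra.
lra.
Qed.

(** Moving the projection in the direction z stays in the cone and cannot reduce
    the distance. *)
Lemma perpK_polar x z : coneK z -> frob_inner (perpK x) z <= 0.
Proof.
move=> Kz; have [Kp hp] := projKP x.
apply: (@sqr_bound_le0 _ (frob_inner z z)) => t t0 _.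
have := hp (Defs.projK x + t *: z) (coneKD Kp (coneKZ (ltW t0) Kz)).
have -> : x - (Defs.projK x + t *: z) = perpK x + - t *: z.
  by rewrite opprD addrA scaleNr.
rewrite frob_norm_le [X in _ <= X]frob_inner_sqrD.
by rewrite !(frob_innerZr, frob_innerZl) => h; lra.
Qed.

(** Scaling the projection down stays in the cone as well, which gives the
    inequality opposite to perpK_polar. *)
Lemma perpK_orth x : frob_inner (perpK x) (Defs.projK x) = 0.
Proof.
have [Kp hp] := projKP x; apply/eqP; rewrite eq_le perpK_polar//=.
rewrite -oppr_le0; apply: (@sqr_bound_le0 _ (frob_inner (Defs.projK x) (Defs.projK x))) => t t0 t1.
have := hp ((1 - t) *: Defs.projK x) (coneKZ _ Kp).
rewrite subr_ge0 (ltW t1) => /(_ isT); rewrite frob_norm_le.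
have -> : x - (1 - t) *: Defs.projK x = perpK x + t *: Defs.projK x.
  by rewrite scalerBl scale1r opprB /perpK addrA addrAC.
rewrite [X in _ <= X]frob_inner_sqrD.
by rewrite !(frob_innerZr, frob_innerZl) => h; lra.
Qed.

(** The projection of x is a competitor in the minimisation that defines the
    projection of y; hence the residual norm moves no more than the point. *)
Lemma perpK_shift x y : frob_norm (perpK y) <= frob_norm (perpK x + (y - x)).
Proof.
have [Kp _] := projKP x; have [_ /(_ _ Kp)] := projKP y.
by rewrite (_ : perpK x + (y - x) = y - Defs.projK x)// /perpK addrC addrA subrK.
Qed.

Lemma frob_inner_self_perpK x : frob_inner x (perpK x) = frob_inner (perpK x) (perpK x).
Proof.
have {1}-> : x = Defs.projK x + perpK x by rewrite addrC subrK.
by rewrite frob_innerDl (frob_innerC (Defs.projK x)) perpK_orth add0r.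
Qed.

(** The indicator of a row belongs to the cone. *)
Lemma perpK_row_le0 x i : \sum_j perpK x i j <= 0.
Proof.
have K : coneK (\matrix_(k, l) (k == i)%:R : 'M[R]_n).
  split=> [|k l]; last by rewrite mxE.
  by exists (fun k => (k == i)%:R), (fun=> 0) => k l; rewrite mxE addr0.
have := perpK_polar x K; rewrite /frob_inner (bigD1 i)//= [X in _ + X]big1 ?addr0.
  by under eq_bigr do rewrite mxE eqxx mulr1.
by move=> k /negbTE ki; rewrite big1// => l _; rewrite mxE ki mulr0.
Qed.

Lemma perpK_col_le0 x j : \sum_i perpK x i j <= 0.
Proof.
have K : coneK (\matrix_(k, l) (l == j)%:R : 'M[R]_n).
  split=> [|k l]; last by rewrite mxE.
  by exists (fun=> 0), (fun k => (k == j)%:R) => k l; rewrite mxE add0r.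
have := perpK_polar x K; rewrite /frob_inner.
under eq_bigr => i _.
  rewrite (bigD1 j)//= mxE eqxx mulr1 big1 ?addr0; last first.
    by move=> k /negbTE kj; rewrite mxE kj mulr0.
  over.
by [].
Qed.

End Frobenius.

(** * Drift and hitting times of Markov operators *)
Section Operators.
Variables (R : realType) (S : Type).
Implicit Types (P Q : (S -> R) -> S -> R) (f g h : S -> R).

(** A Markov kernel acts on all real functions here, without any condition of
    measurability or growth; this is meaningful because the kernels considered
    below have finite rows. *)
Record positive_op P : Prop := PositiveOp {
  pop_linear : forall a f g x,
    P (fun y => a * f y + g y) x = a * P f x + P g x;
  pop_le : forall f g, (forall y, f y <= g y) -> forall x, P f x <= P g x
}.

Definition markov_op P : Prop :=
  positive_op P /\ forall x, P (fun=> 1) x = 1.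

Section Positive.
Variables (P : (S -> R) -> S -> R) (hP : positive_op P).

Lemma pop0 x : P (fun=> 0) x = 0.
Proof.
have := pop_linear hP (-1) (fun=> 0) (fun=> 0) x.
under [X in P X]eq_fun do rewrite mulr0 addr0.
by rewrite mulN1r addNr.
Qed.

Lemma popZ a f x : P (fun y => a * f y) x = a * P f x.
Proof.
have := pop_linear hP a f (fun=> 0) x; rewrite pop0 addr0 => <-.
by congr (P _ _); apply/funext => y; rewrite addr0.
Qed.

Lemma popD f g x : P (fun y => f y + g y) x = P f x + P g x.
Proof.
have := pop_linear hP 1 f g x; rewrite mul1r => <-.
by congr (P _ _); apply/funext => y; rewrite mul1r.
Qed.

Lemma popN f x : P (fun y => - f y) x = - P f x.
Proof.
rewrite -mulN1r -popZ; congr (P _ _); apply/funext => y.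
by rewrite mulN1r.
Qed.

Lemma popB f g x : P (fun y => f y - g y) x = P f x - P g x.
Proof. by rewrite popD popN. Qed.

Lemma pop_ge0 f : (forall y, 0 <= f y) -> forall x, 0 <= P f x.
Proof. by move=> f0 x; rewrite -(pop0 x); exact: pop_le. Qed.

Lemma pop_abs f x : `|P f x| <= P (fun y => `|f y|) x.
Proof.
rewrite ler_norml -popN; apply/andP; split; apply: (pop_le hP) => y.
  by rewrite lerNl -normrN ler_norm.
exact: ler_norm.
Qed.

Lemma iter_pop k : positive_op (iter k P).
Proof.
elim: k => [|k IH] //; split=> [a f g x|f g fg x] /=.
  rewrite -(pop_linear hP); congr (P _ _).
  by apply/funext => y; exact: (pop_linear IH).
by apply: (pop_le hP) => y; exact: (pop_le IH).
Qed.

End Positive.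

Lemma mop_cst P : markov_op P -> forall c x, P (fun=> c) x = c.
Proof.
move=> [hP P1] c x; rewrite -[RHS]mulr1 -(P1 x) -(popZ hP).
by congr (P _ _); apply/funext => y; rewrite mulr1.
Qed.

Lemma iter_mop P k : markov_op P -> markov_op (iter k P).
Proof.
move=> mP; have [hP P1] := mP; split; first exact: iter_pop.
by elim: k => [//|k IH] x /=; rewrite (funext IH).
Qed.

(** The kernel killed on entering D: applied k times to the function 1 it gives the
    probability of avoiding D during the first k steps. *)
Definition taboo (D : pred S) P f := P (fun y => if D y then 0 else f y).

Section Taboo.
Variables (P : (S -> R) -> S -> R) (mP : markov_op P) (D : pred S).
Let hP := proj1 mP.

Lemma taboo_pop : positive_op (taboo D P).
Proof.
split=> [a f g x|f g fg x]; rewrite /taboo.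
  rewrite -(pop_linear hP); congr (P _ _); apply/funext => y.
  by case: ifP; rewrite ?mulr0 ?addr0.
by apply: (pop_le hP) => y; case: ifP.
Qed.

Lemma taboo_le k f : (forall y, 0 <= f y) ->
  forall x, iter k (taboo D P) f x <= iter k P f x.
Proof.
move=> f0; elim: k => [//|k IH] x /=; apply: (pop_le hP) => y.
case: ifP => _; last exact: IH.
by apply: (pop_ge0 (iter_pop hP k)).
Qed.

Lemma taboo_ge0 k x : 0 <= iter k (taboo D P) (fun=> 1) x.
Proof. by apply: (pop_ge0 (iter_pop taboo_pop k)). Qed.

Lemma taboo_decr j k x :
  iter (j + k) (taboo D P) (fun=> 1) x <= iter k (taboo D P) (fun=> 1) x.
Proof.
elim: j x => [|j IH] x; first by rewrite add0n.
apply: le_trans (IH x); rewrite addSn iterSr.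
apply: (pop_le (iter_pop taboo_pop _)) => y.
by rewrite -[leRHS](proj2 mP y); apply: (pop_le hP) => z; case: ifP.
Qed.

(** A chain in D at time k + 1 has not avoided D. *)
Lemma taboo_hit k x :
  iter k.+1 (taboo D P) (fun=> 1) x <= 1 - iter k.+1 P (fun y => (D y)%:R) x.
Proof.
rewrite -[X in X - _](proj2 (iter_mop k.+1 mP) x) -(popB (iter_pop hP _)).
rewrite !iterSr; apply: le_trans (taboo_le _ _ _) _.
  by move=> y; apply: (pop_ge0 hP) => z; case: ifP.
apply: (pop_le (iter_pop hP _)) => y; apply: (pop_le hP) => z.
by case: (D z); rewrite ?subrr ?subr0.
Qed.

Variables (W : S -> R) (gam K : R).
Hypotheses (W0 : forall x, 0 <= W x) (g0 : 0 <= gam) (g1 : gam < 1) (K0 : 0 <= K).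
Hypothesis drift : forall x, P W x <= gam * W x + K.

Let K' := K / (1 - gam).

Lemma drift_iter k x : iter k P W x <= gam ^+ k * W x + K'.
Proof.
have sg : 0 < 1 - gam by rewrite subr_gt0.
elim: k x => [|k IH] x; first by rewrite mul1r lerDl divr_ge0// ltW.
rewrite iterSr; apply: (@le_trans _ _ (iter k P (fun y => gam * W y + K) x)).
  by apply: (pop_le (iter_pop hP _)).
rewrite (pop_linear (iter_pop hP k)) (mop_cst (iter_mop k mP)).
apply: (@le_trans _ _ (gam * (gam ^+ k * W x + K') + K)).
  by rewrite lerD2r ler_wpM2l.
rewrite mulrDr mulrA -exprS -addrA lerD2l.
have -> : K = (1 - gam) * K' by rewrite /K' mulrC divfK// gt_eqF.
by rewrite -mulrDl addrCA subrr addr0 mul1r.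
Qed.

(** The function V = 1 + b W decreases by at least s over m steps of the killed
    chain: where W is large the drift of W pays for it, and where W is small
    the loss of mass by hitting D does, provided b is small.  Summing the
    decrements bounds the mean number of steps before D is hit. *)
Lemma taboo_sum_bounded m (del : R) : (0 < m)%N -> 0 < del ->
  (forall x, W x <= (K' + 1) / (1 - gam) ->
     del <= iter m P (fun y => (D y)%:R) x) ->
  exists C : R, 0 <= C /\ forall N x,
    \sum_(k < N) iter k (taboo D P) (fun=> 1) x <= C * (1 + W x).
Proof.
move=> m0 del0 hm; pose T := iter m (taboo D P).
have sg : 0 < 1 - gam by rewrite subr_gt0.
have K'0 : 0 <= K' by rewrite divr_ge0// ltW.
have hT : positive_op T := iter_pop taboo_pop m.
(* b (K' + 1), which dominates the growth b K' of b W, is half of the mass lost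
   in D *)
pose b := del / (2 * (K' + 1)); have b0 : 0 < b.
  by rewrite divr_gt0// mulr_gt0// ltr_wpDl.
pose s := Num.min (del / 2) b; have s0 : 0 < s by rewrite lt_min b0 divr_gt0.
pose V x := 1 + b * W x.
have bK : b * (K' + 1) = del / 2.
  by rewrite /b invfM mulrA divfK// gt_eqF// ltr_wpDl.
have TW x : T W x <= gam * W x + K'.
  apply: le_trans (taboo_le _ W0 _) _; apply: le_trans (drift_iter _ _) _.
  rewrite lerD2r ler_wpM2r//; case: m m0 {hm T hT} => // m _.
  by rewrite exprS ler_piMr// exprn_ile1// ltW.
have T1 x : T (fun=> 1) x <= 1 by have := taboo_decr m 0 x; rewrite addn0.
have TV x : T V x <= V x - s.
  rewrite (_ : V = fun y => b * W y + 1); last by apply/funext => y; rewrite /V addrC.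
  rewrite (pop_linear hT); have sb : s <= b by rewrite ge_min lexx orbT.
  have sd : s <= del / 2 by rewrite ge_min lexx.
  have bTW : b * T W x <= b * (gam * W x + K') by rewrite ler_pM2l.
  have [Wx|/ltW Wx] := leP (W x) ((K' + 1) / (1 - gam)).
    have h1 : T (fun=> 1) x <= 1 - del.
      apply: (@le_trans _ _ (1 - iter m P (fun y => (D y)%:R) x)).
        by move: m0; rewrite /T; case: (m) => // m' _; exact: taboo_hit.
      by rewrite lerD2l lerN2 hm.
    have : b * (gam * W x) <= b * W x by rewrite ler_pM2l// ler_piMl// ltW.
    by move=> h2; nra.
  have : K' + 1 <= W x * (1 - gam) by rewrite -ler_pdivrMr.
  rewrite -(ler_pM2l b0) => h; have T1x := T1 x; nra.
have sumT J x : s * (\sum_(j < J) iter j T (fun=> 1) x) + iter J T V x <= V x.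
  elim: J => [|J IH]; first by rewrite big_ord0 mulr0 add0r.
  apply: le_trans IH; rewrite big_ord_recr /= mulrDr -addrA lerD2l -iterS iterSr.
  rewrite -(popZ (iter_pop hT J)) -(popD (iter_pop hT J)).
  by apply: (pop_le (iter_pop hT J)) => y; rewrite mulr1 -lerBrDl.
have V0 x : 0 <= V x by rewrite addr_ge0// mulr_ge0// ltW.
exists (m%:R / s * (1 + b)); split.
  by apply: mulr_ge0; [apply: divr_ge0 => //; exact: ltW|rewrite addr_ge0// ltW].
move=> N x; apply: (@le_trans _ _ (m%:R / s * V x)); last first.
  rewrite -[leRHS]mulrA ler_wpM2l//; first by apply: divr_ge0 => //; exact: ltW.
  by rewrite /V; have := W0 x => Wx; nra.
(* the tails decrease, so those within a block of m are at most the first *)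
pose u k := iter k (taboo D P) (fun=> 1) x.
have u0 k : 0 <= u k by exact: taboo_ge0.
apply: (@le_trans _ _ (\sum_(k < m * N) u k)).
  rewrite -[leRHS](big_mkord xpredT) [leRHS](@big_cat_nat _ _ _ N)//=; last by rewrite leq_pmull.
  by rewrite big_mkord lerDl sumr_ge0.
have blk J : \sum_(k < m * J) u k <= m%:R * \sum_(j < J) iter j T (fun=> 1) x.
  elim: J => [|J IH]; first by rewrite muln0 !big_ord0 mulr0.
  rewrite big_ord_recr /= mulrDr mulnS addnC -(big_mkord xpredT).
  rewrite (@big_cat_nat _ _ _ (m * J))//= ?leq_addr// big_mkord lerD//.
  rewrite -{1}[(m * J)%N]add0n big_addn addKn /T -iterM mulnC.
  apply: (@le_trans _ _ (\sum_(0 <= i < m) u (J * m)%N)).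
    by apply: ler_sum => i _; exact: taboo_decr.
  by rewrite sumr_const_nat subn0 mulr_natl.
apply: le_trans (blk N) _; rewrite -mulrA ler_wpM2l// mulrC ler_pdivlMr//.
rewrite mulrC; apply: le_trans (sumT N x); rewrite lerDl.
exact: (pop_ge0 (iter_pop hT N)).
Qed.

Lemma taboo_tail_le C N x :
  (forall N x, \sum_(k < N) iter k (taboo D P) (fun=> 1) x <= C * (1 + W x)) ->
  iter N (taboo D P) (fun=> 1) x <= C * (1 + W x) / N.+1%:R.
Proof.
move=> h; rewrite ler_pdivlMr//; apply: le_trans (h N.+1 x).
rewrite mulrC mulr_natl -[in leLHS](card_ord N.+1) -sumr_const.
apply: ler_sum => i _; have /subnK {1}<- : (i <= N)%N by rewrite -ltnS.
exact: taboo_decr.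
Qed.

End Taboo.
End Operators.

(** * Coupling *)
Section Coupling.
Variables (R : realType) (S : eqType) (P : (S -> R) -> S -> R).
Hypothesis mP : markov_op P.
Let hP := proj1 mP.

(** Transition operator of two independent copies of the chain. *)
Definition couple (F : S * S -> R) (xx : S * S) : R :=
  P (fun y => P (fun y' => F (y, y')) xx.2) xx.1.

Lemma couple_mop : markov_op couple.
Proof.
split; last first.
  move=> x; rewrite /couple -[RHS](mop_cst mP 1 x.1).
  by congr (P _ _); apply/funext => y; rewrite (proj2 mP).
split=> [a f g x|f g fg x]; rewrite /couple.
  rewrite -(pop_linear hP); congr (P _ _); apply/funext => y.
  by rewrite -(pop_linear hP).
by apply: (pop_le hP) => y; apply: (pop_le hP) => y'.
Qed.

Lemma iter_couple_prod k (f g : S -> R) x :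
  iter k couple (fun y => f y.1 * g y.2) x = iter k P f x.1 * iter k P g x.2.
Proof.
elim: k x => [//|k IH] x; rewrite !iterS.
rewrite (_ : iter k couple _ = fun y => iter k P f y.1 * iter k P g y.2); last first.
  by apply/funext.
rewrite /couple /= [RHS]mulrC -(popZ hP); congr (P _ _); apply/funext => y.
by rewrite (popZ hP) mulrC.
Qed.

Let diag (x : S * S) := x.1 == x.2.

(** After the two copies have met they have the same law, so a difference comes
    only from the event that they have not met. *)
Lemma coupling_bound (f : S -> R) (M : R) k x x' : (forall y, `|f y| <= M) ->
  `|iter k P f x - iter k P f x'| <=
    2 * M * iter k (taboo diag couple) (fun=> 1) (x, x').
Proof.
move=> fM; elim: k x x' => [|k IH] x x'.
  by rewrite /= mulr1 mulrDl mul1r (le_trans (ler_normB _ _))// lerD.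
rewrite !iterS; set g := iter k P f.
have -> : P g x - P g x' = couple (fun y => g y.1 - g y.2) (x, x').
  rewrite /couple /= -[X in _ - X](mop_cst mP _ x) -(popB hP).
  congr (P _ _); apply/funext => y.
  by rewrite (popB hP) (mop_cst mP).
apply: le_trans (pop_abs (proj1 couple_mop) _ _) _.
rewrite -(popZ (taboo_pop couple_mop diag)); apply: (pop_le (proj1 couple_mop)).
move=> [y y'] /=; rewrite /diag /=; case: eqVneq => [->|_]; last exact: IH.
by rewrite subrr normr0.
Qed.

Variables (W : S -> R) (gam K : R).
Hypotheses (W0 : forall x, 0 <= W x) (g0 : 0 <= gam) (g1 : gam < 1) (K0 : 0 <= K).
Hypothesis drift : forall x, P W x <= gam * W x + K.
Hypothesis minor : forall r : R, exists m z (del : R), [/\ (0 < m)%N, 0 < del &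
  forall x, W x <= r -> del <= iter m P (fun y => (y == z)%:R) x].

(** W x.1 + W x.2 is a drift function for the pair, and where it is small both
    copies reach the same z in m steps with probability at least del * del.  The
    summable, decreasing tail of the meeting time then decays like 1 / k. *)
Lemma coupling_rate : exists C : R, 0 <= C /\ forall k (f : S -> R) (M : R) x x',
  (forall y, `|f y| <= M) ->
  `|iter k P f x - iter k P f x'| <= M * C * (1 + W x + W x') / k.+1%:R.
Proof.
pose W2 (x : S * S) := W x.1 + W x.2.
have W20 x : 0 <= W2 x by rewrite addr_ge0.
have drift2 x : couple W2 x <= gam * W2 x + (2 * K).
  rewrite /couple /W2 /=; under [X in P X]eq_fun do rewrite (popD hP) (mop_cst mP).
  rewrite (popD hP) (mop_cst mP) mulrDr mulrDl mul1r addrACA lerD//.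
have [m [z [del [m0 del0 hm]]]] := minor ((2 * K / (1 - gam) + 1) / (1 - gam)).
have K20 : 0 <= 2 * K by rewrite mulr_ge0.
have [||C [C0 hC]] := taboo_sum_bounded couple_mop (D := diag) W20 g0 g1 K20 drift2 m0
  (del := del * del); first by rewrite mulr_gt0.
  move=> [x x'] Wx.
  apply: (@le_trans _ _ (iter m couple
      (fun y => (y.1 == z)%:R * (y.2 == z)%:R) (x, x'))).
    rewrite (@iter_couple_prod m (fun y => (y == z)%:R) (fun y => (y == z)%:R)) /=.
    apply: ler_pM; [exact: ltW|exact: ltW|apply: hm|apply: hm];
      by apply: le_trans Wx; rewrite /W2 /= ?lerDl ?lerDr.
  apply: (pop_le (iter_pop (proj1 couple_mop) m)) => -[y y'] /=; rewrite /diag /=.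
  have [->|_] := eqVneq y z; last by rewrite mul0r.
  by rewrite mul1r eq_sym.
exists (2 * C); split; first by rewrite mulr_ge0.
move=> k f M x x' fM; have M0 : 0 <= M by apply: le_trans (fM x).
apply: le_trans (coupling_bound k x x' fM) _.
apply: (@le_trans _ _ (2 * M * (C * (1 + W2 (x, x')) / k.+1%:R))).
  apply: ler_wpM2l; first by rewrite mulr_ge0.
  by apply: (taboo_tail_le couple_mop); exact: hC.
rewrite /W2 /= addrA le_eqVlt; apply/orP; left; apply/eqP; ring.
Qed.

(** Comparing the start at x0 with the start at the position after j further
    steps, whose W has bounded mean, shows that the iterates at x0 form a Cauchy
    sequence. *)
Lemma ergodic (f : S -> R) (M : R) : (forall y, `|f y| <= M) ->
  exists l : R, forall x, iter k P f x @[k --> \oo] --> l.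
Proof.
move=> fM; have [C [C0 hC]] := coupling_rate.
have sg : 0 < 1 - gam by rewrite subr_gt0.
have [[x0 _]|noS] := pselect (exists x : S, True); last first.
  by exists 0 => x; exfalso; apply: noS; exists x.
have M0 : 0 <= M by apply: le_trans (fM x0).
pose K' := K / (1 - gam).
have K'0 : 0 <= K' by rewrite divr_ge0// ltW.
pose B := M * C * (1 + 2 * W x0 + K').
have B0 : 0 <= B by rewrite !mulr_ge0// !addr_ge0// mulr_ge0.
have step j k : `|iter (k + j) P f x0 - iter k P f x0| <= B / k.+1%:R.
  rewrite addnC iterD -[X in _ - X](mop_cst (iter_mop j mP) _ x0).
  rewrite -(popB (iter_pop hP j)); apply: le_trans (pop_abs (iter_pop hP j) _ _) _.
  apply: (@le_trans _ _ (iter j P (fun y => M * C / k.+1%:R * W y +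
     M * C / k.+1%:R * (1 + W x0)) x0)).
    apply: (pop_le (iter_pop hP j)) => y; apply: le_trans (hC _ _ _ _ _ fM) _.
    by rewrite le_eqVlt; apply/orP; left; apply/eqP; ring.
  rewrite (pop_linear (iter_pop hP j)) (mop_cst (iter_mop j mP)).
  have := drift_iter mP g0 g1 K0 drift j x0; rewrite -/K' => h.
  have gW : gam ^+ j * W x0 <= W x0 by rewrite ler_piMl// exprn_ile1// ltW.
  rewrite -mulrDr /B mulrAC ler_wpM2r ?invr_ge0// ler_wpM2l ?mulr_ge0//; lra.
have cvx0 : cvgn (fun k => iter k P f x0).
  apply/cauchy_cvgP/cauchy_ballP => e e0.
  near_simpl; near \oo => N.
  exists ([set k | (N <= k)%N], [set k | (N <= k)%N]) => /=.
    by split; exists N => // k.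
  have BN : B / N.+1%:R < e / 2.
    near: N; exists (Num.bound (B / (e / 2))) => // k /= hk.
    rewrite ltr_pdivrMr// mulrC -ltr_pdivrMr ?divr_gt0//.
    apply: (lt_le_trans (archi_boundP _)).
      by rewrite divr_ge0// ltW// divr_gt0.
    by rewrite ler_nat ltnW.
  move=> [a b] /= [Na Nb]; rewrite /ball /=.
  have -> : iter a P f x0 - iter b P f x0 =
    (iter a P f x0 - iter N P f x0) - (iter b P f x0 - iter N P f x0) by ring.
  apply: le_lt_trans (ler_normB _ _) _.
  have := step (a - N)%N N; rewrite subnKC// => h1.
  have := step (b - N)%N N; rewrite subnKC// => h2.
  by apply: le_lt_trans (lerD h1 h2) _; rewrite [ltRHS]splitr ltrD.
exists (limn (fun k => iter k P f x0)) => x.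
have h0 : (fun k => iter k P f x - iter k P f x0) @ \oo --> (0 : R).
  apply/norm_cvg0P; apply: (@squeeze_cvgr _ _ _ _ (fun=> 0)
    (fun k => M * C * (1 + W x + W x0) * k.+1%:R^-1)).
  - by near=> k; rewrite normr_ge0 hC.
  - exact: cvg_cst.
  - have := cvgM (cvg_cst (M * C * (1 + W x + W x0))) (@cvg_harmonic R).
    by rewrite mulr0; apply.
have h := cvgD cvx0 h0; rewrite addr0 in h.
have e : (fun k => iter k P f x) = (fun k => iter k P f x0) \+
    (fun k => iter k P f x - iter k P f x0).
  by apply/funext => k /=; rewrite addrC subrK.
by rewrite e; exact: h.
Unshelve. all: by end_near. Qed.

End Coupling.

(** * Irreducible aperiodic kernels with finite rows *)
Section NumericalSemigroup.
Variable A : nat -> Prop.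
Hypothesis AD : forall j k, A j -> A k -> A (j + k)%N.

Lemma semigroup_mul q k : (0 < q)%N -> A k -> A (q * k)%N.
Proof.
move=> + Ak; elim: q => [//|[|q] IH] _; first by rewrite mul1n.
by rewrite mulSn; apply: AD => //; exact: IH.
Qed.

(** The least positive difference d of two elements k and k + d divides every
    element, by Euclidean division.  Hence d = 1, and from k * k on every number
    is a combination of k and k + 1. *)
Lemma semigroup_cofinite :
  (forall d, (forall k, (0 < k)%N -> A k -> (d %| k)%N) -> d = 1%N) ->
  exists N, forall k, (N <= k)%N -> A k.
Proof.
move=> gcd1.
have [a a0 Aa] : exists2 a, (0 < a)%N & A a.
  apply: contrapT => no; suff : 2%N = 1%N by [].
  by apply: gcd1 => k k0 Ak; exfalso; apply: no; exists k.
pose isdiff d := `[< (0 < d)%N /\ exists k, [/\ (0 < k)%N, A k & A (k + d)%N] >].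
have exd : exists d, isdiff d.
  by exists a; apply/asboolP; split => //; exists a; split => //; exact: AD.
have [d /asboolP[d0 [k [k0 Ak Akd]]] dmin] := ex_minnP exd.
have d1 : d = 1%N.
  apply: gcd1 => b b0 Ab; rewrite /dvdn; apply: contrapT => /negP.
  rewrite -lt0n => r0; have rd := ltn_pmod b d0.
  suff /dmin : isdiff (b %% d)%N by rewrite leqNgt rd.
  apply/asboolP; split => //; have eb := divn_eq b d.
  case: (posnP (b %/ d)) => [q0|q0].
    exists k; split => //; move: eb; rewrite q0 mul0n add0n => <-; exact: AD.
  exists ((b %/ d) * (k + d))%N; split; first by rewrite muln_gt0 q0 addn_gt0 k0.
    exact: semigroup_mul.
  have -> : (b %/ d * (k + d) + b %% d = b + b %/ d * k)%N.
    by rewrite mulnDr -addnA -eb addnC.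
  by apply: AD => //; exact: semigroup_mul.
rewrite d1 in Akd; exists (k * k)%N => N hN.
have eN := divn_eq N k; have rk := ltn_pmod N k0.
have qk : (k <= N %/ k)%N by rewrite leq_divRL.
have -> : N = ((N %/ k - N %% k) * k + N %% k * (k + 1))%N.
  by rewrite mulnBl mulnDr muln1 addnA subnK ?leq_mul2r; lia.
case: (posnP (N %% k)) => [->|r0].
  by rewrite mul0n addn0 subn0; apply: semigroup_mul => //; lia.
by apply: AD; apply: semigroup_mul => //; lia.
Qed.

End NumericalSemigroup.

Section RowFinite.
Variables (R : realType) (S : countType) (p : S -> S -> R) (supp : S -> seq S).
Hypotheses (p0 : forall x y, 0 <= p x y) (us : forall x, uniq (supp x))
  (psupp : forall x y, y \notin supp x -> p x y = 0)
  (psum : forall x, \sum_(y <- supp x) p x y = 1).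

(** The rows are finite with explicit supports, so that the operator is a finite
    sum and accepts every function. *)
Definition kernel_op (f : S -> R) x := \sum_(y <- supp x) p x y * f y.
Local Notation P := kernel_op.

Lemma kernel_mop : markov_op P.
Proof.
split; last by move=> x; rewrite /P -[RHS](psum x); apply: eq_bigr => y _; rewrite mulr1.
split=> [a f g x|f g fg x].
  by rewrite /P mulr_sumr -big_split; apply: eq_bigr => y _ /=; ring.
by apply: ler_sum => y _; rewrite ler_wpM2l.
Qed.
Let hP := proj1 kernel_mop.

Lemma esum_finsupp (r : seq S) (G : S -> R) : uniq r -> (forall y, 0 <= G y) ->
  (forall y, y \notin r -> G y = 0) ->
  \esum_(y in [set: S]) (G y)%:E = (\sum_(y <- r) G y)%:E.
Proof.
move=> ur G0 Gr; rewrite (esumID [set` r]); last by move=> y _; rewrite lee_fin.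
rewrite !setTI [X in (_ + X)%E]esum1 ?adde0; last first.
  by move=> y /= /negP yr; rewrite Gr.
rewrite esum_fset; [|exact: finite_seq|by move=> y _; rewrite lee_fin].
by rewrite -fsbig_seq// sumEFin.
Qed.

Lemma nstepE k x y : nstep p k x y = (iter k P (fun z => (z == y)%:R) x)%:E.
Proof.
elim: k x => [//|k IH] x /=.
rewrite (eq_esum (b := fun z => (p x z * iter k P (fun z => (z == y)%:R) z)%:E)); last first.
  by move=> z _; rewrite IH EFinM.
rewrite (esum_finsupp (us x))//.
  by move=> z; rewrite mulr_ge0// (pop_ge0 (iter_pop hP k)).
by move=> z zs; rewrite psupp// mul0r.
Qed.

(** First passage at time k + 1 means that y is avoided for k steps and then
    entered. *)
Lemma first_passageE k x y : first_passage p k.+1 x y =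
  (iter k (taboo (pred1 y) P) (P (fun z => (z == y)%:R)) x)%:E.
Proof.
elim: k x => [|k IH] x.
  rewrite /= /P; congr _%:E.
  have [yx|yx] := boolP (y \in supp x).
    rewrite (bigD1_seq y)//= eqxx mulr1 big1 ?addr0// => z /negbTE ->.
    by rewrite mulr0.
  rewrite psupp// big_seq big1// => z zx; case: eqP => [zy|]; last by rewrite mulr0.
  by move: yx; rewrite -zy zx.
set F := iter k _ _ in IH *.
rewrite [LHS](_ : _ = \esum_(z in ~` [set y]) ((p x z)%:E * first_passage p k.+1 z y)%E)//.
rewrite esum_mkcond.
rewrite (eq_esum (b := fun z => (p x z * (if pred1 y z then 0 else F z))%:E)); last first.
  move=> z _; rewrite IH /=; have [->|zy] := eqVneq z y.
    by rewrite mulr0 memNset//; apply.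
  by rewrite mem_set//; exact/eqP.
rewrite (esum_finsupp (us x))//.
  move=> z; rewrite mulr_ge0//; case: ifP => // _.
  apply: (pop_ge0 (iter_pop (taboo_pop kernel_mop _) k)) => w.
  by apply: (pop_ge0 hP).
by move=> z zs; rewrite psupp// mul0r.
Qed.

Hypotheses (irr : irreducible p) (aper : aperiodic p).
Local Notation reach k x y := (iter k P (fun z => (z == y)%:R) x).

Lemma reach_mul j k x y z : reach j x y * reach k y z <= reach (j + k) x z.
Proof.
rewrite iterD mulrC -(popZ (iter_pop hP j)); apply: (pop_le (iter_pop hP j)) => w.
case: eqVneq => [->|_]; first by rewrite mulr1.
by rewrite mulr0 (pop_ge0 (iter_pop hP k)).
Qed.

(** The lengths of the loops at y form a semigroup that aperiodicity makes
    cofinite; so each state of F reaches y in m steps for every large m, and a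
    finite F admits a common m. *)
Lemma reach_common (F : set S) y : finite_set F ->
  exists m (del : R), [/\ (0 < m)%N, 0 < del & forall x, F x -> del <= reach m x y].
Proof.
move=> finF.
have hit x : exists N, forall k, (N <= k)%N -> 0 < reach k x y.
  have [N hN] : exists N, forall k, (N <= k)%N -> 0 < reach k y y.
    apply: semigroup_cofinite => [j k hj hk|d hd].
      by apply: lt_le_trans (reach_mul j k y y y); rewrite mulr_gt0.
    apply: (aper (x := y)) => k k0; rewrite nstepE lte_fin; exact: hd.
  have [j] := irr x y; rewrite nstepE lte_fin => hj.
  exists (j + N)%N => k hk; have -> : k = (j + (k - j))%N by lia.
  by apply: lt_le_trans (reach_mul j _ x y y); rewrite mulr_gt0// hN//; lia.
pose N x := projT1 (cid (hit x)).
have hN x k : (N x <= k)%N -> 0 < reach k x y by exact: (projT2 (cid (hit x))).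
pose s := finmap.enum_fset (fset_set F).
have sF x : F x -> x \in s by move=> Fx; rewrite in_fset_set// inE.
pose m := (\max_(x <- s) N x).+1.
pose del := \big[Num.min/1]_(x <- s) reach m x y.
have xm x : x \in s -> 0 < reach m x y.
  by move=> xs; apply: hN; rewrite /m leqW//; apply: bigop.leq_bigmax_seq.
exists m, del; split => //.
  rewrite /del big_seq; apply: (big_ind (fun x => 0 < x)) => //.
    by move=> a b a0 b0; rewrite lt_min a0.
move=> x /sF xs; rewrite /del; elim: s xs {m del xm sF} (m) => // z s IH + m.
rewrite in_cons big_cons ge_min => /orP[/eqP ->|xs]; first by rewrite lexx.
by rewrite IH// orbT.
Qed.

Variables (W : S -> R) (gam K : R).
Hypotheses (W0 : forall x, 0 <= W x) (g0 : 0 <= gam) (g1 : gam < 1) (K0 : 0 <= K).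
Hypothesis drift : forall x, P W x <= gam * W x + K.
Hypothesis Wfin : forall r, finite_set [set x | W x <= r].

Lemma kernel_ergodic (f : S -> R) (M : R) : (forall y, `|f y| <= M) ->
  exists l : R, forall x, iter k P f x @[k --> \oo] --> l.
Proof.
move=> fM; have [[z _]|noS] := pselect (exists x : S, True); last first.
  by exists 0 => x; exfalso; apply: noS; exists x.
apply: (ergodic kernel_mop W0 g0 g1 K0 drift _ fM) => r.
have [m [del [m0 d0 h]]] := reach_common z (Wfin r).
by exists m, z, del.
Qed.

(** With u k the probability of avoiding x for k steps, the return time is k + 1
    with probability u k - u (k + 1).  Its total mass telescopes to 1 - lim u, and Abel
    summation turns its mean into the sum of the u k. *)
Lemma kernel_positive_recurrent : positive_recurrent p.
Proof.
move=> x.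
have [m [del [m0 d0 h]]] := reach_common x (Wfin ((K / (1 - gam) + 1) / (1 - gam))).
have [C [C0 hC]] := taboo_sum_bounded kernel_mop (D := pred1 x) W0 g0 g1 K0 drift m0 d0 h.
pose u k := iter k (taboo (pred1 x) P) (fun=> 1) x.
have fpE k : first_passage p k.+1 x x = (u k - u k.+1)%:E.
  rewrite first_passageE /u iterSr -(popB (iter_pop (taboo_pop kernel_mop _) k)).
  congr (iter k _ _ _)%:E; apply/funext => y.
  rewrite -[X in _ = X - _](proj2 kernel_mop y) -(popB hP); congr (P _ _).
  by apply/funext => z /=; case: eqP; rewrite ?subrr ?subr0.
have u0 k : 0 <= u k by exact: (taboo_ge0 kernel_mop).
have ud k : u k.+1 <= u k by exact: (taboo_decr kernel_mop (pred1 x) 1 k x).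
split.
  apply/cvg_lim => //.
  rewrite -(cvg_shiftS (fun N => \sum_(0 <= k < N) first_passage p k x x)%E).
  have part N : (\sum_(0 <= k < N.+1) first_passage p k x x = (1 - u N)%:E)%E.
    rewrite big_nat_recl// (_ : first_passage p 0 x x = 0%E)// add0e.
    under eq_bigr do rewrite fpE.
    rewrite sumEFin; congr _%:E; elim: N => [|N IH]; first by rewrite big_geq// /u /= subrr.
    by rewrite big_nat_recr//= IH addrA subrK.
  under eq_fun do rewrite part.
  apply: cvg_EFin; first by near=> k.
  have uc : u @ \oo --> (0 : R).
    apply: (@squeeze_cvgr _ _ _ _ (fun=> 0) (fun k => C * (1 + W x) * k.+1%:R^-1)).
    - near=> k; rewrite u0 /=; exact: (taboo_tail_le kernel_mop).
    - exact: cvg_cst.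
    - have := cvgMl_tmp (a := C * (1 + W x)) (@cvg_harmonic R).
      by rewrite mulr0; apply.
  have := cvgB (cvg_cst (1 : R)) uc; rewrite subr0; exact.
have fp0 k : (0 <= first_passage p k x x)%E.
  by case: k => // k; rewrite fpE lee_fin subr_ge0.
apply: (@le_lt_trans _ _ (C * (1 + W x))%:E); last exact: ltry.
apply: lime_le.
  by apply: is_cvg_nneseries => k _ _; rewrite mule_ge0// lee_fin.
near=> N; apply: (@le_trans _ _ (\sum_(0 <= k < N.+1) k%:R%:E * first_passage p k x x)%E).
  by rewrite big_nat_recr//= leeDl// mule_ge0// lee_fin.
rewrite big_nat_recl// mul0e add0e; under eq_bigr do rewrite fpE -EFinM.
rewrite sumEFin lee_fin; apply: le_trans (hC N x).
have -> : \sum_(0 <= i < N) i.+1%:R * (u i - u i.+1) = \sum_(k < N) u k - N%:R * u N.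
  elim: {+}N => [|M IH]; first by rewrite big_geq// big_ord0 mul0r subrr.
  by rewrite big_nat_recr//= IH big_ord_recr /= -[M.+1%:R]natr1; ring.
by rewrite lerBlDr lerDl mulr_ge0.
Unshelve. all: by end_near. Qed.

End RowFinite.

(** * Integration of variables with countably many values *)
Section DiscreteVariables.
Variables (R : realType) (d : measure_display) (T : measurableType d)
  (Pr : probability T R).

(** Preimages of all sets are required, also for real values, so that any function
    of a discrete variable is discrete again. *)
Definition discrete_rv (C : Type) (Y : T -> C) : Prop :=
  forall A : set C, measurable (Y @^-1` A).

Lemma discrete_rv_points (C : countType) (Y : T -> C) :
  (forall c, measurable (Y @^-1` [set c])) -> discrete_rv Y.
Proof.
move=> h A; rewrite (_ : Y @^-1` A =
    \bigcup_c (if `[< A c >] then Y @^-1` [set c] else set0)).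
  by apply: countable_bigcupT_measurable => [|c]; [exact: countableP|case: ifP].
apply/seteqP; split => [w Aw|w [c _]] /=.
  by exists (Y w) => //; rewrite asboolT.
by case: asboolP => // Ac ->.
Qed.

Lemma discrete_rv_comp (C C' : Type) (F : C -> C') (Y : T -> C) :
  discrete_rv Y -> discrete_rv (fun w => F (Y w)).
Proof. by move=> h A; exact: (h (F @^-1` A)). Qed.

Lemma discrete_rv_pair (C C' : countType) (Y : T -> C) (Z : T -> C') :
  discrete_rv Y -> discrete_rv Z -> discrete_rv (fun w => (Y w, Z w)).
Proof.
move=> hY hZ; apply: discrete_rv_points => -[c c'].
rewrite (_ : _ @^-1` _ = Y @^-1` [set c] `&` Z @^-1` [set c']).
  by apply: measurableI.
by apply/seteqP; split => w /= [-> ->].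
Qed.

Lemma discrete_rv_measurable (D : set T) (f : T -> R) : discrete_rv f ->
  measurable_fun D (EFin \o f).
Proof.
move=> hf; apply/measurable_EFinP => mD Y _; apply: measurableI => //.
Qed.

Lemma finite_expectation (C : eqType) (Y : T -> C) (E : set T) (r : seq C)
    (F : C -> R) :
  measurable E -> discrete_rv Y -> (forall w, E w -> Y w \in r) -> uniq r ->
  (forall c, 0 <= F c) ->
  (\int[Pr]_(w in E) (F (Y w))%:E)%E =
  (\sum_(c <- r) F c * fine (Pr (E `&` Y @^-1` [set c])))%:E.
Proof.
move=> mE hY Er ur F0.
pose G c w := ((F c)%:E * (\1_(Y @^-1` [set c]) w)%:E)%E.
rewrite (eq_integral (fun w => (\sum_(c <- r) G c w)%E)); last first.
  move=> w; rewrite inE => Ew; rewrite /G (bigD1_seq (Y w)) ?Er//=.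
  rewrite indicE mem_set// mule1 big1 ?adde0// => c cY.
  by rewrite indicE memNset ?mule0// => e; rewrite -e eqxx in cY.
rewrite ge0_integral_sum//; last first.
- by move=> c w _; rewrite /G -EFinM lee_fin mulr_ge0.
- move=> c; apply: emeasurable_funM; first exact: measurable_cst.
  by apply/measurable_EFinP; apply: measurable_indic; exact: (hY [set c]).
rewrite -sumEFin; apply: eq_bigr => c _; rewrite /G ge0_integralZl_EFin//; last first.
  by apply/measurable_EFinP; apply: measurable_indic; exact: (hY [set c]).
rewrite integral_indic//.
rewrite setIC EFinM fineK//; apply: fin_num_measure; apply: measurableI => //.
Qed.

(** The level sets of Y, indexed by the codes of its values, form a countable
    measurable partition. *)
Lemma piecewise_integral (C : countType) (Y : T -> C) (F G : T -> R) :
  discrete_rv Y -> discrete_rv F -> discrete_rv G ->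
  (forall w, 0 <= F w) -> (forall w, 0 <= G w) ->
  (forall c, \int[Pr]_(w in Y @^-1` [set c]) (F w)%:E =
             \int[Pr]_(w in Y @^-1` [set c]) (G w)%:E)%E ->
  (\int[Pr]_w (F w)%:E = \int[Pr]_w (G w)%:E)%E.
Proof.
move=> hY hF hG F0 G0 FG.
pose D k := Y @^-1` [set c | pickle c = k].
have DT : setT = \bigcup_k D k.
  by apply/seteqP; split => // w _; exists (pickle (Y w)).
have tD : trivIset setT D by move=> i j _ _ [w [/= <- <-]].
have ex (H : T -> R) : discrete_rv H -> (forall w, 0 <= H w) ->
    (\int[Pr]_w (H w)%:E = \sum_(i <oo) \int[Pr]_(w in D i) (H w)%:E)%E.
  move=> hH H0; rewrite {1}DT ge0_integral_bigcup//.
  - by move=> k; exact: hY.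
  - exact: discrete_rv_measurable.
  - by move=> w _; rewrite lee_fin.
rewrite !ex//; apply: eq_eseriesr => k _.
have [[c <-]|no] := pselect (exists c : C, pickle c = k).
  rewrite (_ : D _ = Y @^-1` [set c])//.
  apply/seteqP; split => w; rewrite /D /=; last by move=> <-.
  exact: (pcan_inj pickleK).
rewrite (_ : D k = set0) ?integral_set0//.
by apply/seteqP; split => // w /= e; apply: no; exists (Y w).
Qed.

End DiscreteVariables.

Section Integration.
Variables (R : realType) (d : measure_display) (T : measurableType d)
  (Pr : probability T R).

Lemma piecewise_measure (C : countType) (Y : T -> C) (A B : set T) (c : R) :
  discrete_rv Y -> measurable A -> measurable B -> 0 <= c ->
  (forall y, Pr (A `&` Y @^-1` [set y]) = Pr (B `&` Y @^-1` [set y]) * c%:E)%E ->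
  (Pr A = Pr B * c%:E)%E.
Proof.
move=> hY mA mB c0 h.
have dI (D : set T) (a : R) : measurable D -> discrete_rv (fun w => a * \1_D w).
  move=> mD U.
  rewrite (_ : _ @^-1` U = (if `[< U a >] then D else set0) `|`
                          (if `[< U 0 >] then ~` D else set0)).
    by apply: measurableU; case: ifP => // _; exact: measurableC.
  apply/seteqP; split => w /=; rewrite indicE.
    have [Dw|nDw] := pselect (D w).
      by rewrite mem_set// mulr1 => Ua; left; rewrite asboolT.
    by rewrite memNset// mulr0 => U0; right; rewrite asboolT.
  case; case: asboolP => // Ua Dw; first by rewrite mem_set// mulr1.
  by rewrite memNset// mulr0.
have int (D E : set T) (a : R) : measurable D -> measurable E -> 0 <= a ->
    (\int[Pr]_(w in E) (a * \1_D w)%:E = Pr (D `&` E) * a%:E)%E.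
  move=> mD mE a0; under eq_integral do rewrite EFinM.
  rewrite ge0_integralZl_EFin//; first by rewrite integral_indic// muleC.
  by apply/measurable_EFinP; apply: measurable_indic.
have hYc y : measurable (Y @^-1` [set y]) by exact: hY.
rewrite -[A]setIT -[B]setIT -(int B)// -[LHS]mule1 -(int A)//.
apply: (piecewise_integral hY); [exact: dI|exact: dI| | |].
- by move=> w; rewrite mulr_ge0.
- by move=> w; rewrite mulr_ge0.
- by move=> y; rewrite !int// mule1 h.
Qed.

Lemma bounded_integrable (f : T -> R) (M : R) : discrete_rv f ->
  (forall w, `|f w| <= M) -> Pr.-integrable setT (EFin \o f).
Proof.
move=> df fM; apply: measurable_bounded_integrable => //.
- by rewrite (le_lt_trans (probability_le1 Pr measurableT))// ltry.
- by apply/measurable_EFinP; exact: discrete_rv_measurable.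
- by exists M; split; [exact: num_real|move=> r Mr q _ /=; apply: le_trans (ltW Mr)].
Qed.

Lemma expectation_shift (f : T -> R) (M : R) : discrete_rv f ->
  (forall w, `|f w| <= M) ->
  ('E_Pr[fun w => (f w + M)%R] = 'E_Pr[f] + M%:E)%E.
Proof.
move=> df fM; rewrite unlock -[in RHS](expectation_cst Pr M) unlock -integralD_EFin//.
- exact: (bounded_integrable df fM).
- apply: (@bounded_integrable _ `|M|) => // A.
  rewrite (_ : _ @^-1` A = if `[< A M >] then setT else set0); first by case: ifP.
  by apply/seteqP; split => w /=; case: asboolP.
Qed.

End Integration.

(** * Limit laws of the chain *)
Section DiscreteExpectation.
Variables (R : realType) (n : nat) (mu : probability (natmx n) R).
Implicit Types f h : natmx n -> R.

Lemma measurable_natmx d (U : measurableType d) (f : natmx n -> U) :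
  measurable_fun setT f.
Proof. by []. Qed.

Lemma exp_ge0D f h : (forall q, 0 <= f q) -> (forall q, 0 <= h q) ->
  ('E_mu[fun q => (f q + h q)%R] = 'E_mu[f] + 'E_mu[h])%E.
Proof.
move=> f0 h0; rewrite unlock -ge0_integralD//; try exact: measurable_natmx.
- by move=> q _; rewrite lee_fin.
- by move=> q _; rewrite lee_fin.
Qed.

Lemma exp_le f h : (forall q, 0 <= f q) -> (forall q, f q <= h q) ->
  ('E_mu[f] <= 'E_mu[h])%E.
Proof.
move=> f0 fh; rewrite unlock; apply: ge0_le_integral => //;
  try exact: measurable_natmx.
- by move=> q _; rewrite lee_fin.
- by move=> q _; rewrite lee_fin.
Qed.

Lemma exp_cst (c : R) : ('E_mu[fun=> c] = c%:E)%E.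
Proof. exact: expectation_cst. Qed.

Lemma exp_ge0 f : (forall q, 0 <= f q) -> (0 <= 'E_mu[f])%E.
Proof. by move=> f0; apply: expectation_ge0. Qed.

Lemma exp_shift f (M : R) : (forall q, `|f q| <= M)%R ->
  ('E_mu[fun q => (f q + M)%R] = 'E_mu[f] + M%:E)%E.
Proof. by move=> fM; apply: expectation_shift. Qed.

Lemma exp_indic_sum (r : seq (natmx n)) f : uniq r -> (forall q, 0 <= f q) ->
  ('E_mu[fun q => if q \in r then f q else 0%R] = \sum_(q <- r) (f q)%:E * mu [set q])%E.
Proof.
move=> ur f0; rewrite unlock.
rewrite (_ : (fun q => _) = (fun q => \sum_(p <- r) ((f p)%:E * (\1_[set p] q)%:E)%E)).
  rewrite ge0_integral_sum//; last first.
    by move=> p q _; rewrite -EFinM lee_fin mulr_ge0.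
  apply: eq_bigr => p _; rewrite ge0_integralZl_EFin//.
    by rewrite integral_indic// setIT.
apply/funext => q; case: ifPn => qr.
  rewrite (bigD1_seq q)//= big1 ?adde0.
    by rewrite indicE mem_set// mule1.
  move=> p pq; rewrite indicE memNset ?mule0// => qp.
  by move: pq; rewrite qp eqxx.
rewrite big_seq big1// => p pr; rewrite indicE memNset ?mule0// => qp.
by move: qr; rewrite qp pr.
Qed.

(** Unbounded functions are reached from bounded ones through truncation, which
    is how the test functions of a limit law extend to moments. *)
Lemma exp_truncate f : (forall q, 0 <= f q) ->
  ('E_mu[fun q => Num.min (f q) N%:R%R] @[N --> \oo] --> 'E_mu[f])%E.
Proof.
move=> f0; rewrite unlock.
pose g (N : nat) q := (Num.min (f q) N%:R)%:E.
have lf q : limn (g ^~ q) = (f q)%:E.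
  apply/cvg_lim => //; apply: cvg_EFin; first by near=> N.
  apply: cvg_near_cst; near=> N; apply/eqP; rewrite /= min_l//.
  near: N; exists (Num.bound (f q)) => // k /= hk.
  by apply: (le_trans (ltW (archi_boundP (f0 q)))); rewrite ler_nat.
rewrite (_ : (fun q => (f q)%:E) = (fun q => limn (g ^~ q))); last first.
  by apply/funext => q; rewrite lf.
apply: (@cvg_monotone_convergence _ _ _ mu _ measurableT g) => //.
- by move=> N q _; rewrite lee_fin le_min f0 ler0n.
- by move=> q _ a b ab; rewrite lee_fin le_min ge_min lexx /= ge_min ler_nat ab orbT.
Unshelve. all: by end_near. Qed.

End DiscreteExpectation.

Section LimitLaw.
Variables (R : realType) (n : nat) (S : choiceType) (P : (S -> R) -> S -> R) (x0 : S)
  (g : S -> natmx n).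
Hypothesis mP : markov_op P.
Let hP := proj1 mP.

(** Convergence in distribution of g of the chain to mu, from every initial
    state. *)
Definition limit_law (mu : probability (natmx n) R) : Prop :=
  forall f (M : R), (forall q, `|f q| <= M) -> exists l : R,
    'E_mu[f]%E = l%:E /\ forall x, iter k P (f \o g) x @[k --> \oo] --> l.

Lemma iter_cvg_le (f h : S -> R) (a b : R) : (forall x, f x <= h x) ->
  iter k P f x0 @[k --> \oo] --> a -> iter k P h x0 @[k --> \oo] --> b -> a <= b.
Proof.
move=> fh fa hb; apply: (ler_cvg_to fa hb).
by apply: nearW => k; apply: (pop_le (iter_pop hP k)).
Qed.

Section Existence.
Variables (W : S -> R) (B : R).
Hypothesis erg : forall (f : S -> R) (M : R), (forall y, `|f y| <= M) ->
  exists l : R, forall x, iter k P f x @[k --> \oo] --> l.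
Hypotheses (W0 : forall x, 0 <= W x) (B0 : 0 <= B).
Hypothesis tight : forall k, iter k P W x0 <= B.
Hypothesis Wfin : forall r : R, finite_set [set x | W x <= r].

(** A genuine limit for bounded f, by ergodicity. *)
Definition long_run (f : S -> R) : R := limn (fun k => iter k P f x0).
Local Notation L := long_run.

Lemma long_run_unique f (l : R) : iter k P f x0 @[k --> \oo] --> l -> L f = l.
Proof. by move=> fl; apply/cvg_lim. Qed.

Lemma long_run_cvg f (M : R) : (forall y, `|f y| <= M) ->
  forall x, iter k P f x @[k --> \oo] --> L f.
Proof. by move=> /erg[l hl] x; rewrite (long_run_unique (hl x0)); exact: hl. Qed.

Lemma long_run_le f h (M N : R) : (forall y, `|f y| <= M) -> (forall y, `|h y| <= N) ->
  (forall x, f x <= h x) -> L f <= L h.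
Proof.
by move=> fM hN fh; apply: (iter_cvg_le fh); apply: long_run_cvg.
Qed.

Lemma long_run_linear (a : R) f h (M N : R) :
  (forall y, `|f y| <= M) -> (forall y, `|h y| <= N) ->
  L (fun x => a * f x + h x) = a * L f + L h.
Proof.
move=> fM hN; apply: long_run_unique.
rewrite (_ : (fun k => _) = (fun k => a * iter k P f x0 + iter k P h x0)); last first.
  by apply/funext => k; rewrite (pop_linear (iter_pop hP k)).
apply: cvgD; last exact: long_run_cvg.
by apply: cvgMl_tmp; exact: long_run_cvg.
Qed.

Lemma long_run_cst c : L (fun=> c) = c.
Proof.
apply: long_run_unique; rewrite (_ : (fun k => _) = (fun=> c)); first exact: cvg_cst.
by apply/funext => k; rewrite (mop_cst (iter_mop k mP)).
Qed.

Lemma bool_bound (T : Type) (b : T -> bool) x : `|(b x)%:R| <= 1 :> R.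
Proof. by case: (b x); rewrite ?normr1 ?normr0. Qed.

Lemma long_run_ge0 f (M : R) : (forall y, `|f y| <= M) -> (forall y, 0 <= f y) ->
  0 <= L f.
Proof.
move=> fM f0; rewrite -(long_run_cst 0).
by apply: (@long_run_le _ _ 0 M) => // y; rewrite normr0.
Qed.

(** Markov inequality, uniformly in time. *)
Lemma long_run_tail (r : R) : 0 < r -> L (fun x => (r < W x)%R%:R) <= B / r.
Proof.
move=> r0; have h := long_run_cvg (bool_bound (fun x => r < W x)) x0.
apply: (ler_cvg_to h (cvg_cst (B / r))); apply: nearW => k.
apply: (@le_trans _ _ (iter k P (fun x => r^-1 * W x) x0)).
  apply: (pop_le (iter_pop hP k)) => x; case: ltP => rW.
    by rewrite mulrC ler_pdivlMr// mul1r ltW.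
  by rewrite mulr_ge0// invr_ge0 ltW.
by rewrite (popZ (iter_pop hP k)) mulrC ler_wpM2r// invr_ge0 ltW.
Qed.

Let ind (A : set (natmx n)) (x : S) : R := (`[< A (g x) >])%:R.
Let indB A y : `|ind A y| <= 1 := bool_bound (fun x => `[< A (g x) >]) y.

(** Linearity of the limits gives finite additivity, tightness the rest. *)
Definition limit_measure (A : set (natmx n)) : \bar R := (L (ind A))%:E.
Local Notation m := limit_measure.

Let m0 : m set0 = 0%E.
Proof.
rewrite /m (_ : ind set0 = fun=> 0) ?long_run_cst//.
by apply/funext => x; rewrite /ind asboolF.
Qed.

Let m_ge0 A : (0 <= m A)%E.
Proof. by rewrite lee_fin; apply: (long_run_ge0 (@indB A)) => y; rewrite /ind. Qed.

Let ind_sum (F : (set (natmx n))^nat) N x : trivIset setT F ->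
  \sum_(i < N) ind (F i) x = ind (\bigcup_(i < N) F i) x.
Proof.
move=> tF; rewrite /ind; case: asboolP => [[i /= iN Fi]|no].
  rewrite (bigD1 (Ordinal iN))//= asboolT// big1 ?addr0// => j ji.
  rewrite asboolF// => Fj; move/eqP: ji; apply; apply/val_inj => /=.
  by apply: tF => //; exists (g x); split.
rewrite big1// => i _; rewrite asboolF// => Fi.
by apply: no; exists i => //=.
Qed.

Let m_sum (F : (set (natmx n))^nat) N : trivIset setT F ->
  (\sum_(0 <= i < N) m (F i) = m (\bigcup_(i < N) F i))%E.
Proof.
move=> tF; rewrite /m big_mkord sumEFin; congr _%:E.
rewrite (_ : ind (\bigcup_(i < N) F i) = fun x => \sum_(i < N) ind (F i) x); last first.
  by apply/funext => x; rewrite ind_sum.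
have bd M x : `|\sum_(i < M) ind (F i) x| <= 1 by rewrite ind_sum.
elim: N => [|N IH].
  rewrite big_ord0 (_ : (fun x => _) = fun=> 0) ?long_run_cst//.
  by apply/funext => x; rewrite big_ord0.
rewrite big_ord_recr /= IH addrC -[X in X + _]mul1r.
rewrite -(long_run_linear _ (@indB _) (bd N)); congr (L _); apply/funext => x.
by rewrite big_ord_recr /= mul1r addrC.
Qed.

(** Outside of a finite set of states the mass is at most e, and a finite set of
    states is exhausted by finitely many of the F i. *)
Let m_sigma : semi_sigma_additive m.
Proof.
move=> F _ tF _.
rewrite (_ : (fun N => _) = (fun N => (L (ind (\bigcup_(i < N) F i)))%:E)); last first.
  by apply/funext => N; rewrite m_sum.
apply: cvg_EFin; first by near=> N.
apply/cvgrPdist_le => e e0.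
have r0 : 0 < B / e + 1 by rewrite ltr_wpDl// divr_ge0// ltW.
pose r := B / e + 1; have Br : B / r <= e.
  rewrite ler_pdivrMr// /r mulrDr mulr1 mulrC divfK ?gt_eqF// lerDl ltW//.
pose s := finmap.enum_fset (fset_set [set x | W x <= r]).
have ss x : W x <= r -> x \in s by move=> Wx; rewrite in_fset_set// inE.
have hN : exists N, forall x, x \in s -> (\bigcup_i F i) (g x) ->
    exists2 i, (i < N)%N & F i (g x).
  elim: s {ss} => [|x s [N hN]]; first by exists 0%N.
  have [[i _ Fi]|no] := pselect ((\bigcup_i F i) (g x)).
    exists (maxn N i.+1) => y; rewrite in_cons => /orP[/eqP ->|ys] hy.
      by exists i => //; rewrite leq_max ltnSn orbT.
    by have [j jN Fj] := hN y ys hy; exists j => //; rewrite leq_max jN.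
  exists N => y; rewrite in_cons => /orP[/eqP ->|ys] hy; first by case: no.
  exact: hN.
have [N0 hN0] := hN; near=> N.
have NN : (N0 <= N)%N by near: N; exists N0.
have sub x : ind (\bigcup_(i < N) F i) x <= ind (\bigcup_i F i) x.
  rewrite /ind; case: asboolP => // -[i _ Fi]; rewrite asboolT//; by exists i.
rewrite ger0_norm ?subr_ge0; last exact: (long_run_le (@indB _) (@indB _)).
rewrite lerBlDr; apply: (@le_trans _ _ (1 * L (fun x => (r < W x)%R%:R) +
    L (ind (\bigcup_(i < N) F i)))); last first.
  by rewrite mul1r lerD2r (le_trans _ Br)// long_run_tail.
rewrite -(long_run_linear _ (bool_bound (fun x => r < W x)) (@indB _)).
apply: (long_run_le (@indB _) (N := 2)) => x.
  by rewrite mul1r (le_trans (ler_normD _ _))// (_ : 2 = 1 + 1)// lerD// bool_bound.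
rewrite mul1r /ind; case: asboolP => [Fx|_]; last by rewrite addr_ge0.
case: ltP => Wx; first by rewrite lerDl.
have [i iN Fi] := hN0 x (ss x Wx) Fx.
by rewrite add0r asboolT//; exists i => //=; exact: leq_trans NN.
Unshelve. all: by end_near. Qed.

HB.instance Definition _ := isMeasure.Build _ _ _ m m0 m_ge0 m_sigma.

Let mT : m setT = 1%E.
Proof.
rewrite /m (_ : ind setT = fun=> 1) ?long_run_cst//.
by apply/funext => x; rewrite /ind asboolT.
Qed.

HB.instance Definition _ := Measure_isProbability.Build _ _ _ m mT.

(** It suffices to bound the expectation from below for nonnegative bounded
    functions: the shifts f + M and - f + M give both inequalities.  The lower bound follows by
    restricting the function to the finitely many queue matrices outside of
    which the mass is small. *)
Lemma limit_law_exists : exists mu : probability (natmx n) R, limit_law mu.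
Proof.
pose mu : probability (natmx n) R := m; exists mu.
have ge f (M : R) : (forall q, 0 <= f q <= M) -> ((L (f \o g))%:E <= 'E_mu[f])%E.
  move=> fM; have f0 q : 0 <= f q by have /andP[] := fM q.
  have M0 : 0 <= M by have /andP[h1 h2] := fM (const_mx 0%N); exact: le_trans h2.
  have fgB (h : natmx n -> R) : (forall q, 0 <= h q <= f q) -> forall x, `|(h \o g) x| <= M.
    move=> hf x /=; have /andP[h1 h2] := hf (g x).
    by rewrite ger0_norm// (le_trans h2)//; have /andP[] := fM (g x).
  have ffB := fgB f (fun q => introT andP (conj (f0 q) (lexx _))).
  apply/lee_addgt0Pr => e e0.
  pose r := M * B / e + 1; have r0 : 0 < r by rewrite ltr_wpDl// divr_ge0 ?mulr_ge0// ltW.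
  have Br : M * (B / r) <= e.
    rewrite mulrA ler_pdivrMr// /r mulrDr mulr1 (mulrC e) divfK ?gt_eqF// lerDl ltW//.
  pose s := undup (map g (finmap.enum_fset (fset_set [set x | W x <= r]))).
  have ss x : W x <= r -> g x \in s.
    by move=> Wx; rewrite mem_undup map_f// in_fset_set// inE.
  pose fs q := if q \in s then f q else 0.
  have fs0 q : 0 <= fs q <= f q by rewrite /fs; case: ifP => _; rewrite ?f0 ?lexx.
  apply: (@le_trans _ _ ('E_mu[fs] + e%:E)%E); last first.
    by rewrite leeD2r// exp_le// => q; have /andP[] := fs0 q.
  rewrite exp_indic_sum ?undup_uniq//.
  have -> : (\sum_(q <- s) (f q)%:E * mu [set q] = (L (fs \o g))%:E)%E.
    rewrite /mu /= /m; under eq_bigr do rewrite -EFinM.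
    rewrite sumEFin; congr _%:E.
    rewrite (_ : fs \o g = fun x => \sum_(q <- s) f q * ind [set q] x); last first.
      apply/funext => x; rewrite /fs /ind /=; case: ifPn => gs.
        rewrite (bigD1_seq (g x)) ?undup_uniq//= asboolT// mulr1 big1 ?addr0// => q qx.
        by rewrite asboolF ?mulr0// => e'; rewrite e' eqxx in qx.
      rewrite big_seq big1// => q qs; rewrite asboolF ?mulr0// => e'.
      by move: gs; rewrite e' qs.
    elim: s {ss fs fs0} => [|q s IH].
      rewrite big_nil (_ : (fun x => _) = fun=> 0) ?long_run_cst//.
      by apply/funext => x; rewrite big_nil.
    rewrite big_cons IH -(long_run_linear _ (M := 1) (N := \sum_(p <- s) f p))//.
      by congr (L _); apply/funext => x; rewrite big_cons.
    move=> x; rewrite ger0_norm; last by apply: sumr_ge0 => p _; rewrite mulr_ge0 ?f0.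
    by apply: ler_sum => p _; rewrite ler_piMr ?f0// /ind; case: asboolP.
  rewrite -EFinD lee_fin.
  apply: (@le_trans _ _ (M * L (fun x => (r < W x)%R%:R) + L (fs \o g))).
    rewrite -(long_run_linear _ (bool_bound (fun x => r < W x)) (fgB _ fs0)).
    apply: (long_run_le ffB (N := M + M)) => x.
      apply: le_trans (ler_normD _ _) _; rewrite lerD//; last exact: fgB.
      by rewrite normrM (ger0_norm M0) ler_piMr// bool_bound.
    rewrite /fs /=; case: ltP => Wx.
      rewrite mulr1; case: ifP => _; first by rewrite lerDr.
      by rewrite addr0; have /andP[] := fM (g x).
    by rewrite ss// mulr0 add0r.
  rewrite addrC lerD2l (le_trans _ Br)// ler_wpM2l//; exact: long_run_tail.
move=> f M fM; exists (L (f \o g)); split; last first.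
  by move=> x; apply: (long_run_cvg (M := M)) => y /=.
have M0 : 0 <= M by apply: le_trans (fM (const_mx 0%N)).
have pos h : (forall q, `|h q| <= M) -> ((L (h \o g))%:E <= 'E_mu[h])%E.
  move=> hM; have := ge (fun q => h q + M) (M + M).
  rewrite exp_shift//.
  rewrite (_ : _ \o g = fun x => 1 * (h \o g) x + M); last first.
    by apply/funext => x /=; rewrite mul1r.
  rewrite (long_run_linear _ (M := M) (N := `|M|))//; last by move=> y /=.
  rewrite long_run_cst mul1r EFinD leeD2rE// => H.
  have := H _; apply => q; have := hM q; rewrite ler_norml => /andP[h1 h2].
  by rewrite -lerBlDr sub0r h1 lerD2r.
apply/eqP; rewrite eq_le pos// andbT.
have := pos (fun q => - f q); rewrite (_ : _ \o g = fun x => (-1) * (f \o g) x + 0); last first.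
  by apply/funext => x /=; rewrite mulN1r addr0.
rewrite (long_run_linear _ (M := M) (N := `|0 : R|))//; last by move=> y /=.
rewrite long_run_cst addr0 mulN1r.
have -> : 'E_mu[fun q => (- f q)%R]%E = (- 'E_mu[f])%E.
  have h2 : (forall q, 0 <= - f q + M) /\ (forall q, 0 <= f q + M).
    by split=> q; have := fM q; rewrite ler_norml => /andP[? ?]; lra.
  have e1 := exp_shift mu fM.
  have e2 : ('E_mu[fun q => (- f q + M)%R] = 'E_mu[fun q => (- f q)%R] + M%:E)%E.
    by apply: exp_shift => q; rewrite normrN.
  have := exp_ge0D mu (proj1 h2) (proj2 h2); rewrite e1 e2.
  rewrite (_ : (fun q => - f q + M + (f q + M)) = fun=> M + M); last first.
    by apply/funext => q; ring.
  rewrite exp_cst; case: ('E_mu[f])%E => [a| |]; case: ('E_mu[_])%E => [b| |] //=.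
  by rewrite -!EFinD => -[] h; congr _%:E; lra.
rewrite EFinN leeN2; apply => q; by rewrite normrN.
Qed.

End Existence.

Variables (mu : probability (natmx n) R) (hmu : limit_law mu).

(** Fatou: truncate, pass to the limit, then remove the truncation. *)
Lemma limit_law_le (f : natmx n -> R) (c : R) (b : nat -> R) :
  (forall q, 0 <= f q) -> (forall k, iter k P (f \o g) x0 <= b k) ->
  b @ \oo --> c -> ('E_mu[f] <= c%:E)%E.
Proof.
move=> f0 fb bc; have tr := exp_truncate (mu := mu) f0.
rewrite -(cvg_lim _ tr)//; apply: lime_le; first by apply/cvg_ex; eexists; exact: tr.
apply: nearW => N.
have fN q : `|Num.min (f q) N%:R| <= N%:R.
  by rewrite ger0_norm; [rewrite ge_min lexx orbT|rewrite le_min f0 ler0n].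
have [l [-> hl]] := hmu fN; rewrite lee_fin.
apply: (ler_cvg_to (hl x0) bc); apply: nearW => k; apply: le_trans (fb k).
by apply: (pop_le (iter_pop hP k)) => x /=; rewrite ge_min lexx.
Qed.

(** Bounded second moments make f uniformly integrable, as the excess of f over N
    is at most f^2 / N. *)
Lemma limit_law_cvg (f : natmx n -> R) (B : R) :
  (forall q, 0 <= f q) -> (forall k, iter k P ((fun q => f q ^+ 2) \o g) x0 <= B) ->
  exists l : R, 'E_mu[f]%E = l%:E /\ iter k P (f \o g) x0 @[k --> \oo] --> l.
Proof.
move=> f0 fB.
have B0 : 0 <= B by apply: le_trans (fB 0%N); rewrite /= sqr_ge0.
pose fN (N : nat) q := Num.min (f q) N.+1%:R.
have excess N q : f q - fN N q <= N.+1%:R^-1 * f q ^+ 2.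
  rewrite /fN mulrC ler_pdivlMr//; case: (leP (f q) N.+1%:R) => h.
    by rewrite subrr mul0r sqr_ge0.
  have := f0 q; have : 0 <= N.+1%:R :> R by []; nra.
have exc0 N q : 0 <= f q - fN N q by rewrite subr_ge0 /fN ge_min lexx.
have excB N k : iter k P ((fun q => f q - fN N q) \o g) x0 <= N.+1%:R^-1 * B.
  apply: (@le_trans _ _ (iter k P (fun x => N.+1%:R^-1 * f (g x) ^+ 2) x0)).
    by apply: (pop_le (iter_pop hP k)) => x; exact: excess.
  by rewrite (popZ (iter_pop hP k)) ler_wpM2l.
have fN0 N q : 0 <= fN N q by rewrite /fN le_min f0 ler0n.
have fNb N q : `|fN N q| <= N.+1%:R.
  by rewrite ger0_norm ?fN0// /fN ge_min lexx orbT.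
have Ef N : exists l d : R, [/\ 'E_mu[f]%E = (l + d)%:E, 0 <= d, d <= N.+1%:R^-1 * B &
    iter k P (fN N \o g) x0 @[k --> \oo] --> l].
  have [l [hl cl]] := hmu (fNb N).
  have : ('E_mu[fun q => (f q - fN N q)%R] <= (N.+1%:R^-1 * B)%:E)%E.
    by apply: (limit_law_le (exc0 N) (excB N)); exact: cvg_cst.
  have := exp_ge0 mu (exc0 N).
  have := exp_ge0D mu (fN0 N) (exc0 N).
  rewrite (_ : (fun q => fN N q + (f q - fN N q)) = f); last first.
    by apply/funext => q; rewrite addrC subrK.
  move=> ->; rewrite hl; case: ('E_mu[_])%E => [d| |].
  - by rewrite !lee_fin => d0 dB; exists l, d.
  - by move=> _; rewrite leye_eq => /eqP.
  - by rewrite leeNy_eq => /eqP.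
have [l hl] : exists l : R, 'E_mu[f]%E = l%:E by have [l [d [-> _ _ _]]] := Ef 0%N; eexists.
exists l; split => //; apply/cvgrPdist_le => e e0.
have [N hN] : exists N : nat, N.+1%:R^-1 * B <= e / 3.
  exists (Num.bound (B / (e / 3))); rewrite mulrC ler_pdivrMr// mulrC -ler_pdivrMr ?divr_gt0//.
  apply: ltW; apply: lt_le_trans (archi_boundP _) _; last by rewrite ler_nat.
  by rewrite divr_ge0// ltW// divr_gt0.
have [l' [d [hl' d0 dB cl]]] := Ef N.
have ld : l = l' + d by move: hl'; rewrite hl => -[].
near=> k.
have h1 : `|l' - iter k P (fN N \o g) x0| <= e / 3.
  by near: k; apply: (cvgrPdist_le _ _).1 => //; rewrite divr_gt0.
have h2 := le_trans (excB N k) hN; have {}dB := le_trans dB hN.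
have h3 : 0 <= iter k P ((fun q => f q - fN N q) \o g) x0.
  by apply: (pop_ge0 (iter_pop hP k)) => x /=.
have h4 : iter k P (f \o g) x0 = iter k P (fN N \o g) x0 +
    iter k P ((fun q => f q - fN N q) \o g) x0.
  rewrite -(popD (iter_pop hP k)); congr (iter k P _ _); apply/funext => x /=.
  by rewrite addrC subrK.
move: h1 h2 h3; rewrite ld h4; set a := iter k P _ x0; set b := iter k P _ x0.
by rewrite !ler_norml => /andP[? ?] ? ?; apply/andP; split; lra.
Unshelve. all: by end_near. Qed.

End LimitLaw.

(** * The switch as a Markov kernel *)

Section FiniteBox.
Variable n : nat.

Lemma finite_box (N : 'I_n -> 'I_n -> nat) :
  finite_set [set q : natmx n | forall i j, (q i j <= N i j)%N].
Proof.
pose M := (\sum_i \sum_j N i j)%N.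
pose img := [set (map_mx (@nat_of_ord M.+1) b : natmx n) | b in [set: 'M['I_M.+1]_n]].
apply: (@sub_finite_set _ _ img); last by apply: finite_image; exact: finite_finset.
move=> q /= hq; exists (\matrix_(i, j) inord (q i j)) => //.
apply/matrixP => i j; rewrite !mxE inordK// ltnS (leq_trans (hq i j))//.
rewrite /M (bigD1 i)//= (bigD1 j)//= -addnA; exact: leq_addr.
Qed.

End FiniteBox.

(** Arrivals are coded in a finite type, so that averages over arrivals and
    schedules are finite sums. *)
Definition next_queue n (A : nat) (q : natmx n) (b : 'M['I_A]_n) (s : 'S_n) : natmx n :=
  \matrix_(i, j) (q i j + b i j - (s i == j))%N.

(** What the stability and drift arguments use of a switch: a kernel with finite rows whose step
    draws a schedule from beta x and, independently, an arrival matrix from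
    alpha, with entries of mean lam and uncorrelated of variance V.  No sample
    space is left. *)
Record switch_kernel (R : realType) (n amax : nat) (S : countType)
    (p : S -> S -> R) (supp : S -> seq S) (g : S -> natmx n)
    (beta : S -> 'S_n -> R) (alpha : 'M['I_amax.+1]_n -> R)
    (lam V : 'M[R]_n) : Prop := SwitchKernel {
  sk_p0 : forall x y, 0 <= p x y;
  sk_us : forall x, uniq (supp x);
  sk_supp : forall x y, y \notin supp x -> p x y = 0;
  sk_sum : forall x, \sum_(y <- supp x) p x y = 1;
  sk_gfin : forall A : set (natmx n), finite_set A -> finite_set (g @^-1` A);
  sk_irr : irreducible p;
  sk_aper : aperiodic p;
  sk_b0 : forall x s, 0 <= beta x s;
  sk_b1 : forall x, \sum_s beta x s = 1;
  sk_a0 : forall b, 0 <= alpha b;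
  sk_a1 : \sum_b alpha b = 1;
  sk_mean : forall i j, \sum_b alpha b * (b i j)%:R = lam i j;
  sk_cov : forall i j k l, \sum_b alpha b * ((b i j)%:R * (b k l)%:R) =
    lam i j * lam k l + ((i == k) && (j == l))%:R * V i j;
  sk_step : forall x (f : natmx n -> R), kernel_op p supp (f \o g) x =
    \sum_s \sum_b beta x s * alpha b * f (next_queue (g x) b s)
}.

Section FromSwitch.
Variables (R : realType) (n : nat) (nu : 'M[R]_n) (amax : nat) (eps : R)
  (sw : switch_system R n).
Hypotheses (hs : is_switch nu amax eps sw) (hA1 : condA1 sw) (hA2 : condA2 sw).

Let Pr := prob sw.
Let S := state sw.
Let p : S -> S -> R := @trans _ _ sw.
Let g : S -> natmx n := @queue_of _ _ sw.
Let X : nat -> sample sw -> S := @chain _ _ sw.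
Let Q : nat -> sample sw -> natmx n := @queue _ _ sw.
Let Ar : nat -> sample sw -> natmx n := @arrival _ _ sw.
Let Sc : nat -> sample sw -> natmx n := @schedule _ _ sw.
Let Hi : nat -> sample sw -> seq (natmx n * natmx n) := @history _ _ sw.

Lemma queue_rv t : discrete_rv (Q t).
Proof. by move=> A; have := measurable_queue hs t measurableT I (Y := A); rewrite setTI. Qed.

Lemma schedule_rv t : discrete_rv (Sc t).
Proof. by move=> A; have := measurable_schedule hs t measurableT I (Y := A); rewrite setTI. Qed.

Lemma arrival_rv t : discrete_rv (Ar t).
Proof. by move=> A; have := measurable_arrival hs t measurableT I (Y := A); rewrite setTI. Qed.

Lemma history_rv t : discrete_rv (Hi t).
Proof.
have qs k : discrete_rv (fun w => (Q k w, Sc k w)).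
  by apply: discrete_rv_pair; [exact: queue_rv|exact: schedule_rv].
suff h m : discrete_rv (fun w => mkseq (fun k => (Q k w, Sc k w)) m) by exact: (h t.+1).
elim: m => [|m IH].
  move=> A; rewrite (_ : _ @^-1` A = if `[< A [::] >] then setT else set0).
    by case: ifP.
  by apply/seteqP; split => w /=; case: asboolP.
have := discrete_rv_comp (fun lx => rcons lx.1 lx.2) (discrete_rv_pair IH (qs m)).
rewrite (_ : (fun w => _) = (fun w => mkseq (fun k => (Q k w, Sc k w)) m.+1))//.
by apply/funext => w; rewrite mkseqS.
Qed.

Lemma chain_rv t : discrete_rv (X t).
Proof. by move=> A; have [/(_ t A)[B ->] _ _] := hA1; exact: history_rv. Qed.

Lemma event_rv (C : Type) (Y : sample sw -> C) : discrete_rv Y ->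
  forall c, measurable (Y @^-1` [set c]).
Proof. by move=> hY c; exact: hY. Qed.

Let p0 x y : 0 <= p x y. Proof. by have [[+ _] _] := chain_markov hs; apply. Qed.

(** The Markov property is given for complete paths; the coordinates 0, ..., t - 1
    are summed out one after the other. *)
Lemma transition_prob t x y :
  (Pr (X t @^-1` [set x] `&` X t.+1 @^-1` [set y]) =
   Pr (X t @^-1` [set x]) * (p x y)%:E)%E.
Proof.
pose ev j t z := [set w | forall k, (j <= k <= t)%N -> X k w = z k].
have mev j t' z : measurable (ev j t' z).
  rewrite (_ : ev j t' z = \bigcap_(k in [set k | (j <= k <= t')%N]) (X k @^-1` [set z k])).
    by apply: bigcap_measurableType => k _; exact/event_rv/chain_rv.
  by apply/seteqP; split.
have key j : (j <= t)%N -> forall z, (Pr (ev j t.+1 z) = Pr (ev j t z) * (p (z t) (z t.+1))%:E)%E.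
  elim: j => [|j IH] jt z.
    have [_ /(_ t z)] := chain_markov hs.
    rewrite (_ : ev 0%N t.+1 z = [set w | forall k, (k <= t.+1)%N -> X k w = z k])//.
  apply: (piecewise_measure (chain_rv j)) => // c.
  pose z' k := if k == j then c else z k.
  have e t' : (j <= t')%N -> ev j.+1 t' z `&` X j @^-1` [set c] = ev j t' z'.
    move=> jt'; apply/seteqP; split => [w [h Xc] k /andP[jk kt]|w h].
      rewrite /z'; case: eqVneq => [->//|kj]; apply: h.
      by rewrite kt andbT ltn_neqAle eq_sym kj.
    split; last by have := h j; rewrite leqnn jt' /z' eqxx; apply.
    move=> k /andP[jk kt]; have := h k; rewrite (ltnW jk) kt /z'.
    by case: eqVneq => [kj|_]; [rewrite kj ltnn in jk|apply].
  rewrite !e ?(ltnW jt)//; last by rewrite ltnW// ltnW.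
  rewrite IH ?(ltnW jt)// /z'; congr (_ * (p _ _)%:E)%E.
    by case: eqVneq => // e'; rewrite e' ltnn in jt.
  by case: eqVneq => // e'; rewrite -e' ltnNge leqnSn in jt.
have := key t (leqnn t) (fun k => if k == t then x else y).
rewrite eqxx (gtn_eqF (ltnSn t)) => h.
rewrite (_ : _ `&` _ = ev t t.+1 (fun k => if k == t then x else y)).
  rewrite h; congr (Pr _ * _)%E; apply/seteqP; split => w.
    by move=> /(_ t); rewrite leqnn eqxx; apply.
  by move=> /= Xx k kt; have <- : t = k; [apply/eqP; rewrite eqn_leq|rewrite eqxx].
apply/seteqP; split => [w [/= Xx Xy] k /andP[tk]|w /= hw].
  rewrite leq_eqVlt => /orP[/eqP->|]; first by rewrite (gtn_eqF (ltnSn t)).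
  by rewrite ltnS => kt; have <- : t = k; [apply/eqP; rewrite eqn_leq tk|rewrite eqxx].
split; first by have := hw t; rewrite leqnn leqnSn eqxx; apply.
by have := hw t.+1; rewrite leqnSn leqnn (gtn_eqF (ltnSn t)); apply.
Qed.

(** Some state has positive probability at time 0, and from it irreducibility
    leads to x along transitions of positive probability. *)
Lemma state_reachable x : exists t, (0 < Pr (X t @^-1` [set x]))%E.
Proof.
have [x0 hx0] : exists x0, (0 < Pr (X 0 @^-1` [set x0]))%E.
  apply: contrapT => no.
  have : (Pr setT = Pr set0 * 0%:E)%E.
    apply: (piecewise_measure (chain_rv 0)) => // y; rewrite setTI mule0.
    apply/eqP; rewrite eq_le measure_ge0 andbT leNgt; apply/negP => h.
    by apply: no; exists y.
  by move/eqP; rewrite mule0 probability_setT onee_eq0.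
have [_ /(_ x0 x)[k] + _] := hA1; elim: k x0 0%N hx0 => [|k IH] x0 t hx0.
  by rewrite /=; case: eqVneq => [<- _|_]; [exists t|rewrite ltxx].
have n0 k' z y : (0 <= nstep p k' z y)%E.
  elim: k' z => [|k' IHk] z /=; first by rewrite lee_fin.
  by apply: esum_ge0 => c _; rewrite mule_ge0 ?lee_fin.
move=> /= h; have [z hz] : exists z, (0 < (p x0 z)%:E * nstep p k z x)%E.
  apply: contrapT => no; move: h; rewrite esum1 ?ltxx// => z _.
  apply/eqP; rewrite eq_le mule_ge0 ?lee_fin// andbT leNgt; apply/negP => h.
  by apply: no; exists z.
have pz : 0 < p x0 z.
  rewrite lt_neqAle p0 andbT; apply/negP => /eqP e; move: hz.
  by rewrite -e mul0e ltxx.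
have nz : (0 < nstep p k z x)%E.
  rewrite lt_neqAle (n0 k z x) andbT; apply/negP => /eqP e; move: hz.
  by rewrite -e mule0 ltxx.
apply: (IH z t.+1) => //.
apply: (@lt_le_trans _ _ (Pr (X t @^-1` [set x0] `&` X t.+1 @^-1` [set z]))).
  by rewrite transition_prob mule_gt0 ?lte_fin.
apply: le_measure; rewrite ?inE.
- by apply: measurableI; exact/event_rv/chain_rv.
- exact/event_rv/chain_rv.
- by move=> w [].
Qed.

Definition arrival_code t (w : sample sw) : 'M['I_amax.+1]_n :=
  \matrix_(i, j) inord (Ar t w i j).

Definition perm_of (m : natmx n) : 'S_n :=
  odflt 1%g [pick s : 'S_n | (perm_mx s : 'M[nat]_n) == m].

Definition schedule_code t (w : sample sw) : 'S_n := perm_of (Sc t w).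

Lemma arrival_codeE t w i j : Ar t w i j = arrival_code t w i j.
Proof. by rewrite mxE inordK// ltnS (arrival_bounded hs). Qed.

Lemma schedule_codeE t w : Sc t w = perm_mx (schedule_code t w).
Proof.
rewrite /schedule_code /perm_of; case: pickP => [s /eqP <-//|no].
have /is_perm_mxP[s e] := schedule_perm hs t w.
by have := no s; rewrite -e eqxx.
Qed.

Lemma queue_next t w :
  Q t.+1 w = next_queue (Q t w) (arrival_code t w) (schedule_code t w).
Proof.
apply/matrixP => i j; rewrite [LHS](queue_dynamics hs) mxE.
rewrite -/(Ar t w) arrival_codeE -/(Sc t w) schedule_codeE !mxE.
by case: eqP.
Qed.

Lemma arrival_code_rv t : discrete_rv (arrival_code t).
Proof.
exact: (discrete_rv_comp (fun m : natmx n => \matrix_(i, j) inord (m i j)) (@arrival_rv t)).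
Qed.

Lemma schedule_code_rv t : discrete_rv (schedule_code t).
Proof. exact: (discrete_rv_comp perm_of (@schedule_rv t)). Qed.

Definition arrival_law (b : 'M['I_amax.+1]_n) : R :=
  fine (Pr (arrival_code 0 @^-1` [set b])).

Let fnum (E : set (sample sw)) : measurable E -> Pr E \is a fin_num.
Proof. exact: fin_num_measure. Qed.

(** The law of the matrix is the product of the laws of its entries, each of
    which is the same in all slots. *)
Lemma arrival_code_law t b : fine (Pr (arrival_code t @^-1` [set b])) = arrival_law b.
Proof.
have prodE t' : fine (Pr (arrival_code t' @^-1` [set b])) =
    \prod_(ij : 'I_n * 'I_n) fine (Pr [set w | Ar t' w ij.1 ij.2 = b ij.1 ij.2]).
  have := arrival_indep hs (J := [seq (t', ij) | ij <- index_enum ('I_n * 'I_n)%type])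
    (fun k => [set (b k.2.1 k.2.2 : nat)]).
  rewrite map_inj_uniq ?index_enum_uniq; last by move=> x y [].
  move=> /(_ isT); rewrite big_map /= => <-; congr (fine (Pr _)).
  apply/seteqP; split => [w /= h k /mapP[ij _ ->] /=|w h /=].
    by rewrite -/(Ar t' w) arrival_codeE h.
  apply/matrixP => i j; apply/val_inj; rewrite /= -arrival_codeE.
  by apply: (h (t', (i, j))); apply: map_f; rewrite mem_index_enum.
rewrite /arrival_law !prodE; apply: eq_bigr => -[i j] _ /=.
by rewrite (arrival_same_law hs t i j [set (b i j : nat)]).
Qed.

(** Both the state and the schedule of slot t are functions of the history, of
    which the arrivals are independent. *)
Lemma joint_law t x s b :
  fine (Pr (X t @^-1` [set x] `&`
    (fun w => (schedule_code t w, arrival_code t w)) @^-1` [set (s, b)])) =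
  fine (Pr (X t @^-1` [set x] `&` schedule_code t @^-1` [set s])) * arrival_law b.
Proof.
have [/(_ t [set x])[B eB] _ _] := hA1.
pose H := B `&` [set h : seq (natmx n * natmx n) |
  perm_of (nth (const_mx 0%N, const_mx 0%N) h t).2 = s].
have eH : X t @^-1` [set x] `&` schedule_code t @^-1` [set s] = Hi t @^-1` H.
  rewrite [X t @^-1` _]eB /H; apply/seteqP; split => w /=;
    by rewrite /Hi /history nth_mkseq.
have eU : arrival_code t @^-1` [set b] =
    Ar t @^-1` [set m | \matrix_(i, j) inord (m i j) = b] by [].
rewrite (_ : _ `&` _ = (Ar t @^-1` [set m : natmx n | \matrix_(i, j) inord (m i j) = b])
    `&` (Hi t @^-1` H)); last first.
  rewrite -eH; apply/seteqP; split => w /=.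
    by case=> h [h1 h2].
  by case=> h1 [h2 h3]; split => //; congr (_, _).
have := arrival_indep_history hs t [set m | \matrix_(i, j) inord (m i j) = b] H.
move=> ->; rewrite fineM; last 2 first.
- by apply: fnum; exact: arrival_rv.
- by apply: fnum; exact: history_rv.
by rewrite -eH -eU -/Pr arrival_code_law mulrC.
Qed.

(** The transition probabilities do not depend on time, while the law of the
    schedule given the state may.  Any slot in which x has positive probability
    determines a schedule law that represents the transitions from x. *)
Definition visit_time (x : S) : nat := projT1 (cid (state_reachable x)).
Let E x := X (visit_time x) @^-1` [set x].
Let visit_pos x : (0 < Pr (E x))%E := projT2 (cid (state_reachable x)).

Definition schedule_law (x : S) (s : 'S_n) : R :=
  fine (Pr (E x `&` schedule_code (visit_time x) @^-1` [set s])) / fine (Pr (E x)).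

Definition next_states (x : S) : seq S :=
  finmap.enum_fset (fset_set
    (g @^-1` [set q | forall i j, (q i j <= g x i j + amax)%N])).

Let mE x : measurable (E x). Proof. exact/event_rv/chain_rv. Qed.
Let pE x : 0 < fine (Pr (E x)).
Proof. by rewrite fine_gt0// visit_pos /= ltey_eq fnum. Qed.

Lemma mem_next_states t x w : X t w = x -> X t.+1 w \in next_states x.
Proof.
move=> Xx; have [gX gf] := hA2.
rewrite in_fset_set; last by apply: gf; exact: finite_box.
rewrite inE /= /g => i j; rewrite -gX -Xx -/(Q t.+1) queue_next mxE -gX -/(Q t).
by rewrite (leq_trans (leq_subr _ _))// leq_add2l -ltnS.
Qed.

(** Queues grow by at most amax per slot and g has finite fibres. *)
Lemma next_states_support x y : y \notin next_states x -> p x y = 0.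
Proof.
move=> yx; have := transition_prob (visit_time x) x y; rewrite -/(E x).
rewrite (_ : _ `&` _ = set0); last first.
  apply/seteqP; split => // w [Xx Xy].
  by have := mem_next_states Xx; rewrite Xy (negbTE yx).
rewrite measure0 => /esym/eqP; rewrite mule_eq0 gt_eqF//= => /eqP[] //.
Qed.

Lemma transition_fine t x y :
  fine (Pr (X t @^-1` [set x] `&` X t.+1 @^-1` [set y])) =
  fine (Pr (X t @^-1` [set x])) * p x y.
Proof. by rewrite transition_prob fineM//; apply: fnum; exact/event_rv/chain_rv. Qed.

Lemma schedule_law_int x (F : 'S_n -> R) : (forall s, 0 <= F s) ->
  (\int[Pr]_(w in E x) (F (schedule_code (visit_time x) w))%:E)%E =
  (fine (Pr (E x)) * \sum_s schedule_law x s * F s)%:E.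
Proof.
move=> F0; rewrite (finite_expectation Pr (r := index_enum 'S_n))//.
- congr _%:E; rewrite mulr_sumr; apply: eq_bigr => s _.
  by rewrite /schedule_law mulrA mulrCA mulfV ?gt_eqF// mulr1 mulrC.
- exact: schedule_code_rv.
- exact: index_enum_uniq.
Qed.

Lemma arrival_law_int (F : 'M['I_amax.+1]_n -> R) : (forall b, 0 <= F b) ->
  (\int[Pr]_w (F (arrival_code 0 w))%:E)%E = (\sum_b arrival_law b * F b)%:E.
Proof.
move=> F0; rewrite (finite_expectation Pr (r := index_enum 'M['I_amax.+1]_n))//.
- congr _%:E; apply: eq_bigr => b _; by rewrite setTI mulrC.
- exact: arrival_code_rv.
- exact: index_enum_uniq.
Qed.

(** Both sides, multiplied by the probability of E x, are the integral over E x
    of f of the next queue matrix: once through the transition probabilities of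
    the chain, once through the law of schedule and arrivals. *)
Lemma kernel_step_ge0 x (f : natmx n -> R) : (forall q, 0 <= f q) ->
  kernel_op p next_states (f \o g) x =
  \sum_s \sum_b schedule_law x s * arrival_law b * f (next_queue (g x) b s).
Proof.
move=> f0; have [gX _] := hA2; set t := visit_time x.
apply: (mulfI (lt0r_neq0 (pE x))); apply: EFin_inj.
transitivity (\int[Pr]_(w in E x) (f (Q t.+1 w))%:E)%E.
  rewrite (eq_integral (fun w => ((f \o g) (X t.+1 w))%:E)); last first.
    by move=> w _; rewrite /Q gX.
  rewrite (finite_expectation Pr (r := next_states x))//.
  - congr _%:E; rewrite /kernel_op mulr_sumr; apply: eq_bigr => y _.
    by rewrite transition_fine mulrA mulrC.
  - exact: chain_rv.
  - by move=> w; exact: mem_next_states.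
  - exact: finmap.fset_uniq.
  - by move=> y /=.
pose F (sb : 'S_n * 'M['I_amax.+1]_n) := f (next_queue (g x) sb.2 sb.1).
rewrite (eq_integral (fun w => (F (schedule_code t w, arrival_code t w))%:E)); last first.
  move=> w; rewrite inE => Xx; rewrite queue_next /F /=.
  by rewrite /Q gX -/(X t w) Xx.
rewrite (finite_expectation Pr (r := index_enum ('S_n * 'M['I_amax.+1]_n)%type))//.
- congr _%:E; rewrite mulr_sumr.
  under [RHS]eq_bigr do rewrite mulr_sumr.
  rewrite pair_bigA /=; apply: eq_bigr => -[s b] _ /=.
  rewrite joint_law /schedule_law /F /= -/t -/(E x).
  by have := pE x => h; field; rewrite gt_eqF.
- by apply: discrete_rv_pair; [exact: schedule_code_rv|exact: arrival_code_rv].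
- exact: index_enum_uniq.
- by move=> sb; rewrite /F.
Qed.

Lemma next_states_sum x : \sum_(y <- next_states x) p x y = 1.
Proof.
have [[_ h] _] := chain_markov hs.
have := h x; rewrite (esum_finsupp (r := next_states x)) => [[]//|||].
- exact: finmap.fset_uniq.
- exact: p0.
- exact: next_states_support.
Qed.

Lemma kernel_step x (f : natmx n -> R) :
  kernel_op p next_states (f \o g) x =
  \sum_s \sum_b schedule_law x s * arrival_law b * f (next_queue (g x) b s).
Proof.
pose f1 q := Num.max (f q) 0; pose f2 q := Num.max (- f q) 0.
have ff q : f q = f1 q - f2 q.
  by rewrite /f1 /f2 maxC; case: leP => h1; case: leP => h2; lra.
transitivity (kernel_op p next_states (f1 \o g) x - kernel_op p next_states (f2 \o g) x).
  by rewrite /kernel_op -sumrB; apply: eq_bigr => y _; rewrite /= ff mulrBr.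
rewrite !kernel_step_ge0; try by move=> q; rewrite le_max lexx orbT.
rewrite -sumrB; apply: eq_bigr => s _; rewrite -sumrB; apply: eq_bigr => b _.
by rewrite ff mulrBr.
Qed.

Lemma arrival_mean_sum i j : \sum_b arrival_law b * (b i j)%:R = (1 - eps) * nu i j.
Proof.
apply: EFin_inj; rewrite -arrival_law_int// -(arrival_mean hs 0 i j) unlock.
by apply: eq_integral => w _; rewrite -/(Ar 0 w) arrival_codeE.
Qed.

Lemma arrival_law_sum : \sum_b arrival_law b = 1.
Proof.
have := @arrival_law_int (fun=> 1) (fun=> ler01).
rewrite /= integral_cst//= probability_setT mul1e => -[->].
by apply: eq_bigr => b _; rewrite mulr1.
Qed.

(** Diagonal case of sk_cov. *)
Lemma arrival_second_moment i j :
  \sum_b arrival_law b * ((b i j)%:R * (b i j)%:R) =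
  ((1 - eps) * nu i j) ^+ 2 + arrival_variance sw i j.
Proof.
set m := (1 - eps) * nu i j.
have -> : arrival_variance sw i j = \sum_b arrival_law b * ((b i j)%:R - m) ^+ 2.
  rewrite /arrival_variance /variance covariance.unlock (arrival_mean hs) -/m.
  rewrite expectation.unlock -[RHS]/(fine (_%:E)) -arrival_law_int; last first.
    by move=> b; exact: sqr_ge0.
  congr fine; apply: eq_integral => w _.
  by rewrite -arrival_codeE expr2.
rewrite [X in _ = _ + X](eq_bigr (fun b => arrival_law b * ((b i j)%:R * (b i j)%:R) -
   2 * m * (arrival_law b * (b i j)%:R) + m ^+ 2 * arrival_law b)); last first.
  by move=> b _; ring.
rewrite big_split /= sumrB -!mulr_sumr arrival_mean_sum arrival_law_sum -/m; ring.
Qed.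

(** Off-diagonal case of sk_cov, where independence of the entries enters. *)
Lemma arrival_product_moment i j k l : (i, j) != (k, l) ->
  \sum_b arrival_law b * ((b i j)%:R * (b k l)%:R) =
  ((1 - eps) * nu i j) * ((1 - eps) * nu k l).
Proof.
move=> ne.
have code_rv i' j' : discrete_rv (fun w => arrival_code 0 w i' j').
  exact: (discrete_rv_comp (fun b : 'M['I_amax.+1]_n => b i' j') (@arrival_code_rv 0)).
have mean1 i' j' : (1 - eps) * nu i' j' =
    \sum_(u < amax.+1) u%:R * fine (Pr [set w | Ar 0 w i' j' = u]).
  apply: EFin_inj; rewrite -(arrival_mean hs 0 i' j') unlock.
  rewrite (eq_integral (fun w => ((arrival_code 0 w i' j' : nat)%:R)%:E)); last first.
    by move=> w _; rewrite -/(Ar 0 w) arrival_codeE.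
  rewrite (finite_expectation Pr (r := index_enum 'I_amax.+1)
    (Y := fun w => arrival_code 0 w i' j') (F := fun u => u%:R))//.
  - congr _%:E; apply: eq_bigr => u _; rewrite setTI; congr (_ * fine (Pr _)).
    by apply/seteqP; split => w /=; rewrite arrival_codeE; [move=> ->|move/val_inj].
  - by move=> w _; rewrite mem_index_enum.
  - exact: index_enum_uniq.
apply: EFin_inj; rewrite -arrival_law_int; last by move=> b; rewrite mulr_ge0.
rewrite (finite_expectation Pr (r := index_enum ('I_amax.+1 * 'I_amax.+1)%type)
    (Y := fun w => (arrival_code 0 w i j, arrival_code 0 w k l))
    (F := fun uv => uv.1%:R * uv.2%:R))//.
- congr _%:E; rewrite !mean1 mulr_suml; under [RHS]eq_bigr do rewrite mulr_sumr.
  rewrite pair_bigA /=; apply: eq_bigr => -[u v] _ /=; rewrite setTI mulrACA.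
  congr (_ * _).
  have := arrival_indep hs (J := [:: (0%N, (i, j)); (0%N, (k, l))])
    (fun x => if x.2 == (i, j) then [set (u : nat)] else [set (v : nat)]).
  rewrite /= inE andbT; have -> : (0%N, (i, j)) != (0%N, (k, l)).
    by apply: contra ne => /eqP[-> ->].
  move=> /(_ isT); rewrite big_cons big_seq1 /= eqxx eq_sym (negbTE ne) => <-.
  congr (fine (Pr _)); apply/seteqP; split => w /=.
    move=> [e1 e2] x; rewrite !inE => /orP[] /eqP -> /=.
      by rewrite eqxx -/(Ar 0 w) arrival_codeE e1.
    by rewrite eq_sym (negbTE ne) -/(Ar 0 w) arrival_codeE e2.
  move=> h; congr (_, _); apply/val_inj; rewrite /= -arrival_codeE.
    by have := h (0%N, (i, j)); rewrite inE eqxx /= eqxx; apply.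
  by have := h (0%N, (k, l)); rewrite !inE eqxx orbT /= eq_sym (negbTE ne); apply.
- by apply: discrete_rv_pair; exact: code_rv.
- by move=> w _; rewrite mem_index_enum.
- exact: index_enum_uniq.
Qed.

Lemma switch_is_kernel : switch_kernel p next_states g schedule_law arrival_law
  ((1 - eps) *: nu) (\matrix_(i, j) arrival_variance sw i j).
Proof.
have [_ irr aper] := hA1; have [_ gf] := hA2.
split => //.
- by move=> x; exact: finmap.fset_uniq.
- exact: next_states_support.
- exact: next_states_sum.
- by move=> x s; rewrite divr_ge0// fine_ge0.
- move=> x; have := @schedule_law_int x (fun=> 1) (fun=> ler01).
  rewrite /= integral_cst//= mul1e => /(congr1 fine) /= e.
  apply: (mulfI (lt0r_neq0 (pE x))); rewrite mulr1 [RHS]e; congr (_ * _).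
  by apply: eq_bigr => s _; rewrite mulr1.
- by move=> b; rewrite fine_ge0.
- exact: arrival_law_sum.
- by move=> i j; rewrite arrival_mean_sum mxE.
- move=> i j k l; rewrite !mxE; have [/= /eqP[-> ->]|ne] := boolP ((i, j) == (k, l)).
    by rewrite !eqxx arrival_second_moment mul1r expr2.
  by rewrite arrival_product_moment// -xpair_eqE (negbTE ne) mul0r addr0.
- exact: kernel_step.
Qed.

Lemma schedule_law_weight (W2 : R) :
  (forall (t : nat) (x : S), let E := X t @^-1` [set x] in (0 < Pr E)%E ->
    (max_weight (g x))%:R - W2 <= cond_expectation Pr E
      (fun w => (frob_inner (Q t w : 'M[nat]_n) (Sc t w))%:R)) ->
  forall x, (max_weight (g x))%:R - W2 <=
    \sum_s schedule_law x s * (frob_inner (g x) (perm_mx s : 'M[nat]_n))%:R.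
Proof.
move=> hW x; have [gX _] := hA2.
have := hW (visit_time x) x (visit_pos x).
rewrite /cond_expectation -/(E x).
rewrite (eq_integral (fun w => ((frob_inner (g x)
    (perm_mx (schedule_code (visit_time x) w) : 'M[nat]_n))%:R)%:E)); last first.
  by move=> w; rewrite inE => Xx; rewrite schedule_codeE /Q gX -/(X _ w) Xx.
rewrite (schedule_law_int x (F := fun s => (frob_inner (g x) (perm_mx s : 'M[nat]_n))%:R))//.
by rewrite /= mulrC mulKf// gt_eqF.
Qed.

Let P := kernel_op p next_states.

Lemma process_step (h : S -> R) t : (forall y, 0 <= h y) ->
  (\int[Pr]_w (h (X t.+1 w))%:E = \int[Pr]_w (P h (X t w))%:E)%E.
Proof.
move=> h0; have Ph0 y : 0 <= P h y.
  by apply: sumr_ge0 => z _; rewrite mulr_ge0.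
apply: (piecewise_integral (chain_rv t)).
- exact: (discrete_rv_comp h (chain_rv t.+1)).
- exact: (discrete_rv_comp (P h) (chain_rv t)).
- by move=> w.
- by move=> w.
move=> x; rewrite (finite_expectation Pr (r := next_states x))//.
- rewrite (finite_expectation Pr (r := [:: x]) (Y := X t) (F := P h))//.
  + rewrite big_seq1 setIid mulrC /P /kernel_op mulr_sumr; congr _%:E.
    by apply: eq_bigr => y _; rewrite transition_fine; ring.
  + exact/event_rv/chain_rv.
  + exact: chain_rv.
  + by move=> w /= ->; rewrite inE.
- exact/event_rv/chain_rv.
- exact: chain_rv.
- by move=> w; exact: mem_next_states.
- exact: finmap.fset_uniq.
Qed.

Lemma process_law (h : S -> R) t : (forall y, 0 <= h y) ->
  (\int[Pr]_w (h (X t w))%:E = \int[Pr]_w (iter t P h (X 0 w))%:E)%E.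
Proof.
elim: t h => [//|t IH] h h0; rewrite process_step// IH.
  by apply: eq_integral => w _; rewrite -iterSr.
by move=> y; apply: sumr_ge0 => z _; rewrite mulr_ge0.
Qed.

(** The iterates converge pointwise and boundedly, so their integrals against the
    law of the initial state converge.  The shift by M makes the functions
    nonnegative, as process_law requires. *)
Lemma process_cvg (f : natmx n -> R) (M l : R) : (forall q, `|f q| <= M) ->
  (forall x, iter k P (f \o g) x @[k --> \oo] --> l) ->
  ('E_Pr[fun w => f (Q t w)] @[t --> \oo] --> l%:E)%E.
Proof.
move=> fM fl; have [gX _] := hA2.
have mP : markov_op P.
  by apply: kernel_mop => //; exact: next_states_sum.
pose h x := f (g x) + M.
have hB x : 0 <= h x <= M + M.
  by have := fM (g x); rewrite ler_norml /h => /andP[h1 h2]; apply/andP; split; lra.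
have hl x : iter k P h x @[k --> \oo] --> l + M.
  rewrite (_ : (fun k => _) = (fun k => iter k P (f \o g) x + M)); last first.
    apply/funext => k; rewrite /h (popD (iter_pop (proj1 mP) k)).
    by rewrite (mop_cst (iter_mop k mP)).
  by apply: cvgD; [exact: fl|exact: cvg_cst].
have iB k x : 0 <= iter k P h x <= M + M.
  have ip := iter_pop (proj1 mP) k; apply/andP; split.
    by apply: (pop_ge0 ip) => y; have /andP[] := hB y.
  rewrite -[leRHS](mop_cst (iter_mop k mP) _ x).
  by apply: (pop_le ip) => y; have /andP[] := hB y.
have rv k : discrete_rv (fun w => iter k P h (X 0 w)).
  exact: (discrete_rv_comp (iter k P h) (chain_rv 0)).
have [] := @dominated_convergence _ _ _ Pr setT measurableT
  (fun k w => (iter k P h (X 0 w))%:E) (cst (l + M)%:E) (cst (M + M)%:E).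
- by move=> k; apply: discrete_rv_measurable.
- exact: measurable_cst.
- by apply: aeW => w _; apply: cvg_EFin; [near=> k|exact: hl].
- apply: (@bounded_integrable _ _ _ Pr (cst (M + M)) `|M + M|) => // A.
  rewrite (_ : _ @^-1` A = if `[< A (M + M) >] then setT else set0); first by case: ifP.
  by apply/seteqP; split => w /=; case: asboolP.
- apply: aeW => w k _; rewrite lee_fin ger0_norm; by have /andP[] := iB k (X 0 w).
move=> _ _; rewrite /= integral_cst//= probability_setT mule1 => cv.
have e t : ('E_Pr[fun w => f (Q t w)] =
    \int[Pr]_w (iter t P h (X 0 w))%:E - M%:E)%E.
  rewrite -process_law; last by move=> y; have /andP[] := hB y.
  have := expectation_shift Pr (discrete_rv_comp f (queue_rv t)) (fun w => fM (Q t w)).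
  rewrite unlock => /(congr1 (fun z => (z - M%:E)%E)); rewrite addeK// => <-.
  by congr (_ - _)%E; apply: eq_integral => w _; rewrite /h /Q gX.
rewrite (_ : (fun t => _) = (fun t => (\int[Pr]_w (iter t P h (X 0 w))%:E - M%:E)%E)).
  have -> : l%:E = ((l + M)%:E - M%:E)%E by rewrite -EFinB addrK.
  by apply: cvgeB => //; exact: cvg_cst.
by apply/funext => t; rewrite e.
Unshelve. all: by end_near. Qed.

End FromSwitch.

(** * From additive to geometric drift *)
Section ExpBounds.
Variable R : realType.

Lemma expR_le_quad (u : R) : `|u| <= 2^-1 -> expR u <= 1 + u + 2 * u ^+ 2.
Proof.
rewrite ler_norml => /andP[u1 u2].
have h : 1 - u <= expR (- u) by exact: expR_ge1Dx.
have h1 : 0 < 1 - u by lra.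
have -> : expR u = (expR (- u))^-1 by rewrite -expRN opprK.
apply: (@le_trans _ _ (1 - u)^-1); first by rewrite lef_pV2// posrE ?expR_gt0.
rewrite -[(1 - u)^-1]mul1r ler_pdivrMr//.
have : 0 <= u ^+ 2 by exact: sqr_ge0.
by move=> h2; nra.
Qed.

Lemma pow_le_expR (u : R) r : 0 <= u -> u ^+ r.+1 <= r.+1`!%:R * expR u.
Proof.
move=> u0; have := expR_ge1Dxn r u0.
have f0 : 0 < r.+1`!%:R :> R by rewrite ltr0n fact_gt0.
move=> h; rewrite mulrC -ler_pdivrMr//; apply: le_trans h.
by rewrite lerDr.
Qed.

End ExpBounds.

Section Average.
Variables (R : realType) (n amax : nat) (S : countType)
  (p : S -> S -> R) (supp : S -> seq S) (g : S -> natmx n)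
  (beta : S -> 'S_n -> R) (alpha : 'M['I_amax.+1]_n -> R) (lam V : 'M[R]_n).
Hypothesis sk : switch_kernel p supp g beta alpha lam V.

Definition avg x (F : 'S_n -> 'M['I_amax.+1]_n -> R) : R :=
  \sum_s \sum_b beta x s * alpha b * F s b.

Let w0 x s b : 0 <= beta x s * alpha b.
Proof. by rewrite mulr_ge0 ?(sk_b0 sk) ?(sk_a0 sk). Qed.

Lemma avg_le x F G : (forall s b, F s b <= G s b) -> avg x F <= avg x G.
Proof. by move=> FG; apply: ler_sum => s _; apply: ler_sum => b _; rewrite ler_wpM2l. Qed.

Lemma avg_linear x (a : R) F G :
  avg x (fun s b => a * F s b + G s b) = a * avg x F + avg x G.
Proof.
rewrite /avg mulr_sumr -big_split; apply: eq_bigr => s _ /=.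
by rewrite mulr_sumr -big_split; apply: eq_bigr => b _ /=; ring.
Qed.

Lemma avgD x F G : avg x (fun s b => F s b + G s b) = avg x F + avg x G.
Proof.
rewrite -[avg x F]mul1r -avg_linear; apply: eq_bigr => s _.
by apply: eq_bigr => b _; rewrite mul1r.
Qed.

Lemma avgZ x a F : avg x (fun s b => a * F s b) = a * avg x F.
Proof.
rewrite /avg mulr_sumr; apply: eq_bigr => s _; rewrite mulr_sumr.
by apply: eq_bigr => b _; ring.
Qed.

Lemma avg_schedule x (F : 'S_n -> R) : avg x (fun s _ => F s) = \sum_s beta x s * F s.
Proof.
apply: eq_bigr => s _; rewrite -[RHS]mulr1 -(sk_a1 sk) mulr_sumr.
by apply: eq_bigr => b _; ring.
Qed.

Lemma avg_arrival x (F : 'M['I_amax.+1]_n -> R) :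
  avg x (fun _ b => F b) = \sum_b alpha b * F b.
Proof.
rewrite /avg exchange_big; apply: eq_bigr => b _ /=.
by rewrite -!mulr_suml (sk_b1 sk) mul1r.
Qed.

Lemma avg_cst x c : avg x (fun _ _ => c) = c.
Proof. by rewrite avg_schedule -mulr_suml (sk_b1 sk) mul1r. Qed.

Lemma avg_step x (f : natmx n -> R) :
  kernel_op p supp (f \o g) x = avg x (fun s b => f (next_queue (g x) b s)).
Proof. exact: (sk_step sk). Qed.

Definition real_arrival (b : 'M['I_amax.+1]_n) : 'M[R]_n := \matrix_(i, j) (b i j)%:R.

Lemma avg_inner_arrival x (y : 'M[R]_n) :
  avg x (fun _ b => frob_inner y (real_arrival b)) = frob_inner y lam.
Proof.
rewrite avg_arrival /frob_inner; under eq_bigr do rewrite mulr_sumr.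
rewrite exchange_big; apply: eq_bigr => i _.
under eq_bigr do rewrite mulr_sumr.
rewrite exchange_big; apply: eq_bigr => j _ /=.
rewrite -(sk_mean sk) mulr_sumr; apply: eq_bigr => b _; rewrite mxE; ring.
Qed.

End Average.

Section UnusedService.
Variables (R : realType) (n amax : nat).
Implicit Types (q : natmx n) (b : 'M['I_amax.+1]_n) (s : 'S_n).

Definition unused q b s : 'M[R]_n :=
  \matrix_(i, j) ((q i j + b i j == 0%N) && (s i == j))%:R.

Lemma real_next_queue q b s : real_mx R (next_queue q b s) =
  real_mx R q + (real_arrival R b - perm_mx s + unused q b s).
Proof.
apply/matrixP => i j; rewrite !mxE; case: (s i == j) => /=; last first.
  by rewrite andbF subn0 natrD !mulr0n; ring.
case: (posnP (q i j + b i j)%N) => [e|e].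
  rewrite e /= sub0n; move: e => /eqP; rewrite addn_eq0 => /andP[/eqP -> /eqP ->].
  by rewrite !mulr0n mulr1n; ring.
by rewrite natrB// natrD mulr0n; ring.
Qed.

Lemma unused_ge0 q b s i j : 0 <= unused q b s i j.
Proof. by rewrite mxE. Qed.

Lemma unused_queue q b s i j : unused q b s i j != 0 ->
  q i j = 0%N /\ next_queue q b s i j = 0%N.
Proof.
rewrite mxE; have [/andP[e _] _|_] := boolP ((q i j + b i j == 0)%N && (s i == j)).
  by move: e; rewrite mxE addn_eq0 => /andP[/eqP -> /eqP ->].
by rewrite mulr0n eqxx.
Qed.

(** An entry changes by at most amax + 1; the summand 1 makes the bound at least 1
    for every n. *)
Definition step_bound : R := n%:R * (amax.+1)%:R + 1.

Lemma step_bound_gt0 : 0 < step_bound.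
Proof. by rewrite ltr_wpDl// mulr_ge0. Qed.

Lemma step_norm q b s :
  frob_norm (real_mx R (next_queue q b s) - real_mx R q) <= step_bound.
Proof.
apply: (@le_trans _ _ (n%:R * (amax.+1)%:R)); last by rewrite lerDl.
apply: frob_norm_le_entries => i j; rewrite !mxE.
have hb : (b i j <= amax)%N by rewrite -ltnS.
have [h|h] := leqP (q i j) (q i j + b i j - (s i == j)).
  rewrite -natrB// normr_nat ler_nat; lia.
rewrite -normrN opprB -natrB ?(ltnW h)// normr_nat ler_nat; case: (s i == j) h => /=; lia.
Qed.

End UnusedService.

Section GeometricDrift.
Variables (R : realType) (n amax : nat) (eta W : R).
Hypotheses (eta0 : 0 < eta) (eta1 : eta <= 1) (W0 : 0 <= W).

(** The function r is either the queue matrix itself or its residual after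
    projection.  When |r| is large, |r'|^2 <= |r + (q' - q)|^2 bounds the mean of
    |r'| - |r| by - eta / 2; since the jumps are bounded by D, the expansion of
    exp (th * (|r'| - |r|)) to second order multiplies exp (th * |r|) by at most
    rho, for th of order eta / D^2.  When |r| is bounded the constant K takes over.
    The witnesses are chosen before the switch, which is what makes them
    uniform over the family of systems. *)
Lemma geometric_drift : exists th rho K : R,
  [/\ 0 < th, 0 <= rho, rho < 1, 0 <= K &
  forall (S : countType) (p : S -> S -> R) (supp : S -> seq S) (g : S -> natmx n)
    (beta : S -> 'S_n -> R) (alpha : 'M['I_amax.+1]_n -> R) (lam V : 'M[R]_n),
  switch_kernel p supp g beta alpha lam V ->
  forall r : natmx n -> 'M[R]_n,
  (forall q q', frob_norm (r q') <= frob_norm (r q + (real_mx R q' - real_mx R q))) ->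
  (forall (q : natmx n) i j, q i j = 0%N -> r q i j <= 0) ->
  (forall x, frob_inner (r (g x)) lam -
     \sum_s beta x s * frob_inner (r (g x)) (perm_mx s) <=
     - eta * frob_norm (r (g x)) + W) ->
  forall x, kernel_op p supp (fun y => expR (th * frob_norm (r (g y)))) x <=
    rho * expR (th * frob_norm (r (g x))) + K].
Proof.
pose D : R := step_bound R n amax.
have D0 : 0 < D := step_bound_gt0 R n amax.
have D1 : 1 <= D by rewrite lerDr mulr_ge0.
have stepD q (b : 'M['I_amax.+1]_n) s :
    frob_norm (real_mx R (next_queue q b s) - real_mx R q) <= D by exact: step_norm.
clearbody D.
pose th : R := eta / (8 * D ^+ 2).
have D20 : 0 < 8 * D ^+ 2 by rewrite mulr_gt0// exprn_gt0.
have th0 : 0 < th by rewrite divr_gt0.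
have thD : th * (8 * D ^+ 2) = eta :> R by rewrite /th divfK ?gt_eqF.
clearbody th; have thD2 : th * D <= 2^-1.
  have : 0 <= th * D * (D - 1).
    by apply: mulr_ge0; [apply: mulr_ge0; exact: ltW|rewrite subr_ge0].
  have h1 : th * (8 * D ^+ 2) <= 1 by rewrite thD.
  by move=> h; have h2 : th * D ^+ 2 <= 8^-1; lra.
have WD0 : 0 <= W + D ^+ 2 / 2 by rewrite addr_ge0// divr_ge0// exprn_ge0// ltW.
pose kap : R := 2 * (W + D ^+ 2 / 2) / eta + 1.
have kap0 : 0 < kap.
  by apply: ltr_wpDl => //; apply: divr_ge0; [exact: mulr_ge0|exact: ltW].
pose rho : R := 1 - th * eta / 4.
have rho1 : rho < 1 by rewrite ltrBlDr ltrDl divr_gt0// mulr_gt0.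
have rho0 : 0 <= rho.
  have h : th * eta <= th * D by rewrite ler_pM2l// (le_trans eta1).
  by rewrite /rho; lra.
exists th, rho, (expR (th * (kap + D))); split => //.
move=> S p supp g beta alpha lam V sk r r1 r2 r3 x.
set q := g x; set v := frob_norm (r q); have v0 : 0 <= v := frob_norm_ge0 _.
rewrite (_ : (fun y => _) = (fun q => expR (th * frob_norm (r q))) \o g)//.
rewrite (avg_step sk) -/q.
pose v' (s : 'S_n) (b : 'M['I_amax.+1]_n) := frob_norm (r (next_queue q b s)).
have up s b : v' s b <= v + D.
  apply: le_trans (r1 q _) _; apply: le_trans (frob_normD _ _) _.
  by rewrite lerD2l stepD.
have down s b : v <= v' s b + D.
  apply: le_trans (r1 (next_queue q b s) _) _; apply: le_trans (frob_normD _ _) _.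
  by rewrite lerD2l -opprB frob_normN stepD.
have [vk|kv] := ltP v kap.
  apply: (@le_trans _ _ (expR (th * (kap + D)))); last first.
    by rewrite lerDr mulr_ge0// expR_ge0.
  rewrite -[leRHS](avg_cst sk x); apply: (avg_le sk) => s b.
  by rewrite ler_expR ler_pM2l// (le_trans (up s b))// lerD2r ltW.
have vgt : 0 < v by exact: lt_le_trans kv.
(* 2 v (v' - v) <= v'^2 - v^2; the unused service helps, as r <= 0 where q = 0 *)
have sq s b : v * (v' s b - v) <=
    frob_inner (r q) (real_arrival R b) - frob_inner (r q) (perm_mx s) + D ^+ 2 / 2.
  have h1 : v' s b ^+ 2 <= frob_norm (r q + (real_mx R (next_queue q b s) - real_mx R q)) ^+ 2.
    by rewrite ler_sqr ?nnegrE ?frob_norm_ge0// r1.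
  move: h1; rewrite (frob_norm_sqr (r q + _)) frob_inner_sqrD -!frob_norm_sqr -/v.
  have h2 : frob_norm (real_mx R (next_queue q b s) - real_mx R q) ^+ 2 <= D ^+ 2.
    by rewrite ler_sqr ?nnegrE ?frob_norm_ge0 ?(ltW D0)// stepD.
  have h3 : frob_inner (r q) (real_mx R (next_queue q b s) - real_mx R q) <=
      frob_inner (r q) (real_arrival R b) - frob_inner (r q) (perm_mx s).
    rewrite real_next_queue addrAC subrr add0r !frob_innerDr frob_innerNr gerDl.
    apply: sumr_le0 => i _; apply: sumr_le0 => j _.
    have [->|/unused_queue[qij _]] := eqVneq (unused R q b s i j) 0.
      by rewrite mulr0.
    by rewrite mulr_le0_ge0 ?unused_ge0// r2.
  have h4 : 0 <= (v' s b - v) ^+ 2 by exact: sqr_ge0.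
  move=> h1; nra.
have mean : avg beta alpha x (fun s b => v' s b - v) <= - eta / 2.
  rewrite -(ler_pM2l vgt) -avgZ.
  apply: le_trans (avg_le sk x sq) _.
  pose A b := frob_inner (r q) (real_arrival R (b : 'M['I_amax.+1]_n)).
  pose Bs (s : 'S_n) := - frob_inner (r q) (perm_mx s).
  rewrite (@avgD _ _ _ _ beta alpha x (fun s b => A b + Bs s)) (avg_cst sk).
  rewrite (@avgD _ _ _ _ beta alpha x (fun s b => A b) (fun s b => Bs s)).
  rewrite (avg_inner_arrival sk) (avg_schedule sk).
  under [X in _ + X + _]eq_bigr do rewrite mulrN.
  rewrite sumrN; apply: le_trans (_ : - eta * v + W + D ^+ 2 / 2 <= _); first by rewrite lerD2r r3.
  have : (2 * (W + D ^+ 2 / 2)) <= v * eta.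
    by rewrite -ler_pdivrMr// (le_trans _ kv)// lerDl.
  by move=> h; lra.
apply: (@le_trans _ _ (rho * expR (th * v))); last by rewrite lerDl expR_ge0.
have ptw s b : expR (th * v' s b) <=
    expR (th * v) * (th * (v' s b - v) + (1 + 2 * (th * D) ^+ 2)).
  have -> : th * v' s b = th * v + th * (v' s b - v) by ring.
  rewrite expRD ler_pM2l ?expR_gt0//.
  have ab : `|v' s b - v| <= D.
    by rewrite ler_norml; apply/andP; split; have := up s b; have := down s b => ? ?; lra.
  have tab : `|th * (v' s b - v)| <= th * D.
    by rewrite normrM gtr0_norm// ler_pM2l.
  apply: le_trans (expR_le_quad (le_trans tab thD2)) _.
  have : (th * (v' s b - v)) ^+ 2 <= (th * D) ^+ 2.
    rewrite -real_normK ?num_real// ler_sqr ?nnegrE//; first exact: le_trans tab.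
  by move=> h; lra.
apply: le_trans (avg_le sk x ptw) _.
rewrite avgZ mulrC ler_pM2r ?expR_gt0// avg_linear (avg_cst sk) /rho.
have : th * avg beta alpha x (fun s b => v' s b - v) <= th * (- eta / 2) by rewrite ler_pM2l.
by move: thD; rewrite exprMn => h1 h2; nra.
Qed.

End GeometricDrift.

(** * Drifts of the queues and of the residual *)
Section DoublyStochastic.
Variables (R : realType) (n : nat).
Implicit Types x y z M : 'M[R]_n.

Definition total x : R := \sum_i \sum_j x i j.

Lemma perm_ds (s : 'S_n) : doubly_stochastic (perm_mx s : 'M[R]_n).
Proof.
split=> [i j|i|j]; first by rewrite !mxE.
  rewrite (bigD1 (s i))//= !mxE eqxx big1 ?addr0// => j /negbTE js.
  by rewrite !mxE eq_sym js.
rewrite (bigD1 ((s^-1)%g j))//= !mxE permKV eqxx big1 ?addr0// => i /negbTE is'.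
by rewrite !mxE -(inj_eq (@perm_inj _ (s^-1)%g)) permK is'.
Qed.

Lemma subspace_ds (w w' : 'I_n -> R) M : doubly_stochastic M ->
  \sum_i \sum_j (w i + w' j) * M i j = \sum_i w i + \sum_j w' j.
Proof.
move=> [_ Mr Mc]; under eq_bigr do (under eq_bigr do rewrite mulrDl; rewrite big_split).
rewrite big_split /=; congr (_ + _).
  by apply: eq_bigr => i _; rewrite -mulr_sumr Mr mulr1.
by rewrite exchange_big; apply: eq_bigr => j _ /=; rewrite -mulr_sumr Mc mulr1.
Qed.

(** On matrices with entries w i + w' j all doubly stochastic matrices agree, so the
    component of the queues in the cone does not see the schedule. *)
Lemma coneK_ds x M M' : coneK x -> doubly_stochastic M -> doubly_stochastic M' ->
  frob_inner x M = frob_inner x M'.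
Proof.
move=> [[w [w' h]] _] dM dM'.
have e N : doubly_stochastic N -> frob_inner x N = \sum_i w i + \sum_j w' j.
  move=> dN; rewrite -(subspace_ds w w' dN); apply: eq_bigr => i _.
  by apply: eq_bigr => j _; rewrite h.
by rewrite !e.
Qed.

Lemma real_frob_perm (q : natmx n) (s : 'S_n) :
  (frob_inner q (perm_mx s : 'M[nat]_n))%:R =
  frob_inner (real_mx R q) (perm_mx s).
Proof.
rewrite /frob_inner natr_sum; apply: eq_bigr => i _; rewrite natr_sum.
apply: eq_bigr => j _; rewrite natrM !mxE; congr (_ * _).
by case: (_ == _).
Qed.

Lemma total_ds M : doubly_stochastic M -> total M = n%:R.
Proof.
move=> [_ Mr _]; rewrite /total; under eq_bigr do rewrite Mr.
by rewrite sumr_const card_ord.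
Qed.

Lemma real_ge0 (q : natmx n) i j : 0 <= real_mx R q i j.
Proof. by rewrite mxE. Qed.

Lemma total_real_ge0 (q : natmx n) : 0 <= total (real_mx R q).
Proof. by apply: sumr_ge0 => i _; apply: sumr_ge0 => j _; exact: real_ge0. Qed.

Lemma norm_le_total (q : natmx n) : frob_norm (real_mx R q) <= total (real_mx R q).
Proof.
rewrite -ler_sqr ?nnegrE ?frob_norm_ge0 ?total_real_ge0// frob_norm_sqr expr2.
rewrite /frob_inner {2}/total mulr_suml; apply: ler_sum => i _.
rewrite mulr_suml; apply: ler_sum => j _; rewrite ler_wpM2l ?real_ge0//.
rewrite /total (bigD1 i)//= (bigD1 j)//= -addrA lerDl addr_ge0//.
  by apply: sumr_ge0 => *; exact: real_ge0.
by apply: sumr_ge0 => *; apply: sumr_ge0 => *; exact: real_ge0.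
Qed.

Lemma total_le_norm x : total x <= n%:R * n%:R * frob_norm x.
Proof.
apply: (@le_trans _ _ (\sum_(i < n) \sum_(j < n) frob_norm x)).
  by apply: ler_sum => i _; apply: ler_sum => j _;
    apply: le_trans (ler_entry_frob x i j); exact: ler_norm.
rewrite !sumr_const !card_ord -mulrnA -[leLHS]mulr_natr natrM.
by rewrite le_eqVlt; apply/orP; left; apply/eqP; ring.
Qed.

End DoublyStochastic.

Section Drifts.
Variables (R : realType) (n : nat) (nu : 'M[R]_n).
Hypotheses (hn : (0 < n)%N) (hnu : doubly_stochastic nu)
  (hnu_min : forall i j, 0 < nu i j).

Lemma entry_lower_bound : exists c : R, [/\ 0 < c, c <= 1 & forall i j, c <= nu i j].
Proof.
exists (\big[Num.min/1]_(ij : 'I_n * 'I_n) nu ij.1 ij.2); split.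
- apply: (big_ind (fun x => 0 < x)) => // a b a0 b0.
  by rewrite lt_min a0.
- have [_ Mr _] := hnu.
  apply: (big_ind (fun x => x <= 1)) => [//|a b a0 _|ij _]; first by rewrite ge_min a0.
  rewrite -(Mr ij.1) (bigD1 ij.2)//= lerDl.
  by apply: sumr_ge0 => j _; exact: ltW.
- by move=> i j; rewrite (bigD1 (i, j))//= ge_min lexx.
Qed.

Variables (c : R) (c0 : 0 < c) (c1 : c <= 1) (cnu : forall i j, c <= nu i j).
Variables (eps : R) (W2 : R).
Hypotheses (eps0 : 0 < eps) (eps1 : eps < 1).
Variables (q : natmx n) (beta : 'S_n -> R).
Hypotheses (beta0 : forall s, 0 <= beta s) (beta1 : \sum_s beta s = 1).
Hypothesis mw : (max_weight q)%:R - W2 <=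
  \sum_s beta s * (frob_inner q (perm_mx s : 'M[nat]_n))%:R.

Let x := real_mx R q.

Lemma mw_real : (max_weight q)%:R - W2 <= \sum_s beta s * frob_inner x (perm_mx s).
Proof.
by apply: le_trans mw _; apply: ler_sum => s _; rewrite real_frob_perm.
Qed.

(** The maximal weight exceeds the inner product with nu, which for nonnegative
    entries is at least c times the norm; the load 1 - eps leaves a margin of eps
    times the maximal weight. *)
Lemma queue_drift : frob_inner x ((1 - eps) *: nu) -
   \sum_s beta s * frob_inner x (perm_mx s) <= - (eps * c) * frob_norm x + W2.
Proof.
have h1 := mw_real; have h2 := max_weight_ds q hnu; rewrite -/x in h2.
have h3 : c * frob_norm x <= (max_weight q)%:R.
  apply: le_trans h2; apply: (@le_trans _ _ (c * total x)).
    by rewrite ler_pM2l// norm_le_total.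
  rewrite /total /frob_inner mulr_sumr; apply: ler_sum => i _; rewrite mulr_sumr.
  by apply: ler_sum => j _; rewrite mulrC ler_wpM2l ?real_ge0.
have h4 : eps * (c * frob_norm x) <= eps * (max_weight q)%:R by rewrite ler_pM2l.
have h5 : (1 - eps) * frob_inner x nu <= (1 - eps) * (max_weight q)%:R.
  by rewrite ler_wpM2l// subr_ge0 ltW.
rewrite frob_innerZr; lra.
Qed.

(** The competitor is nu + (c / |z|) z for z = perpK x: its entries are
    nonnegative because the entries of nu are at least c, and its row and column
    sums are at most 1 by polarity. *)
Lemma max_weight_perp :
  frob_inner x nu + c * frob_norm (perpK x) <= (max_weight q)%:R.
Proof.
set z := perpK x.
have [z0|zn] := eqVneq (frob_norm z) 0; first by rewrite z0 mulr0 addr0 max_weight_ds.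
have zp : 0 < frob_norm z by rewrite lt_def zn frob_norm_ge0.
have cz : 0 < c / frob_norm z by rewrite divr_gt0.
have zr i : \sum_j z i j <= 0 by exact: perpK_row_le0.
have zc j : \sum_i z i j <= 0 by exact: perpK_col_le0.
have xz : frob_inner x z = frob_norm z ^+ 2.
  by rewrite /z frob_inner_self_perpK// frob_norm_sqr.
clearbody z; pose t := c / frob_norm z.
have t0 : 0 < t by rewrite divr_gt0.
have tz : t * frob_norm z = c by rewrite /t divfK.
have -> : c * frob_norm z = t * frob_inner x z by rewrite xz expr2 mulrA tz.
rewrite -frob_innerZr -frob_innerDr; have [_ nr nc] := hnu; apply: max_weight_ge.
- move=> i j; rewrite !mxE; have h1 := cnu i j.
  have h2 : t * - z i j <= t * frob_norm z.
    by rewrite ler_pM2l// (le_trans _ (ler_entry_frob z i j))// -normrN ler_norm.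
  by rewrite tz in h2; lra.
- move=> i; under eq_bigr do rewrite !mxE; rewrite big_split /= nr -mulr_sumr gerDl.
  by rewrite mulr_ge0_le0// ltW.
- move=> j; under eq_bigr do rewrite !mxE; rewrite big_split /= nc -mulr_sumr gerDl.
  by rewrite mulr_ge0_le0// ltW.
Qed.

(** The component in the cone contributes the same to nu and to each schedule, so
    max_weight_perp bounds the drift at load 1; reducing the load to 1 - eps costs
    at most eps |z| |nu|, which is absorbed for small eps. *)
Lemma perp_drift : eps * (2 * (frob_norm nu + 1)) <= c ->
  frob_inner (perpK x) ((1 - eps) *: nu) -
   \sum_s beta s * frob_inner (perpK x) (perm_mx s) <=
   - (c / 2) * frob_norm (perpK x) + W2.
Proof.
move=> epsc; set z := perpK x; set y := Defs.projK x.
have xE : x = z + y by rewrite subrK.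
have [Ky _] := projKP hn x.
have e1 : \sum_s beta s * frob_inner z (perm_mx s) =
    \sum_s beta s * frob_inner x (perm_mx s) - frob_inner y nu.
  rewrite -[frob_inner y nu]mul1r -beta1 mulr_suml -sumrB; apply: eq_bigr => s _.
  rewrite xE frob_innerDl (coneK_ds Ky (perm_ds R s) hnu); ring.
have h1 := mw_real; have h2 := max_weight_perp; rewrite -/z in h2.
have h3 : frob_inner x nu = frob_inner z nu + frob_inner y nu by rewrite {1}xE frob_innerDl.
have h4 : - frob_inner z nu <= frob_norm z * frob_norm nu.
  by rewrite -frob_innerNl (le_trans (frob_cauchy _ _))// frob_normN.
have z0 := frob_norm_ge0 z.
have h5 : eps * - frob_inner z nu <= eps * (frob_norm z * frob_norm nu).
  by rewrite ler_pM2l.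
have h6 : eps * (2 * (frob_norm nu + 1)) * frob_norm z <= c * frob_norm z.
  by rewrite ler_wpM2r.
have h7 : 0 <= eps * frob_norm z by rewrite mulr_ge0// ltW.
rewrite frob_innerZr e1; lra.
Qed.

End Drifts.

(** * The quadratic form of the projection onto S *)
Section SubspaceProjection.
Variables (R : realType) (n : nat).
Hypothesis hn : (0 < n)%N.
Implicit Types x y z M : 'M[R]_n.

Let N : R := n%:R.
Let N0 : N != 0. Proof. by rewrite pnatr_eq0 -lt0n. Qed.

(** Orthogonal projection onto the matrices with entries w i + w' j. *)
Definition projS x : 'M[R]_n :=
  \matrix_(i, j) (N^-1 * \sum_k x i k + N^-1 * \sum_k x k j - N^-2 * total x).

Definition formS x y : R := frob_inner (projS x) y.

Lemma total_linear (a : R) x y : total (a *: x + y) = a * total x + total y.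
Proof.
rewrite /total mulr_sumr -big_split; apply: eq_bigr => i _ /=.
by rewrite mulr_sumr -big_split; apply: eq_bigr => j _ /=; rewrite !mxE.
Qed.

Lemma projS_linear (a : R) x y : projS (a *: x + y) = a *: projS x + projS y.
Proof.
have sl (f g h : 'I_n -> R) : (forall k, h k = a * f k + g k) ->
    \sum_k h k = a * \sum_k f k + \sum_k g k.
  by move=> e; rewrite mulr_sumr -big_split; apply: eq_bigr.
apply/matrixP => i j; rewrite !mxE total_linear.
rewrite (sl (x i) (y i) ((a *: x + y) i)); last by move=> k; rewrite !mxE.
rewrite (sl (x^~ j) (y^~ j) ((a *: x + y)^~ j)); last by move=> k; rewrite !mxE.
ring.
Qed.

(** This is what makes the drift of the form computable: schedules and arrival
    rates enter only through the total queue. *)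
Lemma formS_ds x M : doubly_stochastic M -> formS x M = total x / N.
Proof.
move=> dM; rewrite /formS /frob_inner.
pose w i := N^-1 * \sum_k x i k - N^-2 * total x.
pose w' j := N^-1 * \sum_k x k j.
transitivity (\sum_i \sum_j (w i + w' j) * M i j).
  by apply: eq_bigr => i _; apply: eq_bigr => j _; rewrite mxE /w /w'; congr (_ * _); ring.
rewrite (subspace_ds _ _ dM) /w /w' sumrB -!mulr_sumr sumr_const card_ord -mulr_natr.
rewrite [X in _ + N^-1 * X]exchange_big -/(total x) -/N; field; exact: N0.
Qed.

(** The matrix of the form; its diagonal entries are all 2 / n - 1 / n^2, the factor
    of the variances in the limit. *)
Definition gramS (i j k l : 'I_n) : R :=
  N^-1 * (i == k)%:R + N^-1 * (j == l)%:R - N^-2.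

Lemma projS_gram x i j : projS x i j = \sum_k \sum_l gramS i j k l * x k l.
Proof.
rewrite mxE /gramS; under [RHS]eq_bigr do (under eq_bigr do rewrite mulrBl mulrDl;
  rewrite sumrB big_split /=).
rewrite [RHS]sumrB [X in _ = X - _]big_split /=; congr (_ + _ - _).
- rewrite [RHS](bigD1 i)//= [X in _ + X]big1 ?addr0.
    by rewrite mulr_sumr; apply: eq_bigr => k _; rewrite eqxx mulr1.
  move=> k /negbTE ki; rewrite big1// => l _.
  by rewrite eq_sym ki mulr0 mul0r.
- rewrite mulr_sumr; apply: eq_bigr => k _; rewrite (bigD1 j)//= eqxx mulr1 big1 ?addr0//.
  by move=> l /negbTE lj; rewrite eq_sym lj mulr0 mul0r.
- by rewrite /total mulr_sumr; apply: eq_bigr => k _; rewrite mulr_sumr.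
Qed.

Lemma formS_gram x y :
  formS x y = \sum_i \sum_j \sum_k \sum_l gramS i j k l * (x k l * y i j).
Proof.
apply: eq_bigr => i _; apply: eq_bigr => j _; rewrite projS_gram mulr_suml.
by apply: eq_bigr => k _; rewrite mulr_suml; apply: eq_bigr => l _; rewrite mulrA.
Qed.

Lemma formSC x y : formS x y = formS y x.
Proof.
rewrite !formS_gram pair_big /= [RHS]pair_big /=.
under eq_bigr do rewrite pair_big /=; under [RHS]eq_bigr do rewrite pair_big /=.
rewrite exchange_big /=; apply: eq_bigr => -[k l] _; apply: eq_bigr => -[i j] _ /=.
rewrite /gramS (eq_sym i k) (eq_sym j l); ring.
Qed.

Lemma formSDl x y z : formS (x + y) z = formS x z + formS y z.
Proof.
by rewrite /formS -[in LHS](scale1r x) projS_linear !scale1r frob_innerDl.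
Qed.

Lemma formSDr x y z : formS x (y + z) = formS x y + formS x z.
Proof. exact: frob_innerDr. Qed.

Lemma formSNr x y : formS x (- y) = - formS x y.
Proof. exact: frob_innerNr. Qed.

Lemma formSNl x y : formS (- x) y = - formS x y.
Proof. by rewrite formSC formSNr formSC. Qed.

Lemma formSZr a x y : formS x (a *: y) = a * formS x y.
Proof. exact: frob_innerZr. Qed.

Lemma projS_id y : subspaceS y -> projS y = y.
Proof.
move=> [w [w' h]]; apply/matrixP => i j; rewrite mxE /total h.
have e1 i0 : \sum_k y i0 k = N * w i0 + \sum_k w' k.
  under eq_bigr do rewrite h; rewrite big_split /= sumr_const card_ord.
  by rewrite -[w i0 *+ n]mulr_natl.
have e2 : \sum_k y k j = \sum_k w k + N * w' j.
  under eq_bigr do rewrite h; rewrite big_split /= sumr_const card_ord.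
  by rewrite -[w' j *+ n]mulr_natl.
have e3 : \sum_i \sum_j y i j = N * \sum_k w k + N * \sum_k w' k.
  under eq_bigr do rewrite e1.
  by rewrite big_split /= -mulr_sumr sumr_const card_ord -(mulr_natl (\sum_k w' k) n).
rewrite e1 e2 e3; field; exact: N0.
Qed.

Lemma projS_sub x : subspaceS (projS x).
Proof.
exists (fun i => N^-1 * \sum_k x i k - N^-2 * total x), (fun j => N^-1 * \sum_k x k j).
by move=> i j; rewrite mxE; ring.
Qed.

Lemma formS_sqr x : formS x x = frob_norm (projS x) ^+ 2.
Proof.
rewrite frob_norm_sqr -/(formS x (projS x)) formSC /formS.
by rewrite (@projS_id (projS x))//; exact: projS_sub.
Qed.

Lemma orth_sqr z : frob_norm (z - projS z) ^+ 2 = frob_norm z ^+ 2 - formS z z.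
Proof.
rewrite !frob_norm_sqr frob_inner_sqrD frob_innerNl !frob_innerNr.
have e : frob_inner (projS z) (projS z) = formS z z by rewrite formS_sqr frob_norm_sqr.
by rewrite e opprK (frob_innerC z) -/(formS z z); ring.
Qed.

Lemma formS_le x : formS x x <= frob_norm x ^+ 2.
Proof. by rewrite -subr_ge0 -orth_sqr sqr_ge0. Qed.

Lemma formS_ge0 x : 0 <= formS x x.
Proof. by rewrite formS_sqr sqr_ge0. Qed.

(** The cone lies in S, so the distance to S is at most the distance to the
    cone. *)
Lemma orth_le_perpK x : frob_norm (x - projS x) <= frob_norm (perpK x).
Proof.
have [[Sy _] _] := projKP hn x.
have -> : x - projS x = perpK x - projS (perpK x).
  have -> : projS (perpK x) = projS x - Defs.projK x.
    by rewrite /perpK addrC -scaleN1r projS_linear (projS_id Sy) scaleN1r addrC.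
  by rewrite /perpK opprB addrA subrK.
rewrite -ler_sqr ?nnegrE ?frob_norm_ge0// orth_sqr gerBl; exact: formS_ge0.
Qed.

End SubspaceProjection.

(** * The stationary balance *)
Section HeavyTraffic.
Variables (R : realType) (n amax : nat) (nu : 'M[R]_n) (eps : R).
Hypotheses (hn : (0 < n)%N) (hnu : doubly_stochastic nu).
Variables (S : countType) (p : S -> S -> R) (supp : S -> seq S) (g : S -> natmx n)
  (beta : S -> 'S_n -> R) (alpha : 'M['I_amax.+1]_n -> R) (V : 'M[R]_n).
Hypothesis sk : switch_kernel p supp g beta alpha ((1 - eps) *: nu) V.

Let N : R := n%:R.
Let N0 : N != 0. Proof. by rewrite pnatr_eq0 -lt0n. Qed.
Let P := kernel_op p supp.

Definition queue_total (q : natmx n) : R := total (real_mx R q).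
Definition queue_form (q : natmx n) : R := formS (real_mx R q) (real_mx R q).
Definition perp_sqr (q : natmx n) : R := frob_norm (perpK (real_mx R q)) ^+ 2.

Definition drift_constant : R :=
  (2 / N - N^-2) * total V + eps ^+ 2.

Section Pointwise.
Variables (q : natmx n) (b : 'M['I_amax.+1]_n) (s : 'S_n).
Let x := real_mx R q.
Let x' := real_mx R (next_queue q b s).
Let A : 'M[R]_n := real_arrival R b.
Let M : 'M[R]_n := perm_mx s.
Let u : 'M[R]_n := unused R q b s.

Lemma total_real_next : total x' = total x + total A - N + total u.
Proof.
rewrite /x' real_next_queue -/x -/A -/M -/u.
have -> : x + (A - M + u) = 1 *: x + (1 *: A + (-1 *: M + u)).
  by rewrite !scale1r scaleN1r !addrA.
rewrite !total_linear (total_ds (perm_ds R s)) -/N; ring.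
Qed.

(** Expansion of the form at x' = x + A - M + u, with the terms in u gathered as
    2 * formS x' u - formS u u. *)
Lemma form_next : formS x' x' = formS x x + 2 * formS x A - 2 * (total x / N) +
  formS A A - 2 * (total A / N) + 1 + (2 * formS x' u - formS u u).
Proof.
have dM := perm_ds R s.
have MM : formS M M = 1 by rewrite formS_ds// (total_ds dM) divff.
have xM : formS x M = total x / N by rewrite formS_ds.
have AM : formS A M = total A / N by rewrite formS_ds.
rewrite /x' real_next_queue -/x -/A -/M -/u.
rewrite !(formSDl, formSDr, formSNl, formSNr) MM.
rewrite !(formSC A x) !(formSC M x) !(formSC u x) !(formSC M A) !(formSC u A)
  !(formSC u M) xM AM.
ring.
Qed.

Lemma unused_sqr_le : frob_norm u ^+ 2 <= total u.
Proof.
rewrite frob_norm_sqr; apply: ler_sum => i _; apply: ler_sum => j _.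
by rewrite !mxE; case: (_ && _); rewrite ?mulr1n ?mulr0n ?mulr1 ?mulr0.
Qed.

(** A queue that wastes service is empty in the next slot. *)
Lemma unused_orth : frob_inner x' u = 0.
Proof.
rewrite /frob_inner big1// => i _; rewrite big1// => j _.
have [->|/unused_queue[_ e]] := eqVneq (u i j) 0; first by rewrite mulr0.
by rewrite mxE e mul0r.
Qed.

(** As x' is orthogonal to u, formS x' u only involves the part of x' outside of
    S, which is small by the collapse; then 2 a d <= c a^2 + d^2 / c. *)
Lemma unused_form_bound (c : R) : 0 < c ->
  `|2 * formS x' u - formS u u| <= c * frob_norm (perpK x') ^+ 2 + (c^-1 + 1) * total u.
Proof.
move=> c0; set z := x' - projS x'.
have e : formS x' u = - frob_inner z u.
  by rewrite /z frob_innerDl frob_innerNl unused_orth add0r opprK.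
have hz : `|frob_inner z u| <= frob_norm (perpK x') * frob_norm u.
  have h w : frob_norm w <= frob_norm (perpK x') ->
      frob_inner w u <= frob_norm (perpK x') * frob_norm u.
    by move=> hw; apply: le_trans (frob_cauchy _ _) _; rewrite ler_wpM2r ?frob_norm_ge0.
  have oz : frob_norm z <= frob_norm (perpK x') by exact: orth_le_perpK.
  by rewrite ler_norml lerNl -frob_innerNl !h ?frob_normN.
have uu0 : 0 <= formS u u by exact: formS_ge0.
have uu1 : formS u u <= total u.
  by apply: le_trans unused_sqr_le; exact: formS_le.
have tu := unused_sqr_le.
set a := frob_norm (perpK x') in hz *; set d := frob_norm u in hz tu *.
have ci : 0 < c^-1 by rewrite invr_gt0.
have amgm : 2 * (a * d) <= c * a ^+ 2 + c^-1 * d ^+ 2.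
  have : 0 <= c^-1 * (c * a - d) ^+ 2 by rewrite mulr_ge0 ?sqr_ge0// ltW.
  have -> : c^-1 * (c * a - d) ^+ 2 = c * a ^+ 2 - 2 * (a * d) + c^-1 * d ^+ 2.
    by field; rewrite gt_eqF.
  by move=> h; lra.
have h1 : c^-1 * d ^+ 2 <= c^-1 * total u by rewrite ler_pM2l.
rewrite e; move: hz; rewrite !ler_norml => /andP[h2 h3].
by apply/andP; split; lra.
Qed.

End Pointwise.

Lemma totalZ (a : R) (y : 'M[R]_n) : total (a *: y) = a * total y.
Proof.
rewrite /total mulr_sumr; apply: eq_bigr => i _; rewrite mulr_sumr.
by apply: eq_bigr => j _; rewrite mxE.
Qed.

Lemma avg_total_arrival x :
  avg beta alpha x (fun _ b => total (real_arrival R b)) = (1 - eps) * N.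
Proof.
have e (y : 'M[R]_n) : total y = frob_inner (const_mx 1) y.
  by apply: eq_bigr => i _; apply: eq_bigr => j _; rewrite mxE mul1r.
rewrite (_ : (fun _ _ => _) = (fun _ b => frob_inner (const_mx 1) (real_arrival R b))).
  by rewrite (avg_inner_arrival sk) -e totalZ (total_ds hnu).
by apply/funext => s; apply/funext => b; rewrite e.
Qed.

(** The form of the mean gives (1 - eps)^2, and the covariances, concentrated on
    the diagonal, pick out the diagonal of gramS. *)
Lemma avg_form_arrival x :
  avg beta alpha x (fun _ b => formS (real_arrival R b) (real_arrival R b)) =
  (1 - eps) ^+ 2 + (2 / N - N^-2) * total V.
Proof.
rewrite (avg_arrival sk).
have -> : \sum_b alpha b * formS (real_arrival R b) (real_arrival R b) =
  \sum_i \sum_j \sum_k \sum_l @gramS R n i j k l *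
     (\sum_b alpha b * ((b k l)%:R * (b i j)%:R)).
  under eq_bigr do rewrite formS_gram mulr_sumr.
  rewrite exchange_big; apply: eq_bigr => i _ /=; under eq_bigr do rewrite mulr_sumr.
  rewrite exchange_big; apply: eq_bigr => j _ /=; under eq_bigr do rewrite mulr_sumr.
  rewrite exchange_big; apply: eq_bigr => k _ /=; under eq_bigr do rewrite mulr_sumr.
  rewrite exchange_big; apply: eq_bigr => l _ /=; rewrite mulr_sumr.
  by apply: eq_bigr => b _; rewrite !mxE; ring.
set lam := (1 - eps) *: nu.
have ll : formS lam lam = (1 - eps) ^+ 2.
  rewrite /lam formSZr (formSC) formSZr formS_ds// (total_ds hnu) divff// mulr1.
  by rewrite expr2.
rewrite -ll formS_gram /total mulr_sumr -big_split; apply: eq_bigr => i _ /=.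
rewrite mulr_sumr -big_split; apply: eq_bigr => j _ /=.
have -> : (2 / N - N^-2) * V i j = \sum_k \sum_l @gramS R n i j k l *
    (((k == i) && (l == j))%:R * V k l).
  rewrite (bigD1 i)//= [X in _ = _ + X]big1 ?addr0; last first.
    move=> k /negbTE ki; rewrite big1// => l _; by rewrite ki mul0r mulr0.
  rewrite (bigD1 j)//= big1 ?addr0; last first.
    by move=> l /negbTE lj; rewrite lj andbF mul0r mulr0.
  by rewrite /gramS !eqxx /= -/N; ring.
rewrite -big_split; apply: eq_bigr => k _ /=; rewrite -big_split; apply: eq_bigr => l _ /=.
by rewrite (sk_cov sk) mulrDr.
Qed.

(** The mean unused service is the drift of the total queue plus the spare
    capacity eps * n. *)
Lemma total_drift x : P (queue_total \o g) x - queue_total (g x) + eps * N =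
  avg beta alpha x (fun s b => total (unused R (g x) b s)).
Proof.
rewrite /P (avg_step sk) /queue_total.
rewrite (_ : (fun s b => _) = (fun s b => total (real_arrival R b) +
   (total (unused R (g x) b s) + (total (real_mx R (g x)) - N)))); last first.
  by apply/funext => s; apply/funext => b; rewrite total_real_next; ring.
rewrite (@avgD _ _ _ _ beta alpha x (fun s b => total (real_arrival R b))).
rewrite (@avgD _ _ _ _ beta alpha x (fun s b => total (unused R (g x) b s))).
rewrite (avg_cst sk) avg_total_arrival; ring.
Qed.

Lemma one_step_balance (c : R) x : 0 < c ->
  `|P (queue_form \o g) x - queue_form (g x) + 2 * eps * queue_total (g x) / N
    - drift_constant| <=
  c * P (perp_sqr \o g) x +
  (c^-1 + 1) * (P (queue_total \o g) x - queue_total (g x) + eps * N).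
Proof.
move=> c0; rewrite total_drift /P !(avg_step sk).
set y := real_mx R (g x).
pose err (s : 'S_n) (b : 'M['I_amax.+1]_n) := 2 * formS (real_mx R (next_queue (g x) b s)) (unused R (g x) b s) -
  formS (unused R (g x) b s) (unused R (g x) b s).
have -> : avg beta alpha x (fun s b => queue_form (next_queue (g x) b s)) =
    queue_form (g x) - 2 * eps * queue_total (g x) / N + drift_constant +
    avg beta alpha x err.
  rewrite (_ : (fun s b => _) = (fun s b =>
      2 * formS y (real_arrival R b) + (formS (real_arrival R b) (real_arrival R b) +
      (- (2 / N) * total (real_arrival R b) +
      (err s b + (formS y y - 2 * (total y / N) + 1)))))); last first.
    apply/funext => s; apply/funext => b; rewrite /queue_form form_next -/y /err; field.
    exact: N0.
  rewrite (@avg_linear _ _ _ _ beta alpha x 2 (fun s b => formS y (real_arrival R b))).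
  rewrite (@avgD _ _ _ _ beta alpha x
    (fun s b => formS (real_arrival R b) (real_arrival R b))).
  rewrite (@avg_linear _ _ _ _ beta alpha x _ (fun s b => total (real_arrival R b))).
  rewrite (@avgD _ _ _ _ beta alpha x err) (avg_cst sk) avg_form_arrival avg_total_arrival.
  rewrite (_ : avg beta alpha x (fun s b => formS y (real_arrival R b)) =
    (1 - eps) * (total y / N)); last first.
    by rewrite /formS (avg_inner_arrival sk) -/(formS y _) formSZr formS_ds.
  rewrite /drift_constant /queue_form /queue_total -/y; field; exact: N0.
rewrite (_ : _ - drift_constant = avg beta alpha x err); last by ring.
have ub : avg beta alpha x err <= avg beta alpha x
   (fun s b => c * perp_sqr (next_queue (g x) b s) +
               (c^-1 + 1) * total (unused R (g x) b s)).
  apply: (avg_le sk) => s b; apply: le_trans (ler_norm _) _.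
  exact: unused_form_bound.
have lb : - avg beta alpha x err <= avg beta alpha x
   (fun s b => c * perp_sqr (next_queue (g x) b s) +
               (c^-1 + 1) * total (unused R (g x) b s)).
  rewrite -mulN1r -avgZ; apply: (avg_le sk) => s b.
  by rewrite mulN1r (le_trans _ (unused_form_bound _ _ _ c0))// -normrN ler_norm.
move: ub lb; rewrite (@avg_linear _ _ _ _ beta alpha x c
  (fun s b => perp_sqr (next_queue (g x) b s))) avgZ => ub lb.
by rewrite ler_norml lerNl lb ub.
Qed.

Section Limit.
Variables (x0 : S) (mu : probability (natmx n) R) (hmu : limit_law P g mu).
Variables (th rho K : R) (th0 : 0 < th) (r0 : 0 <= rho) (r1 : rho < 1) (K0 : 0 <= K).
Let mP : markov_op P := kernel_mop (sk_p0 sk) (sk_sum sk).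

(** Powers are dominated by the exponential, whose mean obeys the geometric
    drift. *)
Lemma moment_bound (h : S -> R) r (k : nat) : (forall y, 0 <= h y) ->
  (forall y, P (fun y => expR (th * h y)) y <= rho * expR (th * h y) + K) ->
  iter k P (fun y => h y ^+ r.+1) x0 <=
    (r.+1`!)%:R / th ^+ r.+1 * (rho ^+ k * expR (th * h x0) + K / (1 - rho)).
Proof.
move=> h0 hd; have ip := iter_pop (proj1 mP) k.
have c0 : 0 <= (r.+1`!)%:R / th ^+ r.+1 by rewrite divr_ge0// exprn_ge0// ltW.
apply: (@le_trans _ _ (iter k P (fun y => (r.+1`!)%:R / th ^+ r.+1 * expR (th * h y)) x0)).
  apply: (pop_le ip) => y.
  rewrite mulrAC ler_pdivlMr ?exprn_gt0// -exprMn mulrC [th * _]mulrC.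
  by rewrite [h y * th]mulrC pow_le_expR// mulr_ge0// ltW.
rewrite (popZ ip) ler_wpM2l//.
apply: (drift_iter mP (W := fun y => expR (th * h y))) => // y; exact: expR_ge0.
Qed.

Hypothesis qdrift : forall y, P (fun y => expR (th * frob_norm (real_mx R (g y)))) y <=
  rho * expR (th * frob_norm (real_mx R (g y))) + K.

Lemma moment_uniform r : exists B, forall k,
  iter k P (fun y => frob_norm (real_mx R (g y)) ^+ r.+1) x0 <= B.
Proof.
exists ((r.+1`!)%:R / th ^+ r.+1 *
  (expR (th * frob_norm (real_mx R (g x0))) + K / (1 - rho))) => k.
apply: le_trans (moment_bound r k (fun y => frob_norm_ge0 _) qdrift) _.
rewrite ler_wpM2l//; first by rewrite divr_ge0// exprn_ge0// ltW.
by rewrite lerD2r ler_piMl ?expR_ge0// exprn_ile1// ltW.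
Qed.

Lemma poly_limit (f : natmx n -> R) (a : R) r : 0 <= a ->
  (forall q, 0 <= f q) ->
  (forall q, f q ^+ 2 <= a * frob_norm (real_mx R q) ^+ r.+1) ->
  exists l : R, 'E_mu[f]%E = l%:E /\ iter k P (f \o g) x0 @[k --> \oo] --> l.
Proof.
move=> a0 f0 fB; have [B hB] := moment_uniform r.
apply: (limit_law_cvg mP hmu (B := a * B)) => // k.
apply: le_trans (_ : a * iter k P (fun y => frob_norm (real_mx R (g y)) ^+ r.+1) x0 <= _).
  rewrite -(popZ (iter_pop (proj1 mP) k)).
  by apply: (pop_le (iter_pop (proj1 mP) k)) => y; exact: fB.
by rewrite ler_wpM2l.
Qed.

(** Iterating one_step_balance k times and letting k grow removes the differences
    of successive means of the form and of the total queue. *)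
Lemma stationary_balance (c : R) : 0 < c -> exists t phi : R,
  [/\ 'E_mu[queue_total]%E = t%:E, 'E_mu[perp_sqr]%E = phi%:E &
  `|2 * eps * t / N - drift_constant| <= c * phi + (c^-1 + 1) * (eps * N)].
Proof.
move=> c0.
have NN : 0 <= N * N by rewrite mulr_ge0.
have [t [Et ct]] : exists l : R, 'E_mu[queue_total]%E = l%:E /\
    iter k P (queue_total \o g) x0 @[k --> \oo] --> l.
  apply: (poly_limit (a := (N * N) ^+ 2) (r := 1)); first exact: sqr_ge0.
    by move=> q; exact: total_real_ge0.
  move=> q; rewrite -exprMn ler_sqr ?nnegrE ?total_real_ge0//; first exact: total_le_norm.
  by rewrite mulr_ge0// frob_norm_ge0.
have [phi [Ephi cphi]] : exists l : R, 'E_mu[perp_sqr]%E = l%:E /\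
    iter k P (perp_sqr \o g) x0 @[k --> \oo] --> l.
  apply: (poly_limit (a := 1) (r := 3)) => // q; first exact: sqr_ge0.
  rewrite mul1r /perp_sqr -exprM lerXn2r ?nnegrE ?frob_norm_ge0//.
  by have [_ /(_ 0 (@coneK0 R n))] := projKP hn (real_mx R q); rewrite subr0.
have [psi [_ cpsi]] : exists l : R, 'E_mu[queue_form]%E = l%:E /\
    iter k P (queue_form \o g) x0 @[k --> \oo] --> l.
  apply: (poly_limit (a := 1) (r := 3)) => // q; first exact: formS_ge0.
  rewrite mul1r (_ : _ ^+ 4 = (frob_norm (real_mx R q) ^+ 2) ^+ 2); last by rewrite -exprM.
  by rewrite ler_sqr ?nnegrE ?formS_ge0 ?sqr_ge0// formS_le.
exists t, phi; split => //.
pose F k := iter k P (queue_form \o g) x0.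
pose T k := iter k P (queue_total \o g) x0.
pose H k := iter k P (perp_sqr \o g) x0.
have step k : `|F k.+1 - F k + 2 * eps * T k / N - drift_constant| <=
    c * H k.+1 + (c^-1 + 1) * (T k.+1 - T k + eps * N).
  have ip := iter_pop (proj1 mP) k.
  have lin (f : natmx n -> R) : iter k.+1 P (f \o g) x0 = iter k P (P (f \o g)) x0 by rewrite iterSr.
  pose L y := P (queue_form \o g) y - queue_form (g y) + 2 * eps * queue_total (g y) / N
    - drift_constant.
  pose Rh y := c * P (perp_sqr \o g) y +
    (c^-1 + 1) * (P (queue_total \o g) y - queue_total (g y) + eps * N).
  have -> : F k.+1 - F k + 2 * eps * T k / N - drift_constant = iter k P L x0.
    rewrite /L (popB ip) (popD ip) (popB ip) (mop_cst (iter_mop k mP)) -lin.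
    rewrite (_ : (fun y => 2 * eps * queue_total (g y) / N) =
      (fun y => (2 * eps / N) * (queue_total \o g) y)); last first.
      by apply/funext => y /=; ring.
    by rewrite (popZ ip) /F /T; ring.
  have -> : c * H k.+1 + (c^-1 + 1) * (T k.+1 - T k + eps * N) = iter k P Rh x0.
    rewrite /Rh (popD ip) !(popZ ip) (popD ip) (popB ip) (mop_cst (iter_mop k mP)).
    by rewrite -!lin.
  apply: le_trans (pop_abs ip _ _) _; apply: (pop_le ip) => y; exact: one_step_balance.
have sh (u : nat -> R) (l : R) : u @ \oo --> l -> (fun k => u k.+1) @ \oo --> l.
  by move=> h; rewrite cvg_shiftS.
have cL : (fun k => F k.+1 - F k + 2 * eps * T k / N - drift_constant) @ \oo -->
    (psi - psi + 2 * eps * t / N - drift_constant).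
  apply: cvgB; last exact: cvg_cst.
  apply: cvgD; first by apply: cvgB => //; exact: sh.
  by apply: cvgMr_tmp; apply: cvgMl_tmp.
have cR : (fun k => c * H k.+1 + (c^-1 + 1) * (T k.+1 - T k + eps * N)) @ \oo -->
    (c * phi + (c^-1 + 1) * (t - t + eps * N)).
  apply: cvgD; first by apply: cvgMl_tmp; exact: sh.
  apply: cvgMl_tmp; apply: cvgD; last exact: cvg_cst.
  by apply: cvgB => //; exact: sh.
have : `|psi - psi + 2 * eps * t / N - drift_constant| <=
    c * phi + (c^-1 + 1) * (t - t + eps * N).
  by apply: (ler_cvg_to (cvg_norm cL) cR); exact: nearW.
by rewrite !subrr !add0r.
Qed.

End Limit.
End HeavyTraffic.

(** * State space collapse and the heavy traffic limit *)
Section StableSwitch.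
Variables (R : realType) (n : nat) (nu : 'M[R]_n) (amax : nat) (eps : R)
  (sw : switch_system R n) (W2 c : R).
Hypotheses (hn : (0 < n)%N) (hnu : doubly_stochastic nu)
  (c0 : 0 < c) (c1 : c <= 1) (cnu : forall i j, c <= nu i j)
  (eps0 : 0 < eps) (eps1 : eps < 1) (W20 : 0 <= W2).
Hypotheses (hs : is_switch nu amax eps sw) (hA1 : condA1 sw) (hA2 : condA2 sw).
Hypothesis hW : forall (t : nat) (x : state sw),
  let E := @chain _ _ sw t @^-1` [set x] in (0 < prob sw E)%E ->
  (max_weight (queue_of x))%:R - W2 <= cond_expectation (prob sw) E
     (fun w => (frob_inner (queue t w : 'M[nat]_n) (schedule t w))%:R).

Let g := @queue_of _ _ sw.
Let p := @trans _ _ sw.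
Let supp := @next_states R n amax sw.
Let beta := schedule_law hs hA1.
Let alpha := @arrival_law R n amax sw.
Let V : 'M[R]_n := \matrix_(i, j) arrival_variance sw i j.
Let sk : switch_kernel p supp g beta alpha ((1 - eps) *: nu) V := switch_is_kernel hs hA1 hA2.
Let P := kernel_op p supp.
Let mP : markov_op P := kernel_mop (sk_p0 sk) (sk_sum sk).

Let weight x : (max_weight (g x))%:R - W2 <=
  \sum_s beta x s * (frob_inner (g x) (perm_mx s : 'M[nat]_n))%:R.
Proof. exact: (schedule_law_weight hs hA1 hA2 hW). Qed.

Lemma start_state : exists x : state sw, True.
Proof.
have [w _] : exists w : sample sw, True.
  apply: contrapT => no; have : (prob sw setT = 0)%E.
    rewrite (_ : setT = set0) ?measure0//; apply/seteqP; split => // w _.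
    by apply: no; exists w.
  by rewrite probability_setT => /eqP; rewrite onee_eq0.
by exists (chain 0 w).
Qed.

Lemma exp_queue_drift : exists th rho K : R, [/\ 0 < th, 0 <= rho, rho < 1, 0 <= K &
  forall x, P (fun y => expR (th * frob_norm (real_mx R (g y)))) x <=
    rho * expR (th * frob_norm (real_mx R (g x))) + K].
Proof.
have ec0 : 0 < eps * c by rewrite mulr_gt0.
have ec1 : eps * c <= 1 by rewrite mulr_ile1// ltW.
have [th [rho [K [th0 r0 r1 K0 h]]]] := geometric_drift n amax ec0 ec1 W20.
exists th, rho, K; split => //; apply: (h _ _ _ _ _ _ _ _ sk (@real_mx R n)).
- by move=> q q'; rewrite addrC subrK.
- by move=> q i j e; rewrite mxE e.
- move=> x; apply: queue_drift => //.
Qed.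

(** The hypothesis is the conclusion of geometric_drift for the witnesses th, rho and
    K, which are shared by all the systems of the family. *)
Lemma exp_perp_drift th rho K :
  (forall (S : countType) (p : S -> S -> R) (supp : S -> seq S) (g : S -> natmx n)
    (beta : S -> 'S_n -> R) (alpha : 'M['I_amax.+1]_n -> R) (lam V : 'M[R]_n),
  switch_kernel p supp g beta alpha lam V ->
  forall r : natmx n -> 'M[R]_n,
  (forall q q', frob_norm (r q') <= frob_norm (r q + (real_mx R q' - real_mx R q))) ->
  (forall (q : natmx n) i j, q i j = 0%N -> r q i j <= 0) ->
  (forall x, frob_inner (r (g x)) lam -
     \sum_s beta x s * frob_inner (r (g x)) (perm_mx s) <=
     - (c / 2) * frob_norm (r (g x)) + W2) ->
  forall x, kernel_op p supp (fun y => expR (th * frob_norm (r (g y)))) x <=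
    rho * expR (th * frob_norm (r (g x))) + K) ->
  eps * (2 * (frob_norm nu + 1)) <= c ->
  forall x, P (fun y => expR (th * frob_norm (perpK (real_mx R (g y))))) x <=
    rho * expR (th * frob_norm (perpK (real_mx R (g x)))) + K.
Proof.
move=> h epsc; apply: (h _ _ _ _ _ _ _ _ sk (fun q => perpK (real_mx R q))).
- by move=> q q'; exact: perpK_shift.
- move=> q i j e; have [[_ y0] _] := projKP hn (real_mx R q).
  by rewrite /perpK !mxE e sub0r oppr_le0 y0.
- move=> x; apply: perp_drift => //; first exact: (sk_b1 sk).
Qed.

Lemma exp_sublevel_finite (th : R) : 0 < th -> forall r : R,
  finite_set [set x | expR (th * frob_norm (real_mx R (g x))) <= r].
Proof.
move=> th0 r; pose N := Num.bound (`|r| / th).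
apply: (sub_finite_set (B := g @^-1` [set q : natmx n | forall i j, (q i j <= N)%N])).
  move=> x /= h i j.
  have h1 : th * frob_norm (real_mx R (g x)) <= r.
    apply: le_trans h; apply: le_trans (expR_ge1Dx _); by rewrite lerDr.
  have h2 := ler_entry_frob (real_mx R (g x)) i j; rewrite mxE normr_nat in h2.
  have h3 : (g x i j)%:R <= `|r| / th.
    apply: le_trans h2 _; rewrite ler_pdivlMr// mulrC; apply: le_trans h1 _.
    exact: ler_norm.
  have h4 : (g x i j)%:R < N%:R :> R.
    by apply: le_lt_trans h3 (archi_boundP _); rewrite divr_ge0// ltW.
  by rewrite ltr_nat in h4; exact: ltnW.
by apply: (sk_gfin sk); exact: finite_box.
Qed.

Lemma switch_ergodic (f : state sw -> R) (M : R) : (forall y, `|f y| <= M) ->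
  exists l : R, forall x, iter k P f x @[k --> \oo] --> l.
Proof.
have [th [rho [K [th0 r0 r1 K0 h]]]] := exp_queue_drift.
apply: (kernel_ergodic (sk_p0 sk) (sk_us sk) (sk_supp sk) (sk_sum sk) (sk_irr sk)
  (sk_aper sk) (W := fun y => expR (th * frob_norm (real_mx R (g y)))) _ r0 r1 K0 h).
- by move=> y; exact: expR_ge0.
- exact: exp_sublevel_finite.
Qed.

Lemma switch_stable : stable sw.
Proof.
have [th [rho [K [th0 r0 r1 K0 h]]]] := exp_queue_drift.
apply: (kernel_positive_recurrent (sk_p0 sk) (sk_us sk) (sk_supp sk) (sk_sum sk)
  (sk_irr sk) (sk_aper sk) (W := fun y => expR (th * frob_norm (real_mx R (g y)))) _ r0 r1 K0 h).
- by move=> y; exact: expR_ge0.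
- exact: exp_sublevel_finite.
Qed.

Lemma limit_is_steady mu : limit_law P g mu -> steady_state_law sw mu.
Proof.
move=> hmu f [M fM]; have [l [-> hl]] := hmu f M fM.
exact: (process_cvg hs hA1 hA2 fM hl).
Qed.

(** The limits from fixed initial states do not depend on the state, so averaging
    over the initial law gives the same value. *)
Lemma steady_is_limit mu : steady_state_law sw mu -> limit_law P g mu.
Proof.
move=> hmu f M fM.
have [l hl] := @switch_ergodic (f \o g) M (fun y => fM (g y)).
exists l; split => //.
have h1 := hmu f (ex_intro _ M fM).
have h2 := process_cvg hs hA1 hA2 fM hl.
exact: (cvg_unique _ h1 h2).
Qed.

Lemma steady_state_exists : exists mu, steady_state_law sw mu.
Proof.
have [x0 _] := start_state.
have [th [rho [K [th0 r0 r1 K0 h]]]] := exp_queue_drift.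
pose W y := expR (th * frob_norm (real_mx R (g y))).
have W0 y : 0 <= W y by exact: expR_ge0.
have B0 : 0 <= W x0 + K / (1 - rho) by rewrite addr_ge0// divr_ge0// subr_ge0 ltW.
have tight k : iter k P W x0 <= W x0 + K / (1 - rho).
  apply: le_trans (drift_iter mP r0 r1 K0 h k x0) _.
  by rewrite lerD2r ler_piMl// exprn_ile1// ltW.
have [mu hmu] := limit_law_exists g mP switch_ergodic W0 B0 tight (exp_sublevel_finite th0).
by exists mu; exact: limit_is_steady.
Qed.

Section PerpMoments.
Variables (th rho K : R) (th0 : 0 < th) (r0 : 0 <= rho) (r1 : rho < 1) (K0 : 0 <= K).
Hypothesis pd : forall x, P (fun y => expR (th * frob_norm (perpK (real_mx R (g y))))) x <=
    rho * expR (th * frob_norm (perpK (real_mx R (g x)))) + K.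

Lemma perp_moment mu r : steady_state_law sw mu ->
  ('E_mu[fun q => (frob_norm (perpK (real_mx R q)) ^+ r.+1)%R] <=
    ((r.+1`!)%:R / th ^+ r.+1 * (K / (1 - rho)))%:E)%E.
Proof.
move=> /steady_is_limit hmu; have [x0 _] := start_state.
apply: (limit_law_le mP hmu (x0 := x0) (b := fun k => (r.+1`!)%:R / th ^+ r.+1 *
    (rho ^+ k * expR (th * frob_norm (perpK (real_mx R (g x0)))) + K / (1 - rho)))).
- by move=> q; rewrite exprn_ge0// frob_norm_ge0.
- move=> k; apply: (moment_bound sk x0 th0 r0 r1 K0 r k) => // y; exact: frob_norm_ge0.
- apply: cvgMl_tmp; rewrite -[X in _ --> X]add0r.
  apply: cvgD; last exact: cvg_cst.
  rewrite -[X in _ --> X](mul0r (expR (th * frob_norm (perpK (real_mx R (g x0)))))).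
  by apply: cvgMr_tmp; apply: cvg_expr; rewrite ger0_norm.
Qed.

End PerpMoments.

Lemma steady_balance mu (d : R) : steady_state_law sw mu -> 0 < d -> exists t phi : R,
  [/\ 'E_mu[@queue_total R n]%E = t%:E, 'E_mu[@perp_sqr R n]%E = phi%:E &
  `|2 * eps * t / n%:R - drift_constant eps V| <= d * phi + (d^-1 + 1) * (eps * n%:R)].
Proof.
move=> /steady_is_limit hmu d0; have [x0 _] := start_state.
have [th [rho [K [th0 r0 r1 K0 h]]]] := exp_queue_drift.
exact: (stationary_balance hn hnu sk x0 hmu th0 r0 r1 K0 h d0).
Qed.

End StableSwitch.

Section Limits.
Variable R : realType.

Lemma cvg_sumr (T : Type) (F : set_system T) (FF : Filter F) (I : Type) (s : seq I)
    (f : I -> T -> R) (l : I -> R) :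
  (forall i, f i x @[x --> F] --> l i) ->
  (\sum_(i <- s) f i x) @[x --> F] --> \sum_(i <- s) l i.
Proof.
move=> fl; elim: s => [|i s IH].
  by rewrite big_nil; under eq_fun do rewrite big_nil; exact: cvg_cst.
by rewrite big_cons; under eq_fun do rewrite big_cons; apply: cvgD.
Qed.

(** Multiplication by n / 2 turns 2 / n - 1 / n^2 into 1 - 1 / (2 n). *)
Lemma balance_solved (N S phi eps t d : R) : 0 < N ->
  `|2 * eps * t / N - ((2 / N - N^-2) * S + eps ^+ 2)| <=
    d * phi + (d^-1 + 1) * (eps * N) ->
  `|eps * t - (1 - (2 * N)^-1) * S| <=
    N / 2 * (d * phi + (d^-1 + 1) * (eps * N) + eps ^+ 2).
Proof.
move=> N0 h; have Nn : N != 0 by rewrite gt_eqF.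
have -> : eps * t - (1 - (2 * N)^-1) * S = N / 2 *
    ((2 * eps * t / N - ((2 / N - N^-2) * S + eps ^+ 2)) + eps ^+ 2).
  by field.
have N2 : 0 <= N / 2 by rewrite divr_ge0// ltW.
rewrite normrM (ger0_norm N2) ler_wpM2l//; apply: le_trans (ler_normD _ _) _.
by rewrite (ger0_norm (sqr_ge0 _)) lerD2r.
Qed.

End Limits.

Theorem theorem10 (R : realType) (n : nat) (hn : (0 < n)%N)
    (nu : 'M[R]_n) (hnu : doubly_stochastic nu)
    (hnu_min : forall i j, 0 < nu i j)
    (amax : nat)
    (sys : R -> switch_system R n)
    (hsys : forall eps : R, 0 < eps < 1 -> is_switch nu amax eps (sys eps))
    (sigma : 'M[R]_n)
    (hsigma : forall i j,
       arrival_variance (sys eps) i j @[eps --> 0^'+] --> sigma i j ^+ 2)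
    (hPi2 : in_Pi2 sys) :
  achieves_SSC sys /\
  forall qbar : R -> probability (natmx n) R,
    (forall eps : R, 0 < eps < 1 -> steady_state_law (sys eps) (qbar eps)) ->
    (eps%:E * 'E_(qbar eps)[fun q => (\sum_(i < n) \sum_(j < n) (q i j)%:R)%R])%E
      @[eps --> 0^'+]
    --> ((1 - (2 * n%:R)^-1) * frob_norm sigma ^+ 2)%:E.
Proof.
have [c [c0 c1 cnu]] := entry_lower_bound hnu hnu_min.
have [hA [W2 [W20 hW]]] := hPi2.
have c20 : 0 < c / 2 by rewrite divr_gt0.
have c21 : c / 2 <= 1 by rewrite ler_pdivrMr// mul1r (le_trans c1)// ler1n.
have [th [rho [K [th0 r0 r1 K0 hp]]]] := geometric_drift n amax c20 c21 W20.
pose C (r : nat) : R := (r`!)%:R / th ^+ r * (K / (1 - rho)).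
(* for eps <= e1 the reduced load costs at most half of the drift c |z| *)
pose e1 : R := c / (2 * (frob_norm nu + 1)).
have nn : 1 <= frob_norm nu + 1 by rewrite lerDr frob_norm_ge0.
have nu2 : 0 < 2 * (frob_norm nu + 1) by rewrite mulr_gt0// (lt_le_trans ltr01).
have e10 : 0 < e1 by rewrite divr_gt0.
have e11 : e1 < 1 by rewrite ltr_pdivrMr// mul1r; lra.
have small eps : 0 < eps <= e1 -> 0 < eps < 1.
  by move=> /andP[-> h] /=; exact: le_lt_trans e11.
have perp eps mu r : 0 < eps <= e1 -> (0 < r)%N -> steady_state_law (sys eps) mu ->
    ('E_mu[fun q => (frob_norm (perpK (real_mx R q)) ^+ r)%R] <= (C r)%:E)%E.
  move=> he; have hs := hsys _ (small _ he); have [a1 a2] := hA _ (small _ he).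
  have /andP[p0 p1] := small _ he; have /andP[_ he1] := he.
  case: r => // r _ hmu.
  apply: (perp_moment hnu c0 c1 cnu p0 p1 W20 hs a1 a2 (hW _ (small _ he)) th0 r0 r1 K0) => //.
  apply: (exp_perp_drift hn hnu c0 cnu p0 hs a1 a2 (hW _ (small _ he)) hp).
  by rewrite -ler_pdivlMr.
split.
  have ex eps : 0 < eps < 1 -> exists mu, steady_state_law (sys eps) mu.
    move=> he; have [a1 a2] := hA _ he; have /andP[p0 p1] := he.
    exact: (steady_state_exists hnu c0 c1 cnu p0 p1 W20 (hsys _ he) a1 a2 (hW _ he)).
  split=> [eps he|].
    have [a1 a2] := hA _ he; have /andP[p0 p1] := he; split => //.
    exact: (switch_stable hnu c0 c1 cnu p0 p1 W20 (hsys _ he) a1 a2 (hW _ he)).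
  have e1r : 0 < e1 < 1 by rewrite e10.
  pose qb eps : probability (natmx n) R := match pselect (0 < eps < 1) with
    | left h => projT1 (cid (ex eps h)) | right _ => projT1 (cid (ex e1 e1r)) end.
  have qbP eps : 0 < eps < 1 -> steady_state_law (sys eps) (qb eps).
    move=> he; rewrite /qb; case: pselect => // h; exact: (projT2 (cid (ex eps h))).
  exists qb; split => //; exists e1, C; split; first by rewrite e10.
  move=> eps he r rp; apply: (perp eps) => //; apply: qbP; exact: small.
move=> qbar hq.
pose N : R := n%:R; have N0 : 0 < N by rewrite ltr0n.
pose S eps := \sum_i \sum_j arrival_variance (sys eps) i j.
pose L : R := (1 - (2 * N)^-1) * frob_norm sigma ^+ 2.
have SL : (1 - (2 * N)^-1) * S eps @[eps --> 0^'+] --> L.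
  apply: cvgMl_tmp; rewrite frob_norm_sqr; apply: cvg_sumr => i; apply: cvg_sumr => j.
  by rewrite -expr2; exact: hsigma.
pose E eps := ('E_(qbar eps)[fun q => (\sum_(i < n) \sum_(j < n) (q i j)%:R)%R])%E.
have bal eps d : 0 < eps <= e1 -> 0 < d -> exists t : R, E eps = t%:E /\
    `|eps * t - (1 - (2 * N)^-1) * S eps| <=
    N / 2 * (d * C 2%N + (d^-1 + 1) * (eps * N) + eps ^+ 2).
  move=> he d0; have he' := small _ he; have /andP[p0 p1] := he'.
  have [a1 a2] := hA _ he'.
  have [t [phi [Et Ephi h]]] := steady_balance hn hnu c0 c1 cnu p0 p1 W20 (hsys _ he')
    a1 a2 (hW _ he') (hq _ he') d0.
  exists t; split.
    rewrite -Et /E; congr ('E__[_])%E; apply/funext => q.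
    by apply: eq_bigr => i _; apply: eq_bigr => j _; rewrite mxE.
  have phiC : phi <= C 2%N.
    by rewrite -lee_fin -Ephi; apply: (perp eps) => //; exact: hq.
  have eS : total (\matrix_(i, j) arrival_variance (sys eps) i j) = S eps.
    by apply: eq_bigr => i _; apply: eq_bigr => j _; rewrite mxE.
  move: h; rewrite /drift_constant eS => /(balance_solved N0) h.
  apply: le_trans h _; rewrite ler_wpM2l ?divr_ge0 ?(ltW N0)//.
  by rewrite !lerD2r ler_wpM2l// ltW.
have C20 : 0 <= C 2%N.
  by rewrite mulr_ge0// divr_ge0 ?exprn_ge0 ?(ltW th0)// subr_ge0 ltW.
apply: cvg_EFin.
  near=> eps; have he : 0 < eps <= e1.
    apply/andP; split; first by near: eps; exact: nbhs_right_gt.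
    by near: eps; exact: nbhs_right_le.
  by have [t [Et _]] := bal eps 1 he ltr01; rewrite -/(E eps) Et.
apply/cvgrPdist_le => e e0.
(* d is chosen first, against the bound C 2 of the second moment of the
   residual; then eps, against the constant D, which contains 1 / d *)
pose d : R := e / (2 * N * (C 2%N + 1)).
have C21 : 0 < C 2%N + 1 by rewrite ltr_wpDl.
have d0 : 0 < d by rewrite divr_gt0// mulr_gt0// mulr_gt0.
have dC : N / 2 * (d * C 2%N) <= e / 4.
  have -> : e / 4 = N / 2 * (d * (C 2%N + 1)).
    by rewrite /d; field; rewrite !gt_eqF.
  by rewrite ler_pM2l ?divr_gt0// ler_pM2l// lerDl.
pose D : R := N / 2 * ((d^-1 + 1) * N + 1).
have D0 : 0 < D.
  by rewrite mulr_gt0 ?divr_gt0// ltr_wpDl// mulr_ge0 ?(ltW N0)// addr_ge0// invr_ge0 ltW.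
near=> eps.
have eps0 : 0 < eps by near: eps; exact: nbhs_right_gt.
have epsle : eps <= e1 by near: eps; exact: nbhs_right_le.
have he : 0 < eps <= e1 by rewrite eps0.
have [t [Et ht]] := bal eps d he d0.
have epsD : D * eps <= e / 4.
  rewrite mulrC -ler_pdivlMr//; near: eps; apply: nbhs_right_le.
  by rewrite divr_gt0// divr_gt0.
have hL : `|L - (1 - (2 * N)^-1) * S eps| <= e / 2.
  by near: eps; apply: (cvgrPdist_le _ _).1 => //; rewrite divr_gt0.
rewrite /= -/(E eps) Et /=.
have -> : L - eps * t = (L - (1 - (2 * N)^-1) * S eps) - (eps * t - (1 - (2 * N)^-1) * S eps).
  by ring.
apply: le_trans (ler_normB _ _) _.
have sq : eps ^+ 2 <= eps.
  by rewrite expr2 ler_piMl ?(ltW eps0)// (le_trans epsle)// ltW.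
have hR : N / 2 * (d * C 2%N + (d^-1 + 1) * (eps * N) + eps ^+ 2) <=
    N / 2 * (d * C 2%N) + D * eps.
  have -> : N / 2 * (d * C 2%N) + D * eps =
      N / 2 * (d * C 2%N + (d^-1 + 1) * (eps * N) + eps) by rewrite /D; ring.
  by rewrite ler_pM2l ?divr_gt0// lerD2l.
have hE := le_trans ht hR.
lra.
Unshelve. all: by end_near. Qed.
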